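(* The following identities of power series in $q$ hold: \begin{align*} \sum_{n=0}^\infty\left(N^0(1,5,5n+1)-N^0(2,5,5n+1)\right)q^n&=q\frac{J_{10}[q;q^{10}]_\infty}{[q^2,q^4;q^{10}]_\infty},\\ \sum_{n=0}^\infty\left(N^0(1,5,5n+2)-N^0(2,5,5n+2)\right)q^n&=\frac{J_{10}[q^5;q^{10}]_\infty}{[q^2,q^4;q^{10}]_\infty},\\ \sum_{n=0}^\infty\left(N^0(1,5,5n+3)-N^0(2,5,5n+3)\right)q^n&=-\frac{J_{10}[q^3;q^{10}]_\infty}{[q^2,q^4;q^{10}]_\infty}. \end{align*}
   Context: Notation: $(a;q)_\infty=\prod_{n\ge0}(1-aq^n)$, $(a_1,\dots,a_k;q)_\infty=\prod_i(a_i;q)_\infty$, $[a_1,\dots,a_k;q]_\infty=(a_1,q/a_1,\dots,a_k,q/a_k;q)_\infty$ (e.g. $[q^2,q^4;q^{10}]_\infty=(q^2,q^8,q^4,q^6;q^{10})_\infty$), $J_m=(q^m;q^m)_\infty$. An odd Durfee symbol of $n$ is a two-rowed array $\begin{pmatrix}a_1&\cdots&a_s\\ b_1&\cdots&b_t\end{pmatrix}_D$ with a subscript $D\ge 0$ (rows possibly empty), all entries odd positive integers, with $2D+1\ge a_1\ge\cdots\ge a_s$, $2D+1\ge b_1\ge\cdots\ge b_t$ and $n=\sum a_i+\sum b_j+2D^2+2D+1$. Its odd rank is $s-t$. $N^0(m,n)$ is the number of odd Durfee symbols of $n$ with odd rank $m$, and $N^0(m,k,n)=\sum_{t\equiv m\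 (\mathrm{mod}\ k)}N^0(t,n)$. The generating function is $$\sum_{n\ge1}\sum_{m\in\mathbb{Z}}N^0(m,n)z^mq^n=\sum_{n=0}^\infty\frac{q^{2n(n+1)+1}}{(zq;q^2)_{n+1}(z^{-1}q;q^2)_{n+1}},\qquad (a;q)_n=\prod_{j=0}^{n-1}(1-aq^j).$$ *)

(* Defs.v *)
From HB Require Import structures.
From mathcomp Require Import all_boot all_order all_algebra.
From mathcomp Require Import zify.
Set Implicit Arguments.
Unset Strict Implicit.
Unset Printing Implicit Defensive.
Import Order.TTheory GRing.Theory Num.Theory.
Local Open Scope ring_scope.

(** * Odd Durfee symbols *)

Record durfee_array := DurfeeArray
  { top_row : seq nat; bottom_row : seq nat; durfee_sub : nat }.

(* Odd entries are automatically positive. *)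
Definition odd_durfee_row (D : nat) (a : seq nat) : bool :=
  [&& all odd a, sorted geq a & all (fun x => x <= 2 * D + 1)%N a].

Definition odd_durfee_symbol (n : nat) (s : durfee_array) : bool :=
  let D := durfee_sub s in
  [&& odd_durfee_row D (top_row s), odd_durfee_row D (bottom_row s)
    & n == (sumn (top_row s) + sumn (bottom_row s)
            + (2 * D ^ 2 + 2 * D + 1))%N].

Definition odd_rank (s : durfee_array) : int :=
  (size (top_row s))%:Z - (size (bottom_row s))%:Z.

(* The arrays with at most n entries in each row and with all entries and the
   subscript at most n.  By [odd_durfee_symbol_bounded] every odd Durfee symbol
   of n is of this form, so that counting over this finite type loses none. *)
Definition bounded_array (n : nat) : finType :=
  (n.-bseq 'I_n.+1 * n.-bseq 'I_n.+1 * 'I_n.+1)%type.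

Definition array_of n (s : bounded_array n) : durfee_array :=
  DurfeeArray [seq val i | i <- s.1.1] [seq val i | i <- s.1.2] s.2.

Lemma array_of_inj n : injective (@array_of n).
Proof.
move=> [[a b] D] [[a' b'] D'] [] /= /(inj_map val_inj) ea /(inj_map val_inj) eb.
by move/val_inj=> ->; congr (_, _, _); apply/val_inj.
Qed.

Lemma odd_durfee_row_size D a : odd_durfee_row D a -> (size a <= sumn a)%N.
Proof.
case/and3P=> + _ _; elim: a => //= x a IHa /andP[ox /IHa].
by case: x ox => // x _; lia.
Qed.

Lemma all_leq_sumn (a : seq nat) : all (fun x => x <= sumn a)%N a.
Proof.
elim: a => //= x a IHa; rewrite leq_addr /=.
by apply: sub_all IHa => y /leq_trans; apply; apply: leq_addl.
Qed.

Lemma row_bseq n (a : seq nat) : (size a <= n)%N -> (sumn a <= n)%N ->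
  {a' : n.-bseq 'I_n.+1 | [seq val i | i <- a'] = a}.
Proof.
move=> sz su; have szi : (size [seq inord i : 'I_n.+1 | i <- a] <= n)%N.
  by rewrite size_map.
exists (Bseq szi); rewrite /= -map_comp map_id_in // => x xa /=.
by rewrite inordK // ltnS (leq_trans _ su) //; apply: (allP (all_leq_sumn a)).
Qed.

Lemma odd_durfee_symbol_bounded n s :
  odd_durfee_symbol n s -> exists s' : bounded_array n, array_of s' = s.
Proof.
case: s => a b D; rewrite /odd_durfee_symbol /= => /and3P[oa ob /eqP en].
have sa := odd_durfee_row_size oa; have sb := odd_durfee_row_size ob.
have [||a' ea] := @row_bseq n a; [by lia..|].
have [||b' eb] := @row_bseq n b; [by lia..|].
have ltD : (D < n.+1)%N by lia.
by exists (a', b', Ordinal ltD); rewrite /array_of /= ea eb.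
Qed.

(* N^0(m, n) *)
Definition N0 (m : int) (n : nat) : nat :=
  #|[set s : bounded_array n | odd_durfee_symbol n (array_of s)
                               && (odd_rank (array_of s) == m)]|.

Lemma N0_eq0 m n : (n < `|m|)%N -> N0 m n = 0%N.
Proof.
move=> ltnm; apply/eqP; rewrite cards_eq0; apply/eqP/setP => s; rewrite !inE.
apply/negP => /andP[/and3P[_ _ _] /eqP em]; move: ltnm; rewrite -em /odd_rank /=.
rewrite !size_map.
move: (size _) (size _) (size_bseq s.1.1) (size_bseq s.1.2) => x y; lia.
Qed.

(* N^0(m, k, n): by [N0_eq0] only the ranks t = i - n with 0 <= i <= 2n
   contribute to the sum over all integers t congruent to m modulo k. *)
Definition N0mod (m : int) (k n : nat) : nat :=
  \sum_(i < (2 * n).+1 | (i%:Z - n%:Z == m %[mod k])%Z) N0 (i%:Z - n%:Z) n.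

(** * Power series in q with integer coefficients *)

Definition fps := nat -> int.

Definition fps1 : fps := fun n => (n == 0)%N%:R.
Definition fpsX : fps := fun n => (n == 1)%N%:R.
Definition fps_opp (f : fps) : fps := fun n => - f n.
Definition fps_mul (f g : fps) : fps :=
  fun n => \sum_(i < n.+1) f i * g (n - i)%N.

(* The geometric series of 1 - g, which is the inverse of g when g has constant
   term 1, as shown by [fps_mulV]; the coefficient of q^n only involves the
   powers (1 - g)^k with k <= n and the truncation of g at order n. *)
Definition fps_inv (g : fps) : fps :=
  fun n => (\sum_(k < n.+1) (1 - \poly_(i < n.+1) g i) ^+ k)`_n.

Definition fps_div (f g : fps) : fps := fps_mul f (fps_inv g).

(* (q^a; q^b)_oo, for 0 < a and 0 < b.  The factors 1 - q^(a + j b) with j > n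
   do not affect the coefficient of q^n, see [qpochE]. *)
Definition qpoch (a b : nat) : fps :=
  fun n => (\prod_(j < n.+1) (1 - 'X^(a + j * b)) : {poly int})`_n.

(* (q^a_1, ..., q^a_k; q^b)_oo *)
Definition qpochs (s : seq nat) (b : nat) : fps :=
  foldr (fun a f => fps_mul (qpoch a b) f) fps1 s.

(* [q^a_1, ..., q^a_k; q^b]_oo, for 0 < a_i < b *)
Definition qbracket (s : seq nat) (b : nat) : fps :=
  qpochs (flatten [seq [:: a; (b - a)%N] | a <- s]) b.

Definition J (m : nat) : fps := qpoch m m.

Lemma qpochE a b n N : (0 < a)%N -> (0 < b)%N -> (n < N)%N ->
  qpoch a b n = (\prod_(j < N) (1 - 'X^(a + j * b)) : {poly int})`_n.
Proof.
move=> a0 b0; rewrite /qpoch; elim: N => // N IHN.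
rewrite ltnS leq_eqVlt => /orP[/eqP -> //|ltnN].
have leNb : (N <= N * b)%N by rewrite leq_pmulr.
by rewrite [in RHS]big_ord_recr /= mulrBr mulr1 coefB coefMXn ifT ?subr0 ?IHN //; lia.
Qed.

(* Two polynomials agreeing below order N have products with the same property. *)
Lemma coefM_low (p p' r r' : {poly int}) N :
  (forall i, (i <= N)%N -> p`_i = p'`_i) -> (forall i, (i <= N)%N -> r`_i = r'`_i) ->
  forall i, (i <= N)%N -> (p * r)`_i = (p' * r')`_i.
Proof.
move=> ep er i leiN; rewrite !coefM; apply: eq_bigr => j _.
by rewrite ep ?er //; have := ltn_ord j; lia.
Qed.

Lemma coefX_low (p p' : {poly int}) N k :
  (forall i, (i <= N)%N -> p`_i = p'`_i) ->
  forall i, (i <= N)%N -> (p ^+ k)`_i = (p' ^+ k)`_i.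
Proof.
by move=> ep; elim: k => [|k IHk] // i; rewrite !exprS; apply: coefM_low.
Qed.

Lemma coefX_eq0 (p : {poly int}) k i :
  p`_0 = 0 -> (i < k)%N -> (p ^+ k)`_i = 0.
Proof.
move=> p0; elim: k i => // k IHk i ltik; rewrite exprS coefM big1 // => j _.
case: (posnP j) => [->|j0]; first by rewrite p0 mul0r.
by rewrite IHk ?mulr0 //; have := ltn_ord j; lia.
Qed.

Lemma fps_mulV g : g 0%N = 1 -> fps_mul g (fps_inv g) =1 fps1.
Proof.
move=> g0 n; pose p : {poly int} := \poly_(i < n.+1) g i; pose u := 1 - p.
have u0 : u`_0 = 0 by rewrite coefB coef1 coef_poly /= g0 subrr.
have einv i : (i <= n)%N -> fps_inv g i = (\sum_(k < n.+1) u ^+ k)`_i.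
  move=> lein; rewrite /fps_inv !coef_sum.
  rewrite (@big_ord_widen _ _ _ i.+1 n.+1 (fun k => ((1 - \poly_(i < i.+1) g i) ^+ k)`_i) lein).
  rewrite [RHS](bigID (fun k : 'I_n.+1 => (k < i.+1)%N)) /= [X in _ = _ + X]big1 ?addr0.
    apply: eq_bigr => k _; apply: (@coefX_low _ _ i) => // j leji.
    by rewrite !coefB !coef_poly !ltnS leji (leq_trans leji lein).
  by move=> k; rewrite -leqNgt => ltik; apply: coefX_eq0.
have -> : fps_mul g (fps_inv g) n = (p * \sum_(k < n.+1) u ^+ k)`_n.
  rewrite coefM; apply: eq_bigr => i _.
  by rewrite coef_poly ltn_ord einv // leq_subr.
have -> : p = 1 - u by rewrite opprB addrC subrK.
by rewrite -opprB mulNr -subrX1 opprB coefB coef1 (coefX_eq0 u0) // subr0.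
Qed.

(* Main.v *)
From HB Require Import structures.
Require Import Defs.
From mathcomp Require Import all_boot all_order all_algebra.
From mathcomp Require Import all_field.
From mathcomp Require Import boolp classical_sets fsbigop zify ring.
Set Implicit Arguments.
Unset Strict Implicit.
Unset Printing Implicit Defensive.
Import Order.TTheory GRing.Theory Num.Theory.
Local Open Scope ring_scope.

(** The proof works with power series in q over the algebraic numbers, and with
    the theta series [theta k], the sum over all integers m of
    (-1)^m q^(5 m^2 + (k - 5) m).  Jacobi's [triple_product] identifies [theta k]
    with J_10 [q^k; q^10]; it is proved as a limit of the q-binomial theorem.

    Symbols.  The two rows of an odd Durfee symbol are independent, so that for
    z^5 = 1 the sum over t of z^t N^0(t, 5, n) is the coefficient of q^n in the
    sum over D of q^(2 D^2 + 2 D + 1) / \prod_(i <= D) (1 - z x_i) (1 - x_i / z),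
    where x_i = q^(2 i + 1) ([rank_series_N0mod]).  Expand each product in
    partial fractions in z ([rank_partial_fractions]) and exchange the sums: the
    coefficient of each pole is an instance of the Durfee identity [durfee], and
    J_2 times the series becomes the Lambert series
      \sum_m (-1)^m q^(3 m^2 + 3 m + 1) (1 / (1 - z x_m) + (x_m / z) / (1 - x_m / z))
    ([rank_series_lambert]).  As this holds for the five fifth roots of unity z,
    the residue classes of the rank can be separated ([rank_class_lambert]).
    With H the generating series of N^0(1, 5, n) - N^0(2, 5, n), the outcome is
    an equation J_2 H = L with L an explicit Lambert series ([rank_difference]).

    Residue classes of n.  Write w = q^5.  Multiplied by J_10, which is J_2 at w, the
    equation becomes J_2 J_10 H = J_2(w) L.  Here J_2 J_10 is
      theta 2 * theta 4 = A^2 - q^2 A B - q^4 B^2,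
    where A and B are the series theta 4 and theta 2 at w ([theta_dissection]),
    and L splits into five sums of Lambert series in w ([Lser_dissection]).  Comparison
    of the five residue classes of exponents gives five linear equations for the
    five sections of H.  Elimination of the sections 0 and 4 leaves three
    equations for the sections 1, 2, 3 of the theorem; their determinant has
    constant term 1, so they have at most one solution, and it remains to verify
    the claimed one ([sections_of_quotient]).

    Verification.  The Lambert series on the right of the three equations are
    combinations of those in the partial fraction expansion of
    1 / [q^a, q^b, q^c; q^10] for the triples 1, 3, 9; 1, 5, 7; 1, 3, 7 and
    1, 3, 5 ([lambert_partial_fractions]), so that they are products of theta
    series.  The equations are then the three identities [theta_I0], [theta_I3]
    and [theta_I4] between theta series.  These follow from the four three-term
    relations [theta_rel1] to [theta_rel4], which hold because each product of
    two theta series is a 2 x 2 determinant ([theta_mul]). *)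

(** * The ring of formal power series *)

Definition pseries (R : Type) : Type := nat -> R.

HB.instance Definition _ R := gen_eqMixin (pseries R).
HB.instance Definition _ R := gen_choiceMixin (pseries R).

Lemma pseriesP (R : Type) (f g : pseries R) : (forall n, f n = g n) -> f = g.
Proof. by move=> e; apply: funext. Qed.

Section Ring.
Variable R : comNzRingType.
Implicit Types f g h : pseries R.

Definition ps0 : pseries R := fun=> 0.
Definition ps1 : pseries R := fun n => (n == 0)%N%:R.
Definition ps_opp f : pseries R := fun n => - f n.
Definition ps_add f g : pseries R := fun n => f n + g n.
Definition ps_mul f g : pseries R := fun n => \sum_(i < n.+1) f i * g (n - i)%N.

Fact ps_addA : associative ps_add.
Proof. by move=> f g h; apply: pseriesP => n; apply: addrA. Qed.
Fact ps_addC : commutative ps_add.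
Proof. by move=> f g; apply: pseriesP => n; apply: addrC. Qed.
Fact ps_add0 : left_id ps0 ps_add.
Proof. by move=> f; apply: pseriesP => n; apply: add0r. Qed.
Fact ps_addN : left_inverse ps0 ps_opp ps_add.
Proof. by move=> f; apply: pseriesP => n; apply: addNr. Qed.

HB.instance Definition _ :=
  GRing.isZmodule.Build (pseries R) ps_addA ps_addC ps_add0 ps_addN.

Definition trunc n f : {poly R} := \poly_(i < n) f i.

Lemma coef_trunc n f i : (i < n)%N -> (trunc n f)`_i = f i.
Proof. by move=> ltin; rewrite coef_poly ltin. Qed.

(** Up to order n, a product of series is a product of polynomials; the ring laws
    of series are inherited from polynomials in this way. *)
Lemma ps_mul_coef f g (p r : {poly R}) n :
  (forall i, (i <= n)%N -> p`_i = f i) -> (forall i, (i <= n)%N -> r`_i = g i) ->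
  forall i, (i <= n)%N -> (p * r)`_i = ps_mul f g i.
Proof.
move=> ep er i lein; rewrite coefM; apply: eq_bigr => j _.
by rewrite ep ?er //; have := ltn_ord j; lia.
Qed.

Fact ps_mulC : commutative ps_mul.
Proof.
move=> f g; apply: pseriesP => n.
have tr h i : (i <= n)%N -> (trunc n.+1 h)`_i = h i by move=> ?; apply: coef_trunc.
by rewrite -(ps_mul_coef (tr f) (tr g)) // mulrC (ps_mul_coef (tr g) (tr f)).
Qed.

Fact ps_mulA : associative ps_mul.
Proof.
move=> f g h; apply: pseriesP => n.
have tr k i : (i <= n)%N -> (trunc n.+1 k)`_i = k i by move=> ?; apply: coef_trunc.
rewrite -(ps_mul_coef (tr f) (ps_mul_coef (tr g) (tr h))) // mulrA.
by rewrite (ps_mul_coef (ps_mul_coef (tr f) (tr g)) (tr h)).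
Qed.

Fact ps_mul1 : left_id ps1 ps_mul.
Proof.
move=> f; apply: pseriesP => n; rewrite /ps_mul big_ord_recl big1 => [|i _].
  by rewrite addr0 mul1r subn0.
by rewrite /ps1 /= mul0r.
Qed.

Fact ps_mulDl : left_distributive ps_mul ps_add.
Proof.
move=> f g h; apply: pseriesP => n; rewrite /ps_mul /ps_add -big_split.
by apply: eq_bigr => i _; rewrite mulrDl.
Qed.

Fact ps_oner_neq0 : ps1 != 0.
Proof. by apply/eqP => /(congr1 (@^~ 0%N)) /eqP; rewrite oner_eq0. Qed.

HB.instance Definition _ := GRing.Zmodule_isComNzRing.Build (pseries R)
  ps_mulA ps_mulC ps_mul1 ps_mulDl ps_oner_neq0.

Lemma coef0ps n : (0 : pseries R) n = 0. Proof. by []. Qed.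
Lemma coef1ps n : (1 : pseries R) n = (n == 0)%N%:R. Proof. by []. Qed.
Lemma coefDps f g n : (f + g) n = f n + g n. Proof. by []. Qed.
Lemma coefNps f n : (- f) n = - f n. Proof. by []. Qed.
Lemma coefBps f g n : (f - g) n = f n - g n. Proof. by []. Qed.
Lemma coefMps f g n : (f * g) n = \sum_(i < n.+1) f i * g (n - i)%N. Proof. by []. Qed.
Lemma coef_sumps I (s : seq I) (P : pred I) (F : I -> pseries R) n :
  (\sum_(i <- s | P i) F i) n = \sum_(i <- s | P i) F i n.
Proof. exact: (big_morph (fun f : pseries R => f n) (fun f g => coefDps f g n)). Qed.

Lemma psM_coef f g (p r : {poly R}) n :
  (forall i, (i <= n)%N -> p`_i = f i) -> (forall i, (i <= n)%N -> r`_i = g i) ->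
  forall i, (i <= n)%N -> (p * r)`_i = (f * g) i.
Proof. exact: ps_mul_coef. Qed.

Definition psC (c : R) : pseries R := fun n => if n is 0 then c else 0.

Lemma coefCM c f n : (psC c * f) n = c * f n.
Proof.
rewrite coefMps big_ord_recl big1 => [|i _]; last by rewrite /= mul0r.
by rewrite addr0 subn0.
Qed.

Fact psC_zmod : zmod_morphism psC.
Proof. by move=> a b; apply: pseriesP => -[|n]; rewrite coefBps //= subr0. Qed.
Fact psC_monoid : monoid_morphism psC.
Proof.
split=> [|a b]; first by apply: pseriesP => -[].
by apply: pseriesP => -[|n]; rewrite coefCM //= mulr0.
Qed.
HB.instance Definition _ := GRing.isZmodMorphism.Build R (pseries R) psC psC_zmod.
HB.instance Definition _ := GRing.isMonoidMorphism.Build R (pseries R) psC psC_monoid.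

Definition pq : pseries R := fun n => (n == 1)%N%:R.

Lemma coef_pqM f n : (pq * f) n = if n is n'.+1 then f n' else 0.
Proof.
rewrite coefMps; case: n => [|n]; first by rewrite big_ord1 mul0r.
rewrite big_ord_recl mul0r add0r big_ord_recl big1 => [|i _]; last by rewrite mul0r.
by rewrite addr0 mul1r /= /bump /= subSS subn0.
Qed.

Lemma coef_pqXM k f n : (pq ^+ k * f) n = if (n < k)%N then 0 else f (n - k)%N.
Proof.
elim: k n => [|k IHk] n; first by rewrite mul1r subn0.
by rewrite exprS -mulrA coef_pqM; case: n => [|n] //; rewrite IHk.
Qed.

Lemma coef_pqX k n : (pq ^+ k) n = (n == k)%:R.
Proof.
rewrite -[_ ^+ _]mulr1 coef_pqXM coef1ps subn_eq0.
by case: (ltngtP n k).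
Qed.

Lemma pq_neq0 : pq != 0.
Proof. by apply/eqP => /(congr1 (@^~ 1%N)) /eqP; rewrite oner_eq0. Qed.

Lemma pq_inj : injective (fun k => pq ^+ k).
Proof.
move=> k l /(congr1 (@^~ l)); rewrite !coef_pqX eqxx.
by case: eqP => // _ /eqP; rewrite eq_sym oner_eq0.
Qed.

(** ** Congruence modulo a power of the variable *)

Definition eqm N f g := forall i, (i < N)%N -> f i = g i.

Lemma eqm_refl N f : eqm N f f. Proof. by []. Qed.
Lemma eqm_sym N f g : eqm N f g -> eqm N g f.
Proof. by move=> e i /e. Qed.
Lemma eqm_trans N f g h : eqm N f g -> eqm N g h -> eqm N f h.
Proof. by move=> e e' i iN; rewrite e ?e'. Qed.
Lemma eqmW N M f g : (M <= N)%N -> eqm N f g -> eqm M f g.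
Proof. by move=> leMN e i iM; apply: e; lia. Qed.
Lemma eqmD N f f' g g' : eqm N f f' -> eqm N g g' -> eqm N (f + g) (f' + g').
Proof. by move=> e e' i iN; rewrite !coefDps e ?e'. Qed.
Lemma eqmN N f f' : eqm N f f' -> eqm N (- f) (- f').
Proof. by move=> e i iN; rewrite !coefNps e. Qed.
Lemma eqmM N f f' g g' : eqm N f f' -> eqm N g g' -> eqm N (f * g) (f' * g').
Proof.
move=> e e' i iN; rewrite !coefMps; apply: eq_bigr => j _.
by rewrite e ?e' //; have := ltn_ord j; lia.
Qed.
Lemma eqm_sum N I (s : seq I) (P : pred I) (F G : I -> pseries R) :
  (forall i, P i -> eqm N (F i) (G i)) ->
  eqm N (\sum_(i <- s | P i) F i) (\sum_(i <- s | P i) G i).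
Proof.
by move=> e i iN; rewrite !coef_sumps; apply: eq_bigr => j Pj; apply: e.
Qed.
Lemma eqm_pqX N k f : (N <= k)%N -> eqm N (pq ^+ k * f) 0.
Proof. by move=> leNk i iN; rewrite coef_pqXM ifT //; lia. Qed.

Lemma coef0M f g : (f * g) 0%N = f 0%N * g 0%N.
Proof. by rewrite coefMps big_ord1. Qed.
Lemma coef0_prod I (s : seq I) (P : pred I) (F : I -> pseries R) :
  (\prod_(i <- s | P i) F i) 0%N = \prod_(i <- s | P i) F i 0%N.
Proof. by apply: (big_morph (fun f : pseries R => f 0%N) coef0M). Qed.
Lemma coef0X f k : (f ^+ k) 0%N = f 0%N ^+ k.
Proof. by elim: k => // k IHk; rewrite !exprS coef0M IHk. Qed.

Lemma eqm_exp0 f k : f 0%N = 0 -> eqm k (f ^+ k) 0.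
Proof.
move=> f0; elim: k => // k IHk i ik; rewrite exprS coefMps big1 // => j _.
case: (posnP j) => [->|j0]; first by rewrite f0 mul0r.
by rewrite IHk ?mulr0 //; have := ltn_ord j; lia.
Qed.

(** Substitution of q^d for q. *)
Definition dil d f : pseries R := fun n => if (d %| n)%N then f (n %/ d)%N else 0.

End Ring.

Section Field.
Variable R : fieldType.
Implicit Types f g h : pseries R.

(** The geometric series of 1 - f / f_0, whose k-th term only contributes to the
    coefficients of q^n with n >= k.  Series without inverse are left unchanged,
    as a ring with units demands. *)
Definition ps_inv f : pseries R :=
  if f 0%N == 0 then f else
  fun n => (\sum_(k < n.+1) psC (f 0%N)^-1 * (1 - psC (f 0%N)^-1 * f) ^+ k) n.

Fact ps_mulV f : f 0%N != 0 -> ps_inv f * f = 1.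
Proof.
move=> f0; rewrite /ps_inv (negPf f0); set c := psC _; set u := 1 - c * f.
have u0 : u 0%N = 0 by rewrite /u coefBps coefCM coef1ps mulVf ?subrr.
set g := (X in X * f = _).
have cf : c * f = 1 - u by rewrite /u; ring.
apply: pseriesP => n.
have eg : eqm n.+1 g (c * \sum_(k < n.+1) u ^+ k).
  move=> i iN; rewrite /g -mulr_sumr !coefCM; congr (_ * _); rewrite !coef_sumps.
  rewrite (@big_ord_widen _ _ _ i.+1 n.+1 (fun k => (u ^+ k) i)) //.
  rewrite [RHS](bigID (fun k : 'I_n.+1 => (k < i.+1)%N)) /= [X in _ = _ + X]big1 ?addr0 //.
  by move=> k; rewrite -leqNgt => ik; rewrite eqm_exp0.
rewrite (eqmM eg (@eqm_refl _ n.+1 f)) // mulrAC cf -opprB mulNr -subrX1.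
by rewrite opprB coefBps (eqm_exp0 u0) ?subr0.
Qed.

Definition ps_unit := [pred f : pseries R | f 0%N != 0].

Fact ps_mulVx : {in ps_unit, left_inverse 1 ps_inv *%R}.
Proof. by move=> f; apply: ps_mulV. Qed.
Fact ps_unitP f g : g * f = 1 -> ps_unit f.
Proof.
move=> /(congr1 (@^~ 0%N)); rewrite coef0M coef1ps /= => e.
by apply: contra_eq_neq e => ->; rewrite mulr0 eq_sym oner_eq0.
Qed.
Fact ps_inv0id : {in [predC ps_unit], ps_inv =1 id}.
Proof. by move=> f; rewrite !inE negbK /ps_inv => ->. Qed.

HB.instance Definition _ := GRing.ComNzRing_hasMulInverse.Build (pseries R)
  ps_mulVx ps_unitP ps_inv0id.

Lemma ps_unitE f : (f \is a GRing.unit) = (f 0%N != 0). Proof. by []. Qed.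

Lemma ps_low f : f != 0 -> exists k g, f = pq R ^+ k * g /\ g 0%N != 0.
Proof.
move=> f0; have /existsNP[n fn] : ~ forall n, f n = 0.
  by move=> e; case/eqP: f0; apply: pseriesP.
have exf : exists n, f n != 0 by exists n; apply/eqP.
case: (ex_minnP exf) => k fk mk; exists k, (fun n => f (n + k)%N); split=> //.
apply: pseriesP => i; rewrite coef_pqXM; case: ltnP => [ik|ki]; last by rewrite subnK.
by apply: contraTeq ik => /mk; rewrite -leqNgt.
Qed.

Fact ps_idomain : GRing.integral_domain_axiom (pseries R).
Proof.
move=> f g fg0; apply/norP => -[/ps_low[k [f' [ef f0]]] /ps_low[l [g' [eg g0]]]].
have /(congr1 (@^~ (k + l)%N)) := fg0.
rewrite ef eg mulrACA -exprD coef_pqXM ltnn subnn coef0M coef0ps => /eqP.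
by rewrite mulf_eq0 (negPf f0) (negPf g0).
Qed.

HB.instance Definition _ :=
  GRing.ComUnitRing_isIntegral.Build (pseries R) ps_idomain.

Lemma eqmV N f g : f 0%N != 0 -> g 0%N != 0 -> eqm N f g -> eqm N f^-1 g^-1.
Proof.
move=> f0 g0 e; have fU : f \is a GRing.unit by [].
have gU : g \is a GRing.unit by [].
have -> : f^-1 = f^-1 * g * g^-1 by rewrite mulrK.
have {2}-> : g^-1 = f^-1 * f * g^-1 by rewrite mulVr // mul1r.
by apply: eqmM => //; apply: eqmM => //; apply: eqm_sym.
Qed.

End Field.

(** ** Limits, infinite sums and infinite products *)

Section Limits.
Variable R : fieldType.
Implicit Types f g h : pseries R.
Local Notation q := (pq R).

Definition pcvg (u : nat -> pseries R) f :=
  forall N, exists K, forall M, (K <= M)%N -> eqm N (u M) f.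

Lemma pcvg_uniq u f g : pcvg u f -> pcvg u g -> f = g.
Proof.
move=> uf ug; apply: pseriesP => n.
have [K uK] := uf n.+1; have [L uL] := ug n.+1.
have le1 : (K <= K + L)%N by lia.
have le2 : (L <= K + L)%N by lia.
by rewrite -(uK _ le1) // -(uL _ le2).
Qed.

Lemma pcvg_cst f : pcvg (fun=> f) f.
Proof. by move=> N; exists 0%N. Qed.

Lemma pcvg_ext u v f : (forall M, u M = v M) -> pcvg u f -> pcvg v f.
Proof. by move=> e cu N; have [K uK] := cu N; exists K => M /uK; rewrite e. Qed.

Lemma pcvg_ev u v (f : pseries R) K :
  (forall M, (K <= M)%N -> u M = v M) -> pcvg u f -> pcvg v f.
Proof.
move=> e uf N; have [L uL] := uf N; exists (maxn K L) => M leM.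
by rewrite -e; [apply: uL|]; lia.
Qed.

Lemma pcvg_op2 (op : pseries R -> pseries R -> pseries R) :
  (forall N f f' g g', eqm N f f' -> eqm N g g' -> eqm N (op f g) (op f' g')) ->
  forall u v f g, pcvg u f -> pcvg v g -> pcvg (fun M => op (u M) (v M)) (op f g).
Proof.
move=> opP u v f g uf vg N; have [K uK] := uf N; have [L vL] := vg N.
by exists (maxn K L) => M leM; apply: opP; [apply: uK|apply: vL]; lia.
Qed.
Definition pcvgD := pcvg_op2 (@eqmD R).
Definition pcvgM := pcvg_op2 (@eqmM R).

Lemma pcvgV u f : f 0%N != 0 -> pcvg u f -> pcvg (fun M => (u M)^-1) f^-1.
Proof.
move=> f0 uf N; have [K uK] := uf N.+1; exists K => M /uK e.
by apply: eqmV => //; [rewrite e|apply: eqmW e].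
Qed.

Lemma pcvg_comp u f (phi : nat -> nat) :
  (forall M, exists K, forall n, (K <= n)%N -> (M <= phi n)%N) ->
  pcvg u f -> pcvg (u \o phi) f.
Proof.
move=> phiP uf N; have [K uK] := uf N; have [L phiL] := phiP K.
by exists L => M /phiL; apply: uK.
Qed.

Definition summable (F : nat -> pseries R) := forall k, eqm k (F k) 0.

(** The sum of all F k, for F [summable]: then F k starts at order k or later, and
    the terms with k > n do not affect the coefficient of q^n. *)
Definition nsum (F : nat -> pseries R) : pseries R :=
  fun n => (\sum_(k < n.+1) F k) n.

Lemma nsumE F N : summable F -> eqm N (nsum F) (\sum_(k < N) F k).
Proof.
move=> sF n nN; rewrite /nsum !coef_sumps.
rewrite (@big_ord_widen _ _ _ n.+1 N (fun k => F k n)) //.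
rewrite [RHS](bigID (fun k : 'I_N => (k < n.+1)%N)) /= [X in _ = _ + X]big1 ?addr0 //.
by move=> k; rewrite -leqNgt => nk; rewrite sF.
Qed.

Lemma eq_nsum F G : (forall k, F k = G k) -> nsum F = nsum G.
Proof. by move=> e; congr nsum; apply: funext. Qed.

Lemma nsumD F G : nsum (fun k => F k + G k) = nsum F + nsum G.
Proof. by apply: pseriesP => n; rewrite coefDps /nsum big_split. Qed.

Lemma nsumN F : nsum (fun k => - F k) = - nsum F.
Proof. by apply: pseriesP => n; rewrite coefNps /nsum sumrN. Qed.

Lemma summableM f F : summable F -> summable (fun k => f * F k).
Proof. by move=> sF k; rewrite -(mulr0 f); apply: eqmM. Qed.

Lemma nsumM f F : summable F -> f * nsum F = nsum (fun k => f * F k).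
Proof.
move=> sF; apply: pseriesP => n.
rewrite (eqmM (@eqm_refl _ n.+1 f) (nsumE (N:=n.+1) sF)) //.
by rewrite mulr_sumr -(nsumE (N:=n.+1) (summableM f sF)).
Qed.

Lemma nsum_cvg F : summable F -> pcvg (fun M => \sum_(k < M) F k) (nsum F).
Proof.
move=> sF N; exists N => M leM; apply: eqm_sym; apply: (@eqmW _ M N) => //.
exact: nsumE.
Qed.

(** Dominated convergence for series: the bound on the order of the terms plays
    the part of the dominating function. *)
Lemma tannery (G : nat -> nat -> pseries R) F (phi : nat -> nat) :
  (forall n, (n <= phi n)%N) ->
  (forall M, summable (G M)) -> (forall k, pcvg (G^~ k) (F k)) ->
  pcvg (fun M => \sum_(k < phi M) G M k) (nsum F).
Proof.
move=> phiP sG cG N.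
have sF : summable F.
  move=> k; have [K GK] := cG k k; apply: eqm_trans (sG K k).
  by apply: eqm_sym; apply: GK.
have [K GK] : exists K, forall M k, (K <= M)%N -> (k < N)%N -> eqm N (G M k) (F k).
  elim: {-2}N => [|n [K GK]]; first by exists 0%N.
  have [L GL] := cG n N; exists (maxn K L) => M k leM; rewrite ltnS leq_eqVlt.
  by case/orP=> [/eqP->|]; [apply: GL|apply: GK]; lia.
exists (K + N)%N => M leM; apply: eqm_trans (eqm_sym (nsumE (N:=N) sF)).
apply: (@eqm_trans _ _ _ (\sum_(k < N) G M k)); last first.
  by apply: eqm_sum => k _; apply: GK; have := ltn_ord k; lia.
have leN : (N <= phi M)%N by apply: leq_trans (phiP M); lia.
rewrite (@big_ord_widen _ _ _ N (phi M) (G M)) //.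
rewrite (bigID (fun k : 'I__ => (k < N)%N)) /= -[X in eqm _ _ X]addr0.
apply: eqmD => // i iN; rewrite coef_sumps big1 // => k; rewrite -leqNgt => Nk.
by rewrite sG //; lia.
Qed.

(** ** Pochhammer symbols *)

(** The products (q^a; q^b)_N and (q^a; q^b)_oo. *)
Definition pochN (a b N : nat) : pseries R := \prod_(j < N) (1 - q ^+ (a + j * b)).
Definition poch (a b : nat) : pseries R := fun n => pochN a b n.+1 n.

Lemma pochN0 a b : pochN a b 0 = 1. Proof. exact: big_ord0. Qed.

Lemma pochNS a b N : pochN a b N.+1 = pochN a b N * (1 - q ^+ (a + N * b)).
Proof. exact: big_ord_recr. Qed.

Lemma coef0_1mX k : (0 < k)%N -> (1 - q ^+ k) 0%N = 1.
Proof. by case: k => // k _; rewrite coefBps coef_pqX subr0. Qed.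

Lemma pochN_coef0 a b N : (0 < a)%N -> pochN a b N 0%N = 1.
Proof. by move=> a0; rewrite /pochN coef0_prod big1 // => j _; rewrite coef0_1mX //; lia. Qed.

Lemma pochN_unit a b N : (0 < a)%N -> pochN a b N \is a GRing.unit.
Proof. by move=> a0; rewrite ps_unitE pochN_coef0 ?oner_eq0. Qed.

Lemma pochN_eqm a b N M : (0 < a)%N -> (0 < b)%N -> (N <= M)%N ->
  eqm N (pochN a b M) (pochN a b N).
Proof.
move=> a0 b0; elim: M => [|M IHM]; first by rewrite leqn0 => /eqP->.
rewrite leq_eqVlt => /orP[/eqP<- //|]; rewrite ltnS => NM.
rewrite pochNS mulrBr mulr1 -[X in eqm _ _ X]subr0.
apply: eqmD; first exact: IHM.
have leMb : (M <= M * b)%N by rewrite leq_pmulr.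
by apply: eqmN; rewrite mulrC; apply: eqm_pqX; lia.
Qed.

Lemma poch_cvg a b : (0 < a)%N -> (0 < b)%N -> pcvg (pochN a b) (poch a b).
Proof.
move=> a0 b0 N; exists N => M leM i iN.
have le1 : (i.+1 <= M)%N by lia.
by rewrite /poch (pochN_eqm a0 b0 le1).
Qed.

Lemma poch_coef0 a b : (0 < a)%N -> poch a b 0%N = 1.
Proof. by move=> a0; rewrite /poch pochN_coef0. Qed.

Lemma poch_unit a b : (0 < a)%N -> poch a b \is a GRing.unit.
Proof. by move=> a0; rewrite ps_unitE poch_coef0 ?oner_eq0. Qed.

(** ** Substitution of q^d for q, and extraction of every d-th coefficient *)

Section Dilation.
Variable d : nat.
Hypothesis d0 : (0 < d)%N.

Fact dil_zmod : zmod_morphism (@dil R d).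
Proof.
by move=> f g; apply: pseriesP => n; rewrite [RHS]coefBps /dil; case: ifP => // _; rewrite subr0.
Qed.

Lemma coef_trunc_comp f n i : (i <= n)%N -> (trunc n.+1 f \Po 'X^d)`_i = dil d f i.
Proof.
move=> lein; rewrite coef_comp_poly_Xn // /dil; case: ifP => // _.
by rewrite coef_trunc // ltnS (leq_trans (leq_div _ _)).
Qed.

Fact dil_monoid : monoid_morphism (@dil R d).
Proof.
split=> [|f g]; apply: pseriesP => n.
  rewrite /dil !coef1ps; case: ifP => [/dvdnP[k ->]|]; first by rewrite mulnK // muln_eq0 (gtn_eqF d0) orbF.
  by case: eqP => // ->; rewrite dvdn0.
rewrite -(psM_coef (@coef_trunc_comp f n) (@coef_trunc_comp g n)) //.
rewrite -comp_polyM coef_comp_poly_Xn // /dil; case: ifP => // dn.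
have tr h i : (i <= n)%N -> (trunc n.+1 h)`_i = h i by move=> ?; apply: coef_trunc.
by rewrite -(psM_coef (tr f) (tr g)) // leq_div.
Qed.

Definition sect c f : pseries R := fun n => f (n * d + c)%N.

Lemma sectD c f g : sect c (f + g) = sect c f + sect c g. Proof. by []. Qed.
Lemma sectN c f : sect c (- f) = - sect c f. Proof. by []. Qed.

Lemma sect_dilM c g f : (c < d)%N -> sect c (dil d g * f) = g * sect c f.
Proof.
move=> cd; apply: pseriesP => n; rewrite /sect !coefMps.
rewrite (bigID (fun i : 'I__ => d %| i)%N) /= addrC big1 => [|i /negPf di]; last first.
  by rewrite /dil di mul0r.
have bnd (i : 'I_n.+1) : (i * d < (n * d + c).+1)%N by have := ltn_ord i; nia.
have bnd' (j : 'I_(n * d + c).+1) : (j %/ d < n.+1)%N.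
  by rewrite ltn_divLR //; have := ltn_ord j; nia.
rewrite add0r (reindex_onto (fun i => Ordinal (bnd i)) (fun j => Ordinal (bnd' j))) /=.
  apply: eq_big => [i|i _]; first by rewrite dvdn_mull //=; apply/eqP/val_inj; rewrite /= mulnK.
  rewrite /dil dvdn_mull // mulnK // mulnBl; congr (_ * f _).
  by have := ltn_ord i; nia.
by move=> j dj; apply/val_inj; rewrite /= divnK.
Qed.

Lemma sect_dil c f : (c < d)%N -> sect c (dil d f) = if c == 0%N then f else 0.
Proof.
move=> cd; apply: pseriesP => n; rewrite /sect /dil dvdn_addr ?dvdn_mull //.
case: (posnP c) => [->|c0]; first by rewrite dvdn0 addn0 mulnK.
by rewrite gtnNdvd.
Qed.

(** The class of the exponent moves by j, with a carry into the next power of q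
    when it passes 0. *)
Lemma sect_pqX c j f : (c < d)%N -> (j <= d)%N ->
  sect c (q ^+ j * f) = if (j <= c)%N then sect (c - j) f else q * sect (c + d - j) f.
Proof.
move=> cd jd; apply: pseriesP => n; rewrite /sect coef_pqXM.
case: (leqP j c) => jc; first by rewrite ifF ?addnBA //; lia.
rewrite coef_pqM; case: n => [|n]; first by rewrite mul0n jc.
by rewrite ifF; [congr f; nia|nia].
Qed.

End Dilation.

End Limits.

HB.instance Definition _ (R : fieldType) d :=
  GRing.isZmodMorphism.Build _ _ (@dil R d.+1) (@dil_zmod R d.+1).
HB.instance Definition _ (R : fieldType) d :=
  GRing.isMonoidMorphism.Build _ _ (@dil R d.+1) (@dil_monoid R d.+1 isT).

Section DilationRing.
Variables (R : fieldType) (d : nat).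
Local Notation q := (pq R).
Local Notation D := (dil d.+1).

Lemma dil_pq : D q = q ^+ d.+1.
Proof.
apply: pseriesP => n; rewrite coef_pqX /dil /pq; case: ifP => [/dvdnP[k ->]|].
  by rewrite mulnK // -{2}(mul1n d.+1) eqn_pmul2r.
by case: eqP => // ->; rewrite dvdnn.
Qed.

Lemma dil_pqX k : (D (q ^+ k)) = q ^+ (k * d.+1).
Proof. by rewrite rmorphXn /= dil_pq -exprM mulnC. Qed.

Lemma dil_eqm N (f g : pseries R) : eqm N f g -> eqm N (D f) (D g).
Proof.
by move=> e i iN; rewrite /dil; case: ifP => // _; apply: e; apply: leq_ltn_trans (leq_div _ _) iN.
Qed.

Lemma dil_cvg u (f : pseries R) : pcvg u f -> pcvg (fun M => (D (u M))) (D f).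
Proof. by move=> uf N; have [K uK] := uf N; exists K => M /uK; apply: dil_eqm. Qed.

Lemma dil_poch a b : (0 < a)%N -> (0 < b)%N -> (D (poch R a b)) = poch R (a * d.+1) (b * d.+1).
Proof.
move=> a0 b0; apply: (@pcvg_uniq _ (pochN R (a * d.+1) (b * d.+1))); last by apply: poch_cvg; lia.
apply: pcvg_ext (dil_cvg (poch_cvg R a0 b0)) => M; rewrite rmorph_prod.
by apply: eq_bigr => j _; rewrite rmorphB rmorph1 /= dil_pqX; congr (1 - q ^+ _); lia.
Qed.

Lemma dil_psC (c : R) : D (psC c) = psC c.
Proof.
apply: pseriesP => n; rewrite /dil; case: n => [|n]; first by rewrite dvdn0 div0n.
by case: ifP => // /dvdnP[[|k] ->] //; rewrite mulnK.
Qed.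

Lemma dil_summable F : summable F -> @summable R (fun k => (D (F k))).
Proof. by move=> sF k; rewrite -(rmorph0 (dil d.+1)); apply: dil_eqm. Qed.

Lemma dil_nsum F : summable F -> (D (nsum F)) = nsum (fun k => (D (F k))) :> pseries R.
Proof.
move=> sF; apply: pcvg_uniq (nsum_cvg (dil_summable sF)).
by apply: pcvg_ext (dil_cvg (nsum_cvg sF)) => M; rewrite rmorph_sum.
Qed.

End DilationRing.

(** * Theta series *)

Section Gsum.
Variable R : fieldType.
Local Notation q := (pq R).

(** The sum of c_i q^(e_i) over an infinite index set such as Z or Z^2.  It is
    meaningful when e is [proper]: the sum defining each coefficient is then
    finite. *)
Definition gsum (I : choiceType) (c : I -> R) (e : I -> int) : pseries R :=
  fun n => \sum_(i \in [set` [pred i | e i == n%:Z]]) c i.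

Definition proper (I : choiceType) (e : I -> int) :=
  (forall i, 0 <= e i) /\ forall n : nat, exists s : seq I, forall i, e i <= n%:Z -> i \in s.

Lemma gsum_box (I : choiceType) (c : I -> R) e n (s : seq I) : uniq s ->
  (forall i, e i = n%:Z -> i \in s) -> gsum c e n = \sum_(i <- s | e i == n%:Z) c i.
Proof.
move=> us sP; rewrite /gsum -(@bigfs _ _ _ _ s) // => i /eqP /sP.
by move=> ->.
Qed.

Lemma proper_box (I : choiceType) (e : I -> int) n : proper e ->
  exists2 s : seq I, uniq s & forall i, e i <= n%:Z -> i \in s.
Proof.
case=> _ /(_ n)[s sP]; exists (undup s); first exact: undup_uniq.
by move=> i /sP; rewrite mem_undup.
Qed.

Lemma eq_gsum (I : choiceType) (c c' : I -> R) e e' :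
  (forall i, c i = c' i) -> (forall i, e i = e' i) -> gsum c e = gsum c' e'.
Proof. by move=> ec ee; congr gsum; apply: funext. Qed.

Lemma gsum_scale (I : choiceType) a (c : I -> R) e : proper e ->
  gsum (fun i => a * c i) e = psC a * gsum c e.
Proof.
move=> pe; apply: pseriesP => n; rewrite coefCM.
have [s us sP] := proper_box n pe.
have sP' i : e i = n%:Z -> i \in s by move=> ei; apply: sP; rewrite ei.
by rewrite !(gsum_box _ us sP') mulr_sumr.
Qed.

Lemma gsum_opp (I : choiceType) (c : I -> R) e : proper e ->
  gsum (fun i => - c i) e = - gsum c e.
Proof.
move=> pe; rewrite -(mul1r (gsum c e)) -mulNr -(rmorph1 (@psC R)) -rmorphN -gsum_scale //.
by apply: eq_gsum => i //; rewrite mulN1r.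
Qed.

Lemma gsum_shift (I : choiceType) (c : I -> R) e k : (forall i, 0 <= e i) ->
  gsum c (fun i => e i + k%:Z) = q ^+ k * gsum c e.
Proof.
move=> e0; apply: pseriesP => n; rewrite coef_pqXM /gsum; case: ltnP => nk.
  rewrite fsbig1 // => i /= /eqP; have := e0 i; lia.
apply: eq_fsbigl; rewrite predeqE => i /=; split=> /eqP ei; apply/eqP; lia.
Qed.

Lemma gsum_dil (I : choiceType) (c : I -> R) e d :
  gsum c (fun i => d.+1%:Z * e i) = dil d.+1 (gsum c e).
Proof.
apply: pseriesP => n; rewrite /dil /gsum; case: ifP => [/dvdnP[k ->]|dn].
  rewrite mulnK //; apply: eq_fsbigl; rewrite predeqE => i /=.
  by split=> /eqP ei; apply/eqP; [nia|rewrite ei; lia].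
rewrite fsbig1 // => i /= /eqP ei; case/negP: dn; apply/dvdnP.
by exists (`|e i|)%N; nia.
Qed.

Lemma gsumM (I I' : choiceType) (c : I -> R) e (c' : I' -> R) e' :
  proper e -> proper e' ->
  gsum c e * gsum c' e' = gsum (fun p => c p.1 * c' p.2) (fun p => e p.1 + e' p.2).
Proof.
move=> pe pe'; apply: pseriesP => n.
have [s us sP] := proper_box n pe; have [s' us' sP'] := proper_box n pe'.
have e0 := pe.1; have e0' := pe'.1.
rewrite coefMps (@gsum_box _ _ _ _ [seq (i, j) | i <- s, j <- s']); first last.
- move=> [i j] /= ei; apply: allpairs_f; [apply: sP|apply: sP'].
    by have := e0' j; lia.
  by have := e0 i; lia.
- by apply: allpairs_uniq => // -[? ?] [].
rewrite [RHS]big_mkcond big_allpairs /=.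
under eq_bigr => k _.
  rewrite (gsum_box c us) => [|i ei]; last by apply: sP; rewrite ei; have := ltn_ord k; lia.
  rewrite (gsum_box c' us') => [|i ei]; last by apply: sP'; rewrite ei; lia.
  rewrite big_mkcond mulr_suml.
  under eq_bigr => i _ do rewrite (big_mkcond (fun j => e' j == _)) mulr_sumr.
over.
rewrite exchange_big; apply: eq_bigr => i _ /=; rewrite exchange_big; apply: eq_bigr => j _ /=.
rewrite -(gez0_abs (e0 i)) -(gez0_abs (e0' j)).
move: `|e i|%N `|e' j|%N => a b.
case: eqP => [abn|abn].
  have ltan : (a < n.+1)%N by lia.
  rewrite (bigD1 (Ordinal ltan)) //= eqxx ifT; last by apply/eqP; lia.
  rewrite big1 ?addr0 // => k; rewrite -val_eqE /= => ka.
  by rewrite ifF ?mul0r //; lia.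
rewrite big1 // => k _; case: eqP => [ak|]; last by rewrite mul0r.
by rewrite ifF ?mulr0 //; have := ltn_ord k; lia.
Qed.

Lemma proper_pair (I I' : choiceType) (e : I -> int) (e' : I' -> int) :
  proper e -> proper e' -> proper (fun p : I * I' => e p.1 + e' p.2).
Proof.
move=> [e0 pe] [e0' pe']; split=> [[i j] /=|n]; first by rewrite addr_ge0.
have [s sP] := pe n; have [s' sP'] := pe' n.
exists [seq (i, j) | i <- s, j <- s'] => -[i j] /= le_n.
apply: allpairs_f; [apply: sP|apply: sP']; first by have := e0' j; lia.
by have := e0 i; lia.
Qed.

(** A partition of the index set into the images of finitely many injections
    [phi k] splits the sum. *)
Lemma gsum_classes (I J : choiceType) (K : finType) (phi : K -> J -> I)
    (kappa : I -> K) (rho : I -> J) (c : I -> R) e : proper e ->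
  (forall i, phi (kappa i) (rho i) = i) ->
  (forall k j, kappa (phi k j) = k) -> (forall k j, rho (phi k j) = j) ->
  gsum c e = \sum_k gsum (c \o phi k) (e \o phi k).
Proof.
move=> pe phiK kaK rhK; apply: pseriesP => n; have [s us sP] := proper_box n pe.
have sP' i : e i = n%:Z -> i \in s by move=> ei; apply: sP; rewrite ei.
rewrite (gsum_box c us sP') (partition_big kappa predT) //= coef_sumps.
apply: eq_bigr => k _.
rewrite (@gsum_box _ _ _ _ [seq rho i | i <- s & kappa i == k]).
- rewrite big_map big_filter_cond; apply: eq_big => [i|i].
    by rewrite andbC; case: eqP => //= <-; rewrite phiK.
  by case/andP=> _ /eqP <-; rewrite /= phiK.
- rewrite map_inj_in_uniq ?filter_uniq // => i j.
  rewrite !mem_filter => /andP[/eqP ki _] /andP[/eqP kj _] e_ij.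
  by rewrite -(phiK i) -(phiK j) ki kj e_ij.
move=> j /= ej; apply/mapP; exists (phi k j); last by rewrite rhK.
by rewrite mem_filter kaK eqxx sP'.
Qed.

Lemma gsum_reindex (I J : choiceType) (phi : J -> I) (psi : I -> J) (c : I -> R) e :
  proper e -> cancel psi phi -> cancel phi psi ->
  gsum c e = gsum (c \o phi) (e \o phi).
Proof.
move=> pe pK Kp; rewrite (@gsum_classes _ _ unit (fun=> phi) (fun=> tt) psi c e) //.
  by rewrite (big_pred1 tt) // => -[].
by move=> [].
Qed.

End Gsum.

(** ** Quadratic exponents *)

Definition quad (A B m : int) : int := A * m ^+ 2 + B * m.

(** Gives finiteness of the sets of indices m with bounded exponent. *)
Lemma quad_bound A B m : 0 < A -> - A <= B <= A -> `|m| <= quad A B m + 1.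
Proof.
move=> A0 /andP[AB BA]; rewrite /quad; case: (ltrgt0P m) => [m0|m0|->]; last by lia.
  have h1 : 0 <= (B + A) * m by apply: mulr_ge0; lia.
  have h2 : 0 <= (A * m - 1) * (m - 1) by apply: mulr_ge0; nia.
  by rewrite -subr_ge0; move: (addr_ge0 h1 h2); congr (0 <= _); ring.
have h1 : 0 <= (A - B) * (- m) by apply: mulr_ge0; lia.
have h2 : 0 <= (A * (- m) - 1) * (- m - 1) by apply: mulr_ge0; nia.
by rewrite -subr_ge0; move: (addr_ge0 h1 h2); congr (0 <= _); ring.
Qed.

Lemma quad_ge0 A B m : 0 < A -> - A <= B <= A -> 0 <= quad A B m.
Proof.
move=> A0 AB; case: (eqVneq m 0) => [->|m0]; first by rewrite /quad; lia.
by have := quad_bound m A0 AB; lia.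
Qed.

Lemma proper_quad A B : 0 < A -> - A <= B <= A -> proper (quad A B).
Proof.
move=> A0 AB; split=> [m|n]; first exact: quad_ge0.
exists [seq i%:Z - n.+1%:Z | i <- iota 0 (2 * n + 3)] => m le_n.
have := quad_bound m A0 AB => le_m; apply/mapP.
exists (absz (m + n.+1%:Z)); last by lia.
by rewrite mem_iota; lia.
Qed.

Section Theta.
Variable R : fieldType.
Local Notation q := (pq R).

Definition sg (m : int) : R := (-1) ^+ `|m|%N.

Lemma sgM_mod (m n k : int) : odd (absz (m + n - k)%R) = false -> sg m * sg n = sg k.
Proof.
move=> e; rewrite /sg -signr_odd -[X in _ * X]signr_odd -[RHS]signr_odd -signr_addb.
by congr (_ ^+ nat_of_bool _); lia.
Qed.

(** The sums over Z of (-1)^m q^(A m^2 + B m) and of q^(A m^2 + B m). *)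
Definition ath (A B : int) : pseries R := gsum sg (quad A B).
Definition pth (A B : int) : pseries R := gsum (fun=> 1) (quad A B).

Lemma ath_sym A B : 0 < A -> - A <= B <= A -> ath A (- B) = ath A B.
Proof.
move=> A0 AB; rewrite /ath (@gsum_reindex _ _ _ (@GRing.opp int) (@GRing.opp int)).
- by apply: eq_gsum => m /=; [rewrite /sg abszN|rewrite /quad; ring].
- by apply: proper_quad => //; lia.
- exact: opprK.
- exact: opprK.
Qed.

(** The terms of index m and -1 - m cancel. *)
Lemma ath_diag (A : int) : (2%:R : R) != 0 -> 0 < A -> ath A A = 0.
Proof.
move=> R2 A0; have pA : proper (quad A A) by apply: proper_quad => //; lia.
have e : ath A A = - ath A A.
  rewrite {1}/ath (@gsum_reindex _ _ _ (fun m : int => -1 - m) (fun m : int => -1 - m)) //; try by move=> m; ring.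
  rewrite /ath -gsum_opp //; apply: eq_gsum => m /=; last by rewrite /quad; ring.
  rewrite /sg -signr_odd -[in RHS]signr_odd -signrN; congr (_ ^+ nat_of_bool _); lia.
apply: pseriesP => n; move/(congr1 (@^~ n)): e; rewrite coefNps => e.
have : 2%:R * ath A A n = 0 by rewrite mulr_natl mulr2n {1}e addNr.
by move/eqP; rewrite mulf_eq0 (negPf R2) => /eqP.
Qed.

End Theta.

(** ** Products of two theta series *)

Section ThetaProducts.
Variable R : fieldType.
Local Notation q := (pq R).

(** The lattice Z^2 is the union of the two classes of its pairs (m, n) modulo
    the sublattice of even m + n, in which m + n and m - n separate. *)
Lemma ath_mul (A : int) (a b : nat) :
  0 < A -> (b <= a)%N -> a%:Z + b%:Z <= 2 * A ->
  ath R A (a%:Z - A) * ath R A (b%:Z - A) =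
  pth R (2 * A) (a%:Z + b%:Z - 2 * A) * pth R (2 * A) (a%:Z - b%:Z)
  - q ^+ b * (pth R (2 * A) (a%:Z + b%:Z) * pth R (2 * A) (a%:Z - b%:Z - 2 * A)).
Proof.
move=> A0 ba abA.
have pa : proper (quad A (a%:Z - A)) by apply: proper_quad => //; lia.
have pb : proper (quad A (b%:Z - A)) by apply: proper_quad => //; lia.
have p1 : proper (quad (2 * A) (a%:Z + b%:Z - 2 * A)) by apply: proper_quad; lia.
have p2 : proper (quad (2 * A) (a%:Z - b%:Z)) by apply: proper_quad; lia.
have p3 : proper (quad (2 * A) (a%:Z + b%:Z)) by apply: proper_quad; lia.
have p4 : proper (quad (2 * A) (a%:Z - b%:Z - 2 * A)) by apply: proper_quad; lia.
rewrite /ath /pth !gsumM //.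
pose phi (k : bool) (p : int * int) := (p.1 + p.2, p.1 - p.2 + (k : nat)%:Z).
pose kappa (p : int * int) := odd (absz (p.1 + p.2)).
pose rho (p : int * int) :=
  (((p.1 + p.2) %/ 2)%Z, p.1 - ((p.1 + p.2) %/ 2)%Z).
rewrite (@gsum_classes _ _ _ _ phi kappa rho) //; first last.
- by move=> k [u v]; rewrite /rho /phi /=; congr pair; case: k; lia.
- by move=> k [u v]; rewrite /kappa /phi /=; case: k; lia.
- move=> [m n]; rewrite /phi /kappa /rho /=; congr pair; first by lia.
  by case: (boolP (odd _)) => /=; lia.
- exact: proper_pair.
rewrite big_bool [LHS]addrC /=; congr (_ + _).
  apply: eq_gsum => -[u v] /=; last by rewrite /quad; ring.
  by rewrite mulr1 (@sgM_mod _ _ _ 0) //; lia.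
rewrite -gsum_shift; last by case: (proper_pair p3 p4).
have pp : proper (fun p : int * int => quad (2 * A) (a%:Z + b%:Z) p.1 +
    quad (2 * A) (a%:Z - b%:Z - 2 * A) p.2 + b%:Z).
  have [e0 pe] := proper_pair p3 p4; split=> [p|n]; first by have /= := e0 p; lia.
  by have [s sP] := pe n; exists s => p le_n; apply: sP => /=; lia.
rewrite -gsum_opp //; apply: eq_gsum => -[u v] /=; last by rewrite /quad; ring.
by rewrite mulr1 (@sgM_mod _ _ _ 1) //; lia.
Qed.

(** This is J_10 [q^k; q^10] for 0 < k < 10, by [triple_product]. *)
Definition theta (k : nat) : pseries R := ath R 5 (k%:Z - 5).

Lemma theta_sym k : (k <= 10)%N -> theta (10 - k) = theta k.
Proof.
move=> k10; rewrite /theta -[RHS]ath_sym; [|lia..].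
by congr (ath _ _ _); lia.
Qed.

Definition thX (p : nat) := pth R 10 (p%:Z - 10).
Definition thY (p : nat) := pth R 10 p%:Z.

(** With s = a + b and d = a - b, the right-hand side is, up to a power of q, the
    determinant of the points (thX p, q^(p / 2) thY p) for p = s and p = d. *)
Lemma theta_mul a b s d : (a + b = s)%N -> (b + d = a)%N -> (s <= 10)%N ->
  theta a * theta b = thX s * thY d - q ^+ b * (thY s * thX d).
Proof.
move=> es ed s10; rewrite /theta ath_mul; [|lia..].
rewrite /thX /thY.
have -> : s%:Z = a%:Z + b%:Z by lia.
by have -> : d%:Z = a%:Z - b%:Z by lia.
Qed.

(** A Pluecker relation between four points of the plane, those of [theta_mul]
    for p = 0, 2, 4, 6.  The next three relations are those between the points
    0, 2, 4, 8, between 0, 2, 4, 10 and between 0, 2, 6, 8. *)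
Lemma theta_rel1 : q * theta 1 ^+ 3 * theta 5 + theta 1 * theta 3 ^+ 3
  = theta 2 ^+ 3 * theta 4.
Proof.
have e11 := @theta_mul 1 1 2 0 erefl erefl erefl.
have e51 := @theta_mul 5 1 6 4 erefl erefl erefl.
have e33 := @theta_mul 3 3 6 0 erefl erefl erefl.
have e31 := @theta_mul 3 1 4 2 erefl erefl erefl.
have e22 := @theta_mul 2 2 4 0 erefl erefl erefl.
have e42 := @theta_mul 4 2 6 2 erefl erefl erefl.
have -> : q * theta 1 ^+ 3 * theta 5 = q * (theta 1 * theta 1) * (theta 5 * theta 1) by ring.
have -> : theta 1 * theta 3 ^+ 3 = (theta 3 * theta 3) * (theta 3 * theta 1) by ring.
have -> : theta 2 ^+ 3 * theta 4 = (theta 2 * theta 2) * (theta 4 * theta 2) by ring.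
rewrite e11 e51 e33 e31 e22 e42; ring.
Qed.

Lemma theta_rel2 : q * theta 1 ^+ 2 * theta 2 * theta 4 + theta 1 * theta 3 * theta 4 ^+ 2
  = theta 2 ^+ 2 * theta 3 * theta 5.
Proof.
have e11 := @theta_mul 1 1 2 0 erefl erefl erefl.
have e62 := @theta_mul 6 2 8 4 erefl erefl erefl.
have e44 := @theta_mul 4 4 8 0 erefl erefl erefl.
have e31 := @theta_mul 3 1 4 2 erefl erefl erefl.
have e22 := @theta_mul 2 2 4 0 erefl erefl erefl.
have e53 := @theta_mul 5 3 8 2 erefl erefl erefl.
have e6 : theta 6 = theta 4 by rewrite -(@theta_sym 4).
have -> : q * theta 1 ^+ 2 * theta 2 * theta 4 = q * (theta 1 * theta 1) * (theta 6 * theta 2)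
  by rewrite e6; ring.
have -> : theta 1 * theta 3 * theta 4 ^+ 2 = (theta 4 * theta 4) * (theta 3 * theta 1) by ring.
have -> : theta 2 ^+ 2 * theta 3 * theta 5 = (theta 2 * theta 2) * (theta 5 * theta 3) by ring.
rewrite e11 e62 e44 e31 e22 e53; ring.
Qed.

Lemma theta_rel3 : q * theta 1 ^+ 2 * theta 3 ^+ 2 + theta 1 * theta 3 * theta 5 ^+ 2
  = theta 2 ^+ 2 * theta 4 ^+ 2.
Proof.
have e11 := @theta_mul 1 1 2 0 erefl erefl erefl.
have e73 := @theta_mul 7 3 10 4 erefl erefl erefl.
have e55 := @theta_mul 5 5 10 0 erefl erefl erefl.
have e31 := @theta_mul 3 1 4 2 erefl erefl erefl.
have e22 := @theta_mul 2 2 4 0 erefl erefl erefl.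
have e64 := @theta_mul 6 4 10 2 erefl erefl erefl.
have e6 : theta 6 = theta 4 by rewrite -(@theta_sym 4).
have e7 : theta 7 = theta 3 by rewrite -(@theta_sym 3).
have -> : q * theta 1 ^+ 2 * theta 3 ^+ 2 = q * (theta 1 * theta 1) * (theta 7 * theta 3)
  by rewrite e7; ring.
have -> : theta 1 * theta 3 * theta 5 ^+ 2 = (theta 5 * theta 5) * (theta 3 * theta 1) by ring.
have -> : theta 2 ^+ 2 * theta 4 ^+ 2 = (theta 2 * theta 2) * (theta 6 * theta 4)
  by rewrite e6; ring.
rewrite e11 e73 e55 e31 e22 e64; ring.
Qed.

Lemma theta_rel4 : q ^+ 2 * theta 1 ^+ 3 * theta 3 + theta 2 * theta 4 ^+ 3
  = theta 3 ^+ 3 * theta 5.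
Proof.
have e11 := @theta_mul 1 1 2 0 erefl erefl erefl.
have e71 := @theta_mul 7 1 8 6 erefl erefl erefl.
have e44 := @theta_mul 4 4 8 0 erefl erefl erefl.
have e42 := @theta_mul 4 2 6 2 erefl erefl erefl.
have e33 := @theta_mul 3 3 6 0 erefl erefl erefl.
have e53 := @theta_mul 5 3 8 2 erefl erefl erefl.
have e7 : theta 7 = theta 3 by rewrite -(@theta_sym 3).
have -> : q ^+ 2 * theta 1 ^+ 3 * theta 3 = q ^+ 2 * (theta 1 * theta 1) * (theta 7 * theta 1)
  by rewrite e7; ring.
have -> : theta 2 * theta 4 ^+ 3 = (theta 4 * theta 4) * (theta 4 * theta 2) by ring.
have -> : theta 3 ^+ 3 * theta 5 = (theta 3 * theta 3) * (theta 5 * theta 3) by ring.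
rewrite e11 e71 e44 e42 e33 e53; ring.
Qed.

(** The exponent of the (m, n) term of theta 2 * theta 4 is
    (|(10 m - 3) + (10 n - 1) i|^2 - 10) / 20, and (10 m - 3) + (10 n - 1) i is
    always divisible by 2 - i in the Gaussian integers.  The quotients form five
    classes modulo 10, each giving a product of two theta series in q^5; two of
    these products have the factor [ath 5 5] = 0. *)
Lemma theta_dissection : (2%:R : R) != 0 ->
  theta 2 * theta 4 = dil 5 (theta 4) ^+ 2
    - q ^+ 2 * dil 5 (theta 2 * theta 4) - q ^+ 4 * dil 5 (theta 2) ^+ 2.
Proof.
move=> R2.
(* On the Gaussian integers m + n i, the map phi k is the multiplication by 2 - i
   followed by the translation by sh k; the five translations represent the
   classes modulo 2 - i. *)
pose sh (k : 'I_5) : int * int :=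
  nth (0, 0) [:: (0, 0); (1, 1); (1, 0); (1, -1); (0, 1)] k.
pose phi (k : 'I_5) (p : int * int) :=
  (2 * p.1 + p.2 + (sh k).1, 2 * p.2 - p.1 + (sh k).2).
pose kappa (p : int * int) : 'I_5 := inord (absz ((2 * p.1 - p.2) %% 5)%Z).
pose rho (p : int * int) : int * int :=
  (((2 * p.1 - p.2 + 1) %/ 5)%Z, ((p.1 + 2 * p.2 + 1) %/ 5)%Z).
have pr B : - 5 <= B <= 5 -> proper (quad 5 B) by apply: proper_quad.
have pr2 B C : - 5 <= B <= 5 -> - 5 <= C <= 5 ->
  proper (fun p : int * int => quad 5 B p.1 + quad 5 C p.2).
  by move=> hB hC; apply: proper_pair; apply: pr.
have kaE p : kappa p = absz ((2 * p.1 - p.2) %% 5)%Z :> nat.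
  by rewrite inordK //; lia.
have termE B C k (c : R) : - 5 <= B <= 5 -> - 5 <= C <= 5 ->
    gsum (fun p : int * int => c * (sg R p.1 * sg R p.2))
         (fun p => 5 * (quad 5 B p.1 + quad 5 C p.2) + k%:Z) =
    psC c * (q ^+ k * dil 5 (ath R 5 B * ath R 5 C)).
  move=> hB hC; rewrite gsum_shift; last first.
    by move=> p; have [/(_ p)/= + _] := pr2 B C hB hC; lia.
  rewrite mulrCA; congr (_ * _).
  rewrite (gsum_dil _ (fun p : int * int => quad 5 B p.1 + quad 5 C p.2) 4).
  rewrite /ath gsumM; [|exact: pr..].
  by rewrite gsum_scale ?rmorphM /= ?dil_psC //; apply: pr2.
rewrite [LHS](_ : _ = \sum_(k < 5) gsum
    (fun p => sg R (phi k p).1 * sg R (phi k p).2)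
    (fun p => quad 5 (2%:Z - 5) (phi k p).1 + quad 5 (4%:Z - 5) (phi k p).2)); last first.
  rewrite /theta {1 2}/ath gsumM; [|exact: pr..].
  rewrite (@gsum_classes _ _ _ _ phi kappa rho) //; first exact: pr2.
  - move=> [m n]; rewrite /phi /rho /sh kaE /=.
    have : (absz ((2 * m - n) %% 5)%Z < 5)%N by lia.
    by case ek: (absz ((2 * m - n) %% 5)%Z) => [|[|[|[|[|k]]]]] //= _; congr pair; lia.
  - move=> k [u v]; apply/val_inj; rewrite /= kaE /phi /sh.
    by case: k => -[|[|[|[|[|k]]]]] //= _; lia.
  move=> k [u v]; rewrite /rho /phi /sh.
  by case: k => -[|[|[|[|[|k]]]]] //= _; congr pair; lia.
(* In the class k the sum is
   cs k * q^(ks k) * (ath 5 (Bs k) * ath 5 (Cs k) at q^5). *)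
pose cs (k : nat) : R := nth 0 [:: 1; 1; -1; 1; -1] k.
pose Bs (k : nat) : int := nth 0 [:: -1; 1; 3; 5; -3] k.
pose Cs (k : nat) : int := nth 0 [:: -1; 5; 1; -3; 3] k.
pose ks (k : nat) := nth 0%N [:: 0; 6; 2; 8; 4]%N k.
transitivity (\sum_(k < 5) psC (cs k) *
    (q ^+ ks k * dil 5 (ath R 5 (Bs k) * ath R 5 (Cs k)))).
  apply: eq_bigr => k _; rewrite -termE; first last.
  - by case: k => -[|[|[|[|[|k]]]]] //= _; rewrite /Cs.
  - by case: k => -[|[|[|[|[|k]]]]] //= _; rewrite /Bs.
  apply: eq_gsum => -[u v]; rewrite /phi /sh /=; last first.
    by case: k => -[|[|[|[|[|k]]]]] //= _; rewrite /quad /Bs /Cs /ks /=; ring.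
  have s0 : sg R u * sg R v = sg R (u + v) by apply: sgM_mod; lia.
  have s1 : - sg R (u + v) = sg R (u + v + 1).
    have sg1 : sg R 1 = -1 by [].
    by rewrite -mulrN1 -sg1; apply: sgM_mod; lia.
  case: k => -[|[|[|[|[|k]]]]] //= _; rewrite /cs /= ?mul1r ?mulN1r s0 ?s1.
  - by apply: sgM_mod; lia.
  - by apply: sgM_mod; lia.
  - by apply: sgM_mod; lia.
  - by apply: sgM_mod; lia.
  - by apply: sgM_mod; lia.
rewrite !big_ord_recl big_ord0 addr0 /= /cs /ks /Bs /Cs /=.
rewrite (ath_diag R2) // !(mulr0, mul0r, rmorph0, addr0, add0r).
have t2 : ath R 5 3 = theta 2 by rewrite -ath_sym.
have t4 : ath R 5 1 = theta 4 by rewrite -ath_sym.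
rewrite -[ath R 5 (-1)]/(theta 4) -[ath R 5 (-3)]/(theta 2) t2 t4.
by rewrite !rmorphM !rmorphN !rmorph1 /=; ring.
Qed.

End ThetaProducts.

(** ** Gaussian binomial coefficients and the triple product *)

Section TripleProduct.
Variable R : fieldType.
Local Notation q := (pq R).

(** Gaussian binomial coefficients in p, by Pascal's rule, which needs no division
    by 1 - p^i. *)
Fixpoint gbin (p : pseries R) (M j : nat) : pseries R :=
  match M, j with
  | _, 0%N => 1
  | 0%N, _.+1 => 0
  | M'.+1, j'.+1 => gbin p M' j'.+1 + p ^+ (M' - j') * gbin p M' j'
  end.

Lemma gbin0 p M : gbin p M 0 = 1. Proof. by case: M. Qed.

Lemma gbin_gt p M j : (M < j)%N -> gbin p M j = 0.
Proof.
elim: M j => [|M IHM] [|j] //= Mj; rewrite !IHM //; last by lia.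
by rewrite mulr0 addr0.
Qed.

Lemma gbin_theorem p (x y : pseries R) M :
  \prod_(i < M) (x - y * p ^+ i) =
  \sum_(j < M.+1) (-1) ^+ j * p ^+ 'C(j, 2) * gbin p M j * x ^+ (M - j) * y ^+ j.
Proof.
elim: M => [|M IHM]; first by rewrite big_ord0 big_ord1 /= !mulr1.
rewrite big_ord_recr IHM /= mulrBr !mulr_suml [RHS]big_ord_recl /=.
rewrite [X in X - _]big_ord_recl /= -addrA; congr (_ + _).
  by rewrite !gbin0 subn0 exprS; ring.
rewrite -sumrN.
have -> : \sum_(i < M) (-1) ^+ bump 0 i * p ^+ 'C(bump 0 i, 2) * gbin p M (bump 0 i)
      * x ^+ (M - bump 0 i) * y ^+ bump 0 i * x =
    \sum_(i < M.+1) (-1) ^+ i.+1 * p ^+ 'C(i.+1, 2) * gbin p M i.+1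
      * x ^+ (M - i) * y ^+ i.+1.
  rewrite [RHS]big_ord_recr /= gbin_gt // mulr0 !mul0r addr0.
  apply: eq_bigr => i _; rewrite /bump /= add1n.
  have -> : (M - i = (M - i.+1).+1)%N by have := ltn_ord i; lia.
  by rewrite [x ^+ _.+1]exprS; ring.
rewrite -big_split; apply: eq_bigr => i _ /=; rewrite /bump /= add1n subSS binS bin1.
have -> : p ^+ M = p ^+ i * p ^+ (M - i) by rewrite -exprD subnKC // -ltnS.
by rewrite exprD !exprS; ring.
Qed.

Variable b : nat.
Hypothesis b0 : (0 < b)%N.
Local Notation P := (pochN R b b).

Lemma gbin_poch M j : (j <= M)%N -> gbin (q ^+ b) M j * (P j * P (M - j)%N) = P M.
Proof.
elim: M j => [|M IHM] [|j] //= jM; first by rewrite subn0 pochN0 !mul1r.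
  by rewrite subn0 pochN0 !mul1r.
rewrite subSS; move: jM; rewrite ltnS leq_eqVlt => /orP[/eqP ->|jM].
  have {1}-> := @gbin_gt (q ^+ b) M M.+1 (ltnSn _).
  have := IHM M (leqnn _); rewrite subnn pochN0 !mulr1 => eM.
  by rewrite add0r mul1r pochNS mulrA eM.
have := IHM j.+1 jM; have := IHM j (ltnW jM).
have -> : (M - j = (M - j.+1).+1)%N by lia.
rewrite !pochNS => e1 e2; rewrite mulrDl.
transitivity (P M * (1 - q ^+ (b + (M - j.+1) * b)) +
   (q ^+ b) ^+ (M - j.+1).+1 * (P M * (1 - q ^+ (b + j * b)))); last first.
  have -> : q ^+ (b + M * b) = q ^+ (b + (M - j.+1) * b) * q ^+ (b + j * b).
    by rewrite -exprD; congr (q ^+ _); nia.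
  have -> : (q ^+ b) ^+ (M - j.+1).+1 = q ^+ (b + (M - j.+1) * b).
    by rewrite -exprM; congr (q ^+ _); nia.
  by ring.
by rewrite -{1}e2 -{1}e1; ring.
Qed.

Lemma poch_lim (phi : nat -> nat) :
  (forall M, exists K, forall n, (K <= n)%N -> (M <= phi n)%N) ->
  pcvg (fun N => P (phi N)) (poch R b b).
Proof. by move=> phiP; apply: (pcvg_comp phiP); apply: poch_cvg. Qed.

(** Both indices of the coefficient must grow: then the numerator and the two factors
    of the denominator in [gbin_poch] have the same limit. *)
Lemma gbin_lim (phi : nat -> nat) :
  (forall N, (phi N <= 2 * N)%N) ->
  (forall M, exists K, forall n, (K <= n)%N -> (M <= phi n)%N) ->
  (forall M, exists K, forall n, (K <= n)%N -> (M <= 2 * n - phi n)%N) ->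
  pcvg (fun N => gbin (q ^+ b) (2 * N) (phi N)) (poch R b b)^-1.
Proof.
move=> phi2 phi1 phi3; have PU := poch_unit R b b0.
apply: (@pcvg_ext _ (fun N => P (2 * N)%N / (P (phi N) * P (2 * N - phi N)%N))).
  move=> N; rewrite -(gbin_poch (phi2 N)) mulrK //.
  by rewrite unitrM !pochN_unit.
rewrite -[_^-1](_ : poch R b b / (poch R b b * poch R b b) = _); last first.
  by rewrite invrM // mulrA divrr // mul1r.
apply: pcvgM; first by apply: poch_lim => M; exists M => n; lia.
apply: pcvgV; first by rewrite coef0M poch_coef0 // mulr1 oner_eq0.
by apply: pcvgM; apply: poch_lim.
Qed.

End TripleProduct.

Arguments gbin : simpl never.

Section Theta.
Variable R : fieldType.
Local Notation q := (pq R).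

Definition qmono (A B m : int) : pseries R := psC (sg R m) * q ^+ absz (quad A B m).

Lemma quad_gt A B m : - A < B < A -> `|m| <= quad A B m.
Proof.
move=> AB; have A0 : 0 < A by lia.
case: (ltrgt0P m) => [m0|m0|->]; last by rewrite /quad; lia.
  have h1 : 0 <= (B + A - 1) * m by apply: mulr_ge0; lia.
  have h2 : 0 <= A * m * (m - 1) by apply: mulr_ge0; nia.
  by rewrite -subr_ge0; move: (addr_ge0 h1 h2); congr (0 <= _); rewrite /quad; ring.
have h1 : 0 <= (A - B - 1) * (- m) by apply: mulr_ge0; lia.
have h2 : 0 <= A * (- m) * (- m - 1) by apply: mulr_ge0; nia.
by rewrite -subr_ge0; move: (addr_ge0 h1 h2); congr (0 <= _); rewrite /quad; ring.
Qed.

Lemma qmono_eqm A B m k : - A < B < A -> (k <= absz m)%N -> eqm k (qmono A B m) 0.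
Proof.
by move=> AB km; rewrite /qmono mulrC; apply: eqm_pqX; have := quad_gt m AB; lia.
Qed.

(** Turns the sum over Z into two sums over nat, to which [tannery] applies. *)
Lemma ath_nsum A B : - A < B < A ->
  ath R A B = nsum (fun m => qmono A B m) + nsum (fun m => qmono A B (- m.+1%:Z)).
Proof.
move=> AB; apply: pseriesP => n; rewrite coefDps /nsum !coef_sumps.
rewrite /ath (@gsum_box _ _ _ _ _ ([seq i%:Z | i <- iota 0 n.+1] ++
  [seq - i.+1%:Z | i <- iota 0 n.+1])).
- rewrite big_mkcond big_cat !big_map.
  change (iota 0 n.+1) with (index_iota 0 n.+1); rewrite !big_mkord /=.
  have cf m : qmono A B m n = if quad A B m == n%:Z then sg R m else 0.
    rewrite /qmono coefCM coef_pqX; have := quad_gt m AB.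
    by case: (eqVneq n _) => [en|en] le_m; [rewrite ifT ?mulr1 //|rewrite ifF ?mulr0 //]; lia.
  by congr (_ + _); apply: eq_bigr => i _; rewrite cf.
- rewrite cat_uniq; apply/and3P; split.
  + by rewrite map_inj_uniq ?iota_uniq // => i j; lia.
  + by apply/hasPn => x /mapP[i _ ->]; apply/mapP => -[j _]; lia.
  + by rewrite map_inj_uniq ?iota_uniq // => i j; lia.
move=> m em; have := quad_gt m AB; rewrite em mem_cat => le_m.
case: (lerP 0 m) => m0; apply/orP; [left|right]; apply/mapP.
  by exists (absz m); [rewrite mem_iota; lia|lia].
by exists (absz m).-1; [rewrite mem_iota; lia|lia].
Qed.

(** Jacobi's triple product, as the limit of the q-binomial theorem for
    \prod_(i < 2 N) (q^(2 A N - k) - q^(2 A i)). *)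
Lemma triple_product (A k : nat) : (0 < k < 2 * A)%N ->
  ath R A%:Z (k%:Z - A%:Z) =
  poch R (2 * A) (2 * A) * (poch R k (2 * A) * poch R (2 * A - k) (2 * A)).
Proof.
move=> /andP[k0 kA]; set b := (2 * A)%N; have b0 : (0 < b)%N by lia.
have kb : (0 < b - k)%N by lia.
pose B := k%:Z - A%:Z; have AB : - A%:Z < B < A%:Z by rewrite /B; lia.
pose g N j := gbin (q ^+ b) (2 * N) j.
have fin N : pochN R k b N * pochN R (b - k) b N =
    \sum_(m < N.+1) qmono A B m * g N (N + m)%N +
    \sum_(m < N) qmono A B (- m.+1%:Z) * g N (N - m.+1)%N.
  case: N => [|N'].
    rewrite !pochN0 big_ord0 big_ord1 /g addr0 /qmono /sg /quad !mulr0.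
    by rewrite rmorph1 expr0 /= !mulr1.
  set N := N'.+1; have kN : (k <= b * N)%N by rewrite /N; nia.
  (* The monomial by which the product of the q-binomial theorem differs from
     the product of the two Pochhammer symbols. *)
  pose c : pseries R := (-1) ^+ N * q ^+ (b * 'C(N, 2) + (b * N - k) * N).
  have c0 : c != 0.
    by rewrite /c mulf_neq0 ?expf_neq0 ?oppr_eq0 ?oner_eq0 // pq_neq0.
  have C2 j : (b * 'C(j, 2) = A * (j * j.-1))%N.
    by rewrite /b -(bin1 j.-1) mul_bin_diag; lia.
  have expE (m : int) (j : nat) : j%:Z = N%:Z + m -> (j <= 2 * N)%N ->
      (-1) ^+ j * (q ^+ b) ^+ 'C(j, 2) * g N j * (q ^+ (b * N - k)) ^+ (2 * N - j) =
      c * (qmono A B m * g N j).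
    move=> ej jN; have -> : (-1) ^+ j = (-1) ^+ N * psC (sg R m) :> pseries R.
      rewrite /sg rmorphXn rmorphN rmorph1 -exprD -signr_odd -[RHS]signr_odd.
      by congr (_ ^+ nat_of_bool _); lia.
    rewrite /c /qmono -!exprM.
    have -> : (-1) ^+ N * psC (sg R m) * q ^+ (b * 'C(j, 2)) * g N j
        * q ^+ ((b * N - k) * (2 * N - j)) =
      (-1) ^+ N * psC (sg R m) * g N j * q ^+ (b * 'C(j, 2) + (b * N - k) * (2 * N - j)).
      by rewrite exprD; ring.
    have -> : (b * 'C(j, 2) + (b * N - k) * (2 * N - j) =
       b * 'C(N, 2) + (b * N - k) * N + absz (quad A B m))%N.
      have q0 : 0 <= quad A B m by have := quad_gt m AB; lia.
      have tri i : ((i * i.-1)%N : int) = i%:Z * (i%:Z - 1).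
        by case: i => [|i] //; rewrite PoszM; congr (_ * _); lia.
      have hk : ((b * N - k)%N : int) = 2 * A%:Z * N%:Z - k%:Z by rewrite -subzn ?PoszM.
      have hj : ((2 * N - j)%N : int) = 2 * N%:Z - j%:Z by rewrite -subzn ?PoszM.
      have hm : m = j%:Z - N%:Z by lia.
      apply/eqP; rewrite -eqz_nat; apply/eqP; rewrite !C2 !PoszD.
      rewrite (PoszM A (j * _)%N) (PoszM A (N * _)%N) !(PoszM (b * N - k)%N) !tri hk hj gez0_abs //.
      by rewrite hm /quad /B; ring.
    by rewrite !exprD; ring.
  apply: (mulfI c0).
  have lhs : \prod_(i < 2 * N) (q ^+ (b * N - k) - 1 * (q ^+ b) ^+ i) =
      c * (pochN R k b N * pochN R (b - k) b N).
    rewrite mulSn mul1n big_split_ord /= (reindex_inj rev_ord_inj) /=.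
    rewrite (eq_bigr (fun i : 'I_N => - q ^+ (b * (N - i.+1)) *
      (1 - q ^+ (b - k + i * b)))) => [|i _]; last first.
      rewrite mul1r -exprM mulNr mulrBr mulr1 -exprD opprB; congr (q ^+ _ - _).
      by have := ltn_ord i; nia.
    rewrite [X in _ * X](eq_bigr (fun i : 'I_N => q ^+ (b * N - k) *
      (1 - q ^+ (k + i * b)))) => [|i _]; last first.
      by rewrite mul1r -exprM mulrBr mulr1 -exprD; congr (_ - q ^+ _); nia.
    rewrite !big_split /= -/(pochN R k b N) -/(pochN R (b - k) b N).
    rewrite prodr_const card_ord prodrN card_ord.
    rewrite -(big_morph (fun i => q ^+ i) (exprD q) (expr0 q)) -big_distrr /=.
    have -> : (\sum_(i < N) (N - i.+1) = 'C(N, 2))%N.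
      rewrite -triangular_sum big_mkord [RHS](reindex_inj rev_ord_inj).
      by apply: eq_bigr.
    by rewrite /c exprD -exprM; ring.
  rewrite -lhs gbin_theorem (_ : (2 * N).+1 = N + N.+1)%N; last by lia.
  rewrite big_split_ord [LHS]addrC mulrDr; congr (_ + _).
    rewrite mulr_sumr; apply: eq_bigr => m _ /=; rewrite expr1n mulr1.
    by apply: expE => //; have := ltn_ord m; lia.
  rewrite mulr_sumr (reindex_inj rev_ord_inj); apply: eq_bigr => m _ /=.
  rewrite expr1n mulr1; apply: expE; first by have := ltn_ord m; lia.
  by lia.
have key : poch R k b * poch R (b - k) b = ath R A B / poch R b b.
  apply: (@pcvg_uniq _ (fun N => pochN R k b N * pochN R (b - k) b N)).
    by apply: pcvgM; apply: poch_cvg.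
  have sm : summable (fun m : nat => qmono A B m) by move=> m; apply: qmono_eqm; lia.
  have sm' : summable (fun m : nat => qmono A B (- m.+1%:Z)).
    by move=> m; apply: qmono_eqm; lia.
  suff h : pcvg (fun N => \sum_(m < N.+1) qmono A B m * g N (N + m)%N +
      \sum_(m < N) qmono A B (- m.+1%:Z) * g N (N - m.+1)%N) (ath R A B / poch R b b).
    by apply: (pcvg_ext _ h) => N; rewrite fin.
  rewrite ath_nsum // mulrDl; apply: pcvgD.
    rewrite mulrC nsumM //; apply: (@tannery _ (fun N m => qmono A B m%:Z * g N (N + m)%N) _ S) => // [M m|m].
      by rewrite -(mul0r (g M (M + m)%N)); apply: eqmM => //; apply: sm.
    rewrite mulrC; apply: pcvgM; first exact: pcvg_cst.
    apply: (@pcvg_ev _ (fun M => g M (M + minn m M)%N) _ _ m) => [M mM|].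
      by rewrite (minn_idPl mM).
    apply: gbin_lim => // [N|M|M]; first by lia.
      by exists M => n; lia.
    by exists (M + m)%N => n; lia.
  rewrite mulrC nsumM //; apply: (@tannery _ (fun N m => qmono A B (- m.+1%:Z) * g N (N - m.+1)%N) _ id) => // [M m|m].
    by rewrite -(mul0r (g M (M - m.+1)%N)); apply: eqmM => //; apply: sm'.
  rewrite mulrC; apply: pcvgM; first exact: pcvg_cst.
  apply: gbin_lim => // [N|M|M]; first by lia.
    by exists (M + m.+1)%N => n; lia.
  by exists M => n; lia.
by rewrite key mulrCA divrr ?mulr1 // poch_unit.
Qed.

End Theta.

(** * Partial fractions *)

(** Lagrange interpolation of the polynomial X^a, of degree less than the number
    of nodes. *)
Lemma lagrange_power (F : fieldType) (I : finType) (x : I -> F) (y : F) a :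
  injective x -> (a < #|I|)%N ->
  \sum_i x i ^+ a * \prod_(j | j != i) ((y - x j) / (x i - x j)) = y ^+ a.
Proof.
move=> xI aI.
pose p : {poly F} := \sum_i (x i ^+ a)%:P *
   \prod_(j | j != i) (('X - (x j)%:P) * ((x i - x j)^-1)%:P) - 'X^a.
suff p0 : p = 0.
  have /eqP := congr1 (horner^~ y) p0.
  rewrite /p hornerD hornerN hornerXn horner0 horner_sum subr_eq0 => /eqP <-.
  apply: eq_bigr => i _; rewrite hornerM hornerC horner_prod; congr (_ * _).
  by apply: eq_bigr => j _; rewrite hornerM hornerC hornerXsubC.
apply: (@roots_geq_poly_eq0 _ _ [seq x i | i <- enum I]).
- apply/allP => _ /mapP[i _ ->]; rewrite /root /p hornerD hornerN hornerXn horner_sum.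
  rewrite (bigD1 i) //= [X in _ + X - _]big1 ?addr0 => [|k ki].
    rewrite hornerM hornerC horner_prod big1 ?mulr1 ?subrr // => j ji.
    rewrite hornerM hornerC hornerXsubC mulfV // subr_eq0 (inj_eq xI) //.
    by rewrite eq_sym.
  rewrite hornerM horner_prod (bigD1 i) /=; last by rewrite eq_sym.
  by rewrite hornerM hornerXsubC subrr !mul0r mulr0.
- by rewrite map_inj_uniq ?enum_uniq.
rewrite size_map -cardE; apply: leq_trans (size_polyD _ _) _; rewrite geq_max.
rewrite size_polyN size_polyXn aI andbT.
apply: leq_trans (size_sum _ _ _) _; apply/bigmax_leqP => i _.
apply: leq_trans (size_polyMleq _ _) _.
have sC : (size (x i ^+ a)%:P <= 1)%N by apply: size_polyC_leq1.
have sP : (size (\prod_(j | j != i) (('X - (x j)%:P) * ((x i - x j)^-1)%:P))%R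
    <= #|[pred j | j != i]|.+1)%N.
  apply: leq_trans (size_poly_prod_leq _ _) _; rewrite leq_subLR.
  rewrite addnS ltnS addnn -muln2 -sum_nat_const; apply: leq_sum => j _.
  apply: leq_trans (size_polyMleq _ _) _; rewrite size_XsubC.
  by rewrite size_polyC; case: (_ != 0).
have eI : (#|[pred j | j != i]|.+1 = #|I|)%N.
  by rewrite (cardC1 i) prednK //; apply/card_gt0P; exists i.
by rewrite eI in sP; have le := leq_add sC sP; rewrite -subn1 leq_subLR.
Qed.

Lemma cancel_fraction (F : fieldType) (c u A P d : F) :
  A != 0 -> P != 0 -> d != 0 -> c * (u * (A / P)) / (d * A) * (d * P) = c * u.
Proof. by move=> A0 P0 d0; field; rewrite A0 P0 d0. Qed.

(** Partial fractions of y^a / \prod_i (y - x i), in a domain instead of a field: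
    in the applications the x i and y are monomials in q, and multiplication of
    all the terms by a monomial C makes them power series. *)
Lemma partial_fractions (T : idomainType) (I : finType) (x : I -> T) (y C : T)
    (g : I -> T) (g0 : T) a :
  injective x -> (forall i, y != x i) -> (a < #|I|)%N ->
  (forall i, g i * ((y - x i) * \prod_(j | j != i) (x i - x j)) = C * x i ^+ a) ->
  g0 * \prod_i (y - x i) = C * y ^+ a ->
  \sum_i g i = g0.
Proof.
move=> xI yx aI hg hg0.
pose f : {rmorphism T -> {fraction T}} := @FracField.tofrac T.
have fI : injective f by move=> u v /eqP; rewrite tofrac_eq => /eqP.
have fxI : injective (f \o x) by move=> i j /fI /xI.
have fy i : f y - f (x i) != 0 by rewrite subr_eq0 (inj_eq fI).
apply: (fI); rewrite rmorph_sum /=.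
have Py0 : \prod_i (f y - f (x i)) != 0 by apply/prodf_neq0 => i _; apply: fy.
have -> : f g0 = f C * f y ^+ a / \prod_i (f y - f (x i)).
  apply: (canRL (mulfK Py0)); rewrite -rmorphXn -rmorphM -hg0 rmorphM rmorph_prod.
  by congr (_ * _); apply: eq_bigr => i _; rewrite rmorphB.
rewrite -(lagrange_power (f y) fxI aI) mulr_sumr mulr_suml; apply: eq_bigr => i _.
have Pi0 : \prod_(j | j != i) (f (x i) - f (x j)) != 0.
  apply/prodf_neq0 => j ji; rewrite subr_eq0 (inj_eq fI) //.
  by apply: contra ji => /eqP/xI->.
have Di0 : (f y - f (x i)) * \prod_(j | j != i) (f (x i) - f (x j)) != 0.
  by apply: mulf_neq0; [apply: fy|apply: Pi0].
apply: (mulIf Di0).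
have -> : f (g i) * ((f y - f (x i)) * \prod_(j | j != i) (f (x i) - f (x j))) =
   f C * f (x i) ^+ a.
  rewrite -rmorphXn -[in RHS]rmorphM -hg !rmorphM rmorph_prod rmorphB.
  by congr (_ * (_ * _)); apply: eq_bigr => j _; rewrite rmorphB.
rewrite big_split /= (bigD1 i (P := predT)) //=.
rewrite prodfV.
have Pj0 : \prod_(j | j != i) (f y - f (x j)) != 0 by apply/prodf_neq0 => j _; apply: fy.
by apply: esym; apply: cancel_fraction; [apply: Pj0|apply: Pi0|apply: fy].
Qed.

(** ** Lambert series *)

Section Lambert.
Variable R : fieldType.
Local Notation q := (pq R).
Local Notation P := (pochN R 10 10).
Local Notation Poo := (poch R 10 10).

(** The series \sum_m (-1)^m q^(e m) / (1 - q^(10 m + t)). *)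
Definition lam (e : nat -> nat) t : pseries R :=
  nsum (fun m => (-1) ^+ m * q ^+ e m * (1 - q ^+ (10 * m + t))^-1).

Lemma lam_summable (e : nat -> nat) t : (forall m, (m <= e m)%N) ->
  summable (fun m => (-1) ^+ m * q ^+ e m * (1 - q ^+ (10 * m + t))^-1).
Proof.
move=> he m; rewrite -mulrA mulrCA; apply: eqm_pqX; exact: he.
Qed.

Lemma lam_shift c (e : nat -> nat) t : (forall m, (m <= e m)%N) ->
  q ^+ c * lam e t = lam (fun m => e m + c)%N t.
Proof.
move=> he; rewrite /lam nsumM; last exact: lam_summable.
by apply: eq_nsum => m; rewrite [q ^+ (_ + c)]exprD; move: (_^-1) => i; ring.
Qed.

(** The sum of the exponents 10 l + s for l < m. *)
Definition csum s m := (5 * (m * m.-1) + m * s)%N.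

Lemma csumS s m : csum s m.+1 = (csum s m + (10 * m + s))%N.
Proof. by rewrite /csum; case: m => [|m] /=; nia. Qed.

(** The exponents 10 l + s are less than v, so that - q^(10 l + s) can be taken out
    of each factor; in [prod_above] they are greater, and q^v is taken out. *)
Lemma prod_below v s r m : (v + r = 10 * m + s)%N -> (r < 10)%N ->
  \prod_(l < m) (q ^+ v - q ^+ (10 * l + s)) =
  (-1) ^+ m * q ^+ csum s m * pochN R (10 - r) 10 m.
Proof.
move=> ev r10.
have -> : (-1) ^+ m * q ^+ csum s m = \prod_(l < m) - q ^+ (10 * l + s).
  rewrite prodrN card_ord; congr (_ * _).
  elim: (m) => [|k IHk]; first by rewrite big_ord0 /csum muln0 mul0n.
  by rewrite csumS exprD IHk big_ord_recr.
rewrite /pochN [X in _ * X](reindex_inj rev_ord_inj) -big_split.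
apply: eq_bigr => l _; rewrite /= mulNr mulrBr mulr1 -exprD opprB.
by congr (q ^+ _ - _); have := ltn_ord l; lia.
Qed.

Lemma prod_above v s r m K : (v + r = 10 * m + s)%N ->
  \prod_(l < K) (q ^+ v - q ^+ (10 * (m + l) + s)) = q ^+ (v * K) * pochN R r 10 K.
Proof.
move=> ev; rewrite /pochN exprM -[in (q ^+ v) ^+ _](card_ord K) -prodr_const -big_split.
apply: eq_bigr => l _; rewrite /= mulrBr mulr1 -exprD.
by congr (_ - q ^+ _); lia.
Qed.

(** The difference products that occur in the partial fractions are monomials
    times finite Pochhammer symbols: v is less than 10 l + s for l > m, greater for
    l < m, and r below 10 m + s. *)
Lemma class_prod N v s r m : (v + r = 10 * m + s)%N -> (r < 10)%N -> (m <= N)%N ->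
  \prod_(l < N) (q ^+ v - q ^+ (10 * l + s)) =
  (-1) ^+ m * q ^+ (v * (N - m) + csum s m)
    * (pochN R r 10 (N - m) * pochN R (10 - r) 10 m).
Proof.
move=> ev r10 mN; rewrite -[in LHS](subnKC mN) big_split_ord /=.
by rewrite (prod_below ev r10) (prod_above _ ev) exprD; ring.
Qed.

Lemma own_class_prod N s m : (m < N)%N ->
  \prod_(l < N | l != m :> nat) (q ^+ (10 * m + s) - q ^+ (10 * l + s)) =
  (-1) ^+ m * q ^+ ((10 * m + s) * (N - m.+1) + csum s m) * (P (N - m.+1) * P m).
Proof.
move=> mN; rewrite big_mkcond.
rewrite -(big_mkord xpredT (fun l => if l != m then q ^+ (10 * m + s) - q ^+ (10 * l + s) else 1)).
rewrite (big_cat_nat (n := m)) //=; last exact: ltnW.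
rewrite [X in _ * X]big_ltn // eqxx mul1r big_mkord.
rewrite (eq_bigr (fun l : 'I_m => q ^+ (10 * m + s) - q ^+ (10 * l + s))) => [|l _]; last first.
  by rewrite ifT //; have := ltn_ord l; lia.
rewrite (@prod_below _ _ 0) ?addn0 // -{1}[m.+1]add0n big_addn big_mkord.
rewrite (eq_bigr (fun l : 'I_(N - m.+1) => q ^+ (10 * m + s) - q ^+ (10 * (m.+1 + l) + s)))
  => [|l _]; last by rewrite ifT ?[(m.+1 + _)%N]addnC //; lia.
rewrite (@prod_above _ _ 10); last by lia.
by rewrite exprD; ring.
Qed.

Lemma sum_halves (F : nat -> pseries R) M :
  \sum_(m < 2 * M) F m = \sum_(m < M) F (M + m)%N + \sum_(m < M) F (M - m.+1)%N.
Proof.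
rewrite mul2n -addnn big_split_ord addrC; congr (_ + _).
exact: (reindex_inj rev_ord_inj).
Qed.

Section Pole.
(* The poles are the monomials q^(10 m + s), q^(10 m + sa) and q^(10 m + sb) with
   m < 2 M, and the point of evaluation is y = q^(10 M), in the middle, so that in
   the limit both halves of each class give a Lambert series.  This part computes
   the term of the pole q^(10 m + s).  In the class of sa, the next exponent above
   that of the pole is 10 (m + ba) + sa, at distance ra; similarly for sb.
   The exponents e and e' are those of the two resulting Lambert series, for
   m >= M and for m < M. *)
Variables (s sa ba ra sb bb rb : nat).
Hypotheses (s0 : (0 < s < 10)%N) (sa0 : (0 < sa < 10)%N) (sb0 : (0 < sb < 10)%N).
Hypotheses (ba1 : (ba <= 1)%N) (bb1 : (bb <= 1)%N).
Hypotheses (era : (s + ra = 10 * ba + sa)%N) (erb : (s + rb = 10 * bb + sb)%N).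
Hypotheses (ra0 : (0 < ra < 10)%N) (rb0 : (0 < rb < 10)%N).
Variables e e' : nat -> nat.
Hypothesis he : forall m, (m <= e m)%N.
Hypothesis he' : forall m, (m <= e' m)%N.
Let delta : int := ba%:Z * (s%:Z - sa%:Z) + bb%:Z * (s%:Z - sb%:Z).
Let sigma : int := s%:Z + sa%:Z + sb%:Z.
Hypothesis eE : forall m : nat, (e m : int) =
  15 * m%:Z ^+ 2 + (15 + 3 * s%:Z - sigma) * m%:Z + delta.
Hypothesis eE' : forall m : nat, (e' m : int) =
  15 * m%:Z ^+ 2 + (25 + sigma - 3 * s%:Z) * m%:Z + (10 + sigma - 4 * s%:Z) + delta.

(** What remains of the product of the differences between the pole and the other
    poles, after removal of signs and monomials. *)
Definition pole_den M m := P (2 * M - m.+1)%N * P m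
  * (pochN R ra 10 (2 * M - (m + ba)) * pochN R (10 - ra) 10 (m + ba))
  * (pochN R rb 10 (2 * M - (m + bb)) * pochN R (10 - rb) 10 (m + bb)).

Definition pole_term M m : pseries R := (-1) ^+ (ba + bb) *
  (if (M <= m)%N
   then (-1) ^+ (m - M) * q ^+ e (m - M) * (1 - q ^+ (10 * (m - M) + s))^-1
   else (-1) ^+ (M - m.+1) * q ^+ e' (M - m.+1) * (1 - q ^+ (10 * (M - m.+1) + (10 - s)))^-1)
  * (pole_den M m)^-1.

Lemma pole_den_unit M m : pole_den M m \is a GRing.unit.
Proof. by rewrite /pole_den !unitrM !pochN_unit //; lia. Qed.

(** The hypothesis of [partial_fractions] at this pole, with the numerator
    exponent 3 M - 1; the content is the computation of the exponent of q. *)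
Lemma pole_termE M m : (m < 2 * M)%N ->
  pole_term M m * ((q ^+ (10 * M) - q ^+ (10 * m + s)) *
    ((-1) ^+ m * q ^+ ((10 * m + s) * (2 * M - m.+1) + csum s m) * (P (2 * M - m.+1)%N * P m) *
     (((-1) ^+ (m + ba) * q ^+ ((10 * m + s) * (2 * M - (m + ba)) + csum sa (m + ba)) *
        (pochN R ra 10 (2 * M - (m + ba)) * pochN R (10 - ra) 10 (m + ba))) *
      ((-1) ^+ (m + bb) * q ^+ ((10 * m + s) * (2 * M - (m + bb)) + csum sb (m + bb)) *
        (pochN R rb 10 (2 * M - (m + bb)) * pochN R (10 - rb) 10 (m + bb)))))) =
  (-1) ^+ M * q ^+ (csum s M + csum sa M + csum sb M + 10 * M) * (q ^+ (10 * m + s)) ^+ (3 * M - 1).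
Proof.
move=> mM.
set X1 := ((10 * m + s) * (2 * M - m.+1) + csum s m)%N.
set X2 := ((10 * m + s) * (2 * M - (m + ba)) + csum sa (m + ba))%N.
set X3 := ((10 * m + s) * (2 * M - (m + bb)) + csum sb (m + bb))%N.
have csZ t k : exists2 c, csum t k = c & (c : int) = 5 * k%:Z ^+ 2 - 5 * k%:Z + k%:Z * t%:Z.
  by exists (csum t k); rewrite // /csum; case: k => [|k] //=; rewrite !PoszD !PoszM; ring.
have DU := pole_den_unit M m.
have e3 : ((3 * M - 1)%N : int) = 3 * M%:Z - 1 by lia.
have cancel (f i a sg' qe y S1 S2 S3 : pseries R) D1 D2 D3 : f * i = 1 ->
    D1 * D2 * D3 = pole_den M m ->
    a * (sg' * qe * i) * (pole_den M m)^-1 *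
    (y * f * (S1 * D1 * (S2 * D2 * (S3 * D3)))) = a * sg' * S1 * S2 * S3 * (qe * y).
  move=> fi eD; transitivity (a * sg' * S1 * S2 * S3 * (qe * y) * (f * i) *
    (D1 * D2 * D3 * (pole_den M m)^-1)).
    by move: (_^-1) => d; ring.
  by rewrite fi eD divrr // !mulr1.
have sgn k l : odd (k + l) = false -> (-1) ^+ k = (-1) ^+ l :> pseries R.
  by move=> kl; rewrite -signr_odd -[RHS]signr_odd; congr (_ ^+ nat_of_bool _); lia.
rewrite /pole_term; case: ifP => Mm.
- have -> : q ^+ (10 * M) - q ^+ (10 * m + s) =
      q ^+ (10 * M) * (1 - q ^+ (10 * (m - M) + s)).
    by rewrite mulrBr mulr1 -exprD; congr (_ - q ^+ _); lia.
  rewrite cancel //; last first.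
    by rewrite divrr // ps_unitE coef0_1mX ?oner_eq0 //; lia.
  transitivity ((-1) ^+ (ba + bb + (m - M) + m + (m + ba) + (m + bb)) *
     q ^+ (e (m - M) + 10 * M + X1 + X2 + X3) : pseries R).
    by rewrite !exprD; ring.
  rewrite -exprM -mulrA -exprD; congr (_ * q ^+ _); first by apply: sgn; lia.
  have [mu emu] : exists mu, m = (M + mu)%N by exists (m - M)%N; lia.
  have [ka eka] : exists ka, M = (mu + ka + 1)%N by exists (M - mu.+1)%N; lia.
  apply/eqP; rewrite -eqz_nat; apply/eqP; rewrite /X1 /X2 /X3.
  have -> : (m - M = mu)%N by lia.
  have -> : (2 * M - m.+1 = ka)%N by lia.
  have ea b : (b <= 1)%N -> ((2 * M - (m + b))%N : int) = ka%:Z + 1 - b%:Z by lia.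
  have [c1 -> z1] := csZ s m; have [c2 -> z2] := csZ sa (m + ba)%N.
  have [c3 -> z3] := csZ sb (m + bb)%N; have [c4 -> z4] := csZ s M.
  have [c5 -> z5] := csZ sa M; have [c6 -> z6] := csZ sb M.
  rewrite !PoszD z1 z2 z3 z4 z5 z6 eE !(PoszM (_ + _)%N) !ea // e3 /delta /sigma emu eka.
  rewrite !(PoszD, PoszM).
  by case: ba ba1 => [|[|]] //; case: bb bb1 => [|[|]] // _ _; ring.
have -> : q ^+ (10 * M) - q ^+ (10 * m + s) =
    - q ^+ (10 * m + s) * (1 - q ^+ (10 * (M - m.+1) + (10 - s))).
  by rewrite mulNr mulrBr mulr1 -exprD opprB; congr (q ^+ _ - _); lia.
rewrite cancel //; last first.
  by rewrite divrr // ps_unitE coef0_1mX ?oner_eq0 //; lia.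
transitivity ((-1) ^+ ((ba + bb + (M - m.+1) + m + (m + ba) + (m + bb)).+1) *
   q ^+ (e' (M - m.+1) + (10 * m + s) + X1 + X2 + X3) : pseries R).
  by rewrite !exprD !exprS !exprD; ring.
rewrite -exprM -mulrA -exprD; congr (_ * q ^+ _); first by apply: sgn; lia.
have [mu emu] : exists mu, M = (m + mu + 1)%N by exists (M - m.+1)%N; lia.
apply/eqP; rewrite -eqz_nat; apply/eqP; rewrite /X1 /X2 /X3.
have -> : (M - m.+1 = mu)%N by lia.
have ez : ((2 * M - m.+1)%N : int) = m%:Z + 2 * mu%:Z + 1 by lia.
have ea b : (b <= 1)%N -> ((2 * M - (m + b))%N : int) = m%:Z + 2 * mu%:Z + 2 - b%:Z by lia.
have [c1 -> z1] := csZ s m; have [c2 -> z2] := csZ sa (m + ba)%N.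
have [c3 -> z3] := csZ sb (m + bb)%N; have [c4 -> z4] := csZ s M.
have [c5 -> z5] := csZ sa M; have [c6 -> z6] := csZ sb M.
rewrite !PoszD z1 z2 z3 z4 z5 z6 eE' !(PoszM (_ + _)%N) !ea // e3 ez /delta /sigma emu.
rewrite !(PoszD, PoszM).
by case: ba ba1 => [|[|]] //; case: bb bb1 => [|[|]] // _ _; ring.
Qed.

(** The contribution of one class of poles in the limit: for fixed distance from
    the middle, the denominators tend to products of infinite Pochhammer symbols,
    and [tannery] allows the exchange of limit and sum. *)
Lemma pole_sum_cvg : pcvg (fun M => \sum_(m < 2 * M) pole_term M m)
  ((-1) ^+ (ba + bb) * (lam e s + lam e' (10 - s)) /
   (Poo ^+ 2 * (poch R ra 10 * poch R (10 - ra) 10) * (poch R rb 10 * poch R (10 - rb) 10))).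
Proof.
pose D := Poo ^+ 2 * (poch R ra 10 * poch R (10 - ra) 10) * (poch R rb 10 * poch R (10 - rb) 10).
have D0 : D 0%N != 0.
  by rewrite -ps_unitE /D expr2 !unitrM !poch_unit //; lia.
have den_cvg (phi : nat -> nat) :
    (forall N, exists K, forall M, (K <= M)%N -> (N <= phi M)%N && (N <= 2 * M - (phi M).+1)%N) ->
    pcvg (fun M => (pole_den M (phi M))^-1) D^-1.
  move=> phiP; apply: pcvgV => //.
  have cv c (psi : nat -> nat) : (0 < c)%N ->
      (forall M, (phi M <= psi M)%N || (2 * M - (phi M).+1 <= psi M)%N) ->
      pcvg (fun M => pochN R c 10 (psi M)) (poch R c 10).
    move=> c0 hpsi; apply: (pcvg_comp (phi := psi) _ (poch_cvg R c0 _)) => // N.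
    have [K hK] := phiP N; exists K => M /hK; have := hpsi M; lia.
  rewrite /D expr2; apply: pcvgM; [apply: pcvgM; [|apply: pcvgM]|apply: pcvgM].
  - by apply: pcvgM; apply: cv => // M; rewrite leqnn ?orbT.
  - by apply: (cv _ (fun M => 2 * M - (phi M + ba))%N) => [|M]; lia.
  - by apply: (cv _ (fun M => phi M + ba)%N) => [|M]; lia.
  - by apply: (cv _ (fun M => 2 * M - (phi M + bb))%N) => [|M]; lia.
  - by apply: (cv _ (fun M => phi M + bb)%N) => [|M]; lia.
have lim (f : nat -> nat) t (phi : nat -> nat -> nat) : (forall m, (m <= f m)%N) ->
    (forall m N, exists K, forall M, (K <= M)%N ->
       (N <= phi m M)%N && (N <= 2 * M - (phi m M).+1)%N) ->
    pcvg (fun M => \sum_(m < M) (-1) ^+ (ba + bb) *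
       ((-1) ^+ m * q ^+ f m * (1 - q ^+ (10 * m + t))^-1) * (pole_den M (phi m M))^-1)
      ((-1) ^+ (ba + bb) * lam f t / D).
  move=> hf phiP; rewrite mulrAC nsumM; last exact: lam_summable.
  apply: (@tannery _ (fun M m => (-1) ^+ (ba + bb) *
       ((-1) ^+ m * q ^+ f m * (1 - q ^+ (10 * m + t))^-1) * (pole_den M (phi m M))^-1) _ id)
    => // [M m|m].
    rewrite mulrAC -(mulr0 ((-1) ^+ (ba + bb) / pole_den M (phi m M))).
    by apply: eqmM => //; apply: lam_summable.
  rewrite [X in pcvg _ X]mulrAC; apply: pcvgM; first exact: pcvg_cst.
  exact: den_cvg.
apply: (@pcvg_ext _ (fun M =>
  \sum_(m < M) (-1) ^+ (ba + bb) * ((-1) ^+ m * q ^+ e m * (1 - q ^+ (10 * m + s))^-1)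
     * (pole_den M (M + m))^-1 +
  \sum_(m < M) (-1) ^+ (ba + bb) * ((-1) ^+ m * q ^+ e' m * (1 - q ^+ (10 * m + (10 - s)))^-1)
     * (pole_den M (M - m.+1))^-1)).
  move=> M; rewrite sum_halves; congr (_ + _); apply: eq_bigr => m _; rewrite /pole_term.
    have -> : (M <= M + m)%N = true by apply: leq_addr.
    by have -> : (M + m - M = m)%N by apply: addKn.
  have -> : (M <= M - m.+1)%N = false by have := ltn_ord m; lia.
  by have -> : (M - (M - m.+1).+1 = m)%N by have := ltn_ord m; lia.
rewrite mulrDr mulrDl; apply: pcvgD.
  by apply: (lim e s (fun m M => M + m)%N) => // m N; exists (N + m.+1)%N => M; lia.
by apply: (lim e' (10 - s)%N (fun m M => M - m.+1)%N) => // m N; exists (N + m.+1)%N => M; lia.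
Qed.

End Pole.

End Lambert.

Section LambertPartialFractions.
Variable R : fieldType.
Local Notation q := (pq R).
Local Notation P := (pochN R 10 10).
Local Notation Poo := (poch R 10 10).
Local Notation lam := (lam R).

(** This is [q^k; q^10]_oo. *)
Definition brac k : pseries R := poch R k 10 * poch R (10 - k) 10.

(** The limit M -> oo, after removal of a monomial, of the partial fractions of
    y^(3 M - 1) / \prod_(m < 2 M) (y - q^(10 m + s0)) (y - q^(10 m + s1)) (y - q^(10 m + s2))
    at y = q^(10 M).  The exponents e_i and e_i' are given by their values, so that
    an instance can choose the form in which it wants them. *)
Lemma lambert_partial_fractions (s0 s1 s2 : nat) (e0 e1 e2 e0' e1' e2' : nat -> nat) :
  let sigma : int := s0%:Z + s1%:Z + s2%:Z in
  let E (e : nat -> nat) (s : nat) (d : int) := forall m : nat, (m <= e m)%N /\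
    (e m : int) = 15 * m%:Z ^+ 2 + (15 + 3 * s%:Z - sigma) * m%:Z + d in
  let E' (e : nat -> nat) (s : nat) (d : int) := forall m : nat, (m <= e m)%N /\
    (e m : int) = 15 * m%:Z ^+ 2 + (25 + sigma - 3 * s%:Z) * m%:Z
      + (10 + sigma - 4 * s%:Z) + d in
  (0 < s0)%N -> (s0 < s1)%N -> (s1 < s2)%N -> (s2 < 10)%N ->
  E e0 s0 0 -> E e1 s1 (s1%:Z - s0%:Z) -> E e2 s2 (s2%:Z - s0%:Z + (s2%:Z - s1%:Z)) ->
  E' e0' s0 0 -> E' e1' s1 (s1%:Z - s0%:Z) ->
  E' e2' s2 (s2%:Z - s0%:Z + (s2%:Z - s1%:Z)) ->
  (brac s0 * brac s1 * brac s2)^-1 =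
    (lam e0 s0 + lam e0' (10 - s0)) / (Poo ^+ 2 * brac (s1 - s0) * brac (s2 - s0))
  - (lam e1 s1 + lam e1' (10 - s1)) / (Poo ^+ 2 * brac (10 + s0 - s1) * brac (s2 - s1))
  + (lam e2 s2 + lam e2' (10 - s2)) / (Poo ^+ 2 * brac (10 + s0 - s2) * brac (10 + s1 - s2)).
Proof.
move=> sigma E E' h0 h01 h12 h2 hE0 hE1 hE2 hE0' hE1' hE2'.
pose t0 := pole_term R s0 0 (s1 - s0) 0 (s2 - s0) e0 e0'.
pose t1 := pole_term R s1 1 (10 + s0 - s1) 0 (s2 - s1) e1 e1'.
pose t2 := pole_term R s2 1 (10 + s0 - s2) 1 (10 + s1 - s2) e2 e2'.
have F0 (m : nat) : (e0 m : int) = 15 * m%:Z ^+ 2 +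
    (15 + 3 * s0%:Z - (s0%:Z + s1%:Z + s2%:Z)) * m%:Z +
    (0%N%:Z * (s0%:Z - s1%:Z) + 0%N%:Z * (s0%:Z - s2%:Z)).
  by rewrite (hE0 m).2 /sigma; ring.
have F0' (m : nat) : (e0' m : int) = 15 * m%:Z ^+ 2 +
    (25 + (s0%:Z + s1%:Z + s2%:Z) - 3 * s0%:Z) * m%:Z +
    (10 + (s0%:Z + s1%:Z + s2%:Z) - 4 * s0%:Z) +
    (0%N%:Z * (s0%:Z - s1%:Z) + 0%N%:Z * (s0%:Z - s2%:Z)).
  by rewrite (hE0' m).2 /sigma; ring.
have K0 := @pole_termE R s0 s1 0 (s1 - s0) s2 0 (s2 - s0) ltac:(lia) ltac:(lia) ltac:(lia)
  isT isT ltac:(lia) ltac:(lia) ltac:(lia) ltac:(lia) e0 e0' F0 F0'.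
have L0 := @pole_sum_cvg R s0 s1 0 (s1 - s0) s2 0 (s2 - s0) ltac:(lia) ltac:(lia) ltac:(lia)
  isT isT ltac:(lia) ltac:(lia) ltac:(lia) ltac:(lia) e0 e0'
  (fun m => (hE0 m).1) (fun m => (hE0' m).1).
have F1 (m : nat) : (e1 m : int) = 15 * m%:Z ^+ 2 +
    (15 + 3 * s1%:Z - (s1%:Z + s0%:Z + s2%:Z)) * m%:Z +
    (1%N%:Z * (s1%:Z - s0%:Z) + 0%N%:Z * (s1%:Z - s2%:Z)).
  by rewrite (hE1 m).2 /sigma; ring.
have F1' (m : nat) : (e1' m : int) = 15 * m%:Z ^+ 2 +
    (25 + (s1%:Z + s0%:Z + s2%:Z) - 3 * s1%:Z) * m%:Z +
    (10 + (s1%:Z + s0%:Z + s2%:Z) - 4 * s1%:Z) +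
    (1%N%:Z * (s1%:Z - s0%:Z) + 0%N%:Z * (s1%:Z - s2%:Z)).
  by rewrite (hE1' m).2 /sigma; ring.
have K1 := @pole_termE R s1 s0 1 (10 + s0 - s1) s2 0 (s2 - s1) ltac:(lia) ltac:(lia) ltac:(lia)
  isT isT ltac:(lia) ltac:(lia) ltac:(lia) ltac:(lia) e1 e1' F1 F1'.
have L1 := @pole_sum_cvg R s1 s0 1 (10 + s0 - s1) s2 0 (s2 - s1) ltac:(lia) ltac:(lia) ltac:(lia)
  isT isT ltac:(lia) ltac:(lia) ltac:(lia) ltac:(lia) e1 e1'
  (fun m => (hE1 m).1) (fun m => (hE1' m).1).
have F2 (m : nat) : (e2 m : int) = 15 * m%:Z ^+ 2 +
    (15 + 3 * s2%:Z - (s2%:Z + s0%:Z + s1%:Z)) * m%:Z +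
    (1%N%:Z * (s2%:Z - s0%:Z) + 1%N%:Z * (s2%:Z - s1%:Z)).
  by rewrite (hE2 m).2 /sigma; ring.
have F2' (m : nat) : (e2' m : int) = 15 * m%:Z ^+ 2 +
    (25 + (s2%:Z + s0%:Z + s1%:Z) - 3 * s2%:Z) * m%:Z +
    (10 + (s2%:Z + s0%:Z + s1%:Z) - 4 * s2%:Z) +
    (1%N%:Z * (s2%:Z - s0%:Z) + 1%N%:Z * (s2%:Z - s1%:Z)).
  by rewrite (hE2' m).2 /sigma; ring.
have K2 := @pole_termE R s2 s0 1 (10 + s0 - s2) s1 1 (10 + s1 - s2) ltac:(lia) ltac:(lia) ltac:(lia)
  isT isT ltac:(lia) ltac:(lia) ltac:(lia) ltac:(lia) e2 e2' F2 F2'.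
have L2 := @pole_sum_cvg R s2 s0 1 (10 + s0 - s2) s1 1 (10 + s1 - s2) ltac:(lia) ltac:(lia) ltac:(lia)
  isT isT ltac:(lia) ltac:(lia) ltac:(lia) ltac:(lia) e2 e2'
  (fun m => (hE2 m).1) (fun m => (hE2' m).1).
have fin M : (0 < M)%N ->
    (pochN R s0 10 M * pochN R (10 - s0) 10 M * (pochN R s1 10 M * pochN R (10 - s1) 10 M)
      * (pochN R s2 10 M * pochN R (10 - s2) 10 M))^-1 =
    \sum_(m < 2 * M) t0 M m + \sum_(m < 2 * M) t1 M m + \sum_(m < 2 * M) t2 M m.
  move=> M0.
  pose I : finType := ('I_(2 * M) + 'I_(2 * M) + 'I_(2 * M))%type.
  pose ex (i : I) : nat := match i with
    inl (inl m) => (10 * m + s0)%N | inl (inr m) => (10 * m + s1)%N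
    | inr m => (10 * m + s2)%N end.
  pose g (i : I) := match i with
    inl (inl m) => t0 M m | inl (inr m) => t1 M m | inr m => t2 M m end.
  pose D := pochN R s0 10 M * pochN R (10 - s0) 10 M * (pochN R s1 10 M * pochN R (10 - s1) 10 M)
      * (pochN R s2 10 M * pochN R (10 - s2) 10 M).
  have DU : D \is a GRing.unit by rewrite /D !unitrM !pochN_unit //; lia.
  have -> : \sum_(m < 2 * M) t0 M m + \sum_(m < 2 * M) t1 M m + \sum_(m < 2 * M) t2 M m =
      \sum_i g i by rewrite !big_sumType.
  apply: esym; apply: (@partial_fractions _ _ (fun i => q ^+ ex i) (q ^+ (10 * M))
    ((-1) ^+ M * q ^+ (csum s0 M + csum s1 M + csum s2 M + 10 * M)) g _ (3 * M - 1)).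
  - move=> i j /pq_inj; rewrite /ex.
    case: i => [[i|i]|i]; case: j => [[j|j]|j] /= e;
      first [by exfalso; lia|by have -> : i = j by apply/val_inj => /=; lia].
  - by move=> i; apply/eqP => /pq_inj; rewrite /ex; case: i => [[i|i]|i] /=; lia.
  - by rewrite !card_sum card_ord; lia.
  - have own s m : (m < 2 * M)%N ->
        \prod_(l < 2 * M | l != m :> nat) (q ^+ (10 * m + s) - q ^+ (10 * l + s)) =
        (-1) ^+ m * q ^+ ((10 * m + s) * (2 * M - m.+1) + csum s m)
          * (P (2 * M - m.+1)%N * P m) by apply: own_class_prod.
    have other s t r b m : (m < 2 * M)%N -> (b <= 1)%N -> (s + r = 10 * b + t)%N ->
        (r < 10)%N ->
        \prod_(l < 2 * M) (q ^+ (10 * m + s) - q ^+ (10 * l + t)) =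
        (-1) ^+ (m + b) * q ^+ ((10 * m + s) * (2 * M - (m + b)) + csum t (m + b)) *
          (pochN R r 10 (2 * M - (m + b)) * pochN R (10 - r) 10 (m + b)).
      by move=> mM b1 er r10; apply: class_prod => //; lia.
    have arr0 (t d A1 A2 A3 c : pseries R) :
      t * (d * (A1 * (A2 * A3))) = c -> t * (d * (A1 * A2 * A3)) = c by rewrite !mulrA.
    have arr1 (t d A1 A2 A3 c : pseries R) :
      t * (d * (A2 * (A1 * A3))) = c -> t * (d * (A1 * A2 * A3)) = c.
      by rewrite [A2 * (A1 * A3)]mulrCA !mulrA.
    have arr2 (t d A1 A2 A3 c : pseries R) :
      t * (d * (A3 * (A1 * A2))) = c -> t * (d * (A1 * A2 * A3)) = c.
      by rewrite [A3 * _]mulrC !mulrA.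
    case=> [[m|m]|m]; have mM := ltn_ord m; rewrite big_sumType big_sumType.
    + apply: arr0; rewrite -[RHS](K0 M m mM); congr (_ * (_ * (_ * (_ * _)))).
      * by rewrite -own //; apply: eq_bigl => l.
      * by rewrite -(@other s0 s1 (s1 - s0)%N 0 m mM isT ltac:(lia) ltac:(lia)); apply: eq_bigl => l.
      * by rewrite -(@other s0 s2 (s2 - s0)%N 0 m mM isT ltac:(lia) ltac:(lia)); apply: eq_bigl => l.
    + apply: arr1; have := K1 M m mM; rewrite (addnC (csum s1 M)) => <-.
      congr (_ * (_ * (_ * (_ * _)))).
      * by rewrite -own //; apply: eq_bigl => l.
      * by rewrite -(@other s1 s0 (10 + s0 - s1)%N 1 m mM isT ltac:(lia) ltac:(lia)); apply: eq_bigl => l.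
      * by rewrite -(@other s1 s2 (s2 - s1)%N 0 m mM isT ltac:(lia) ltac:(lia)); apply: eq_bigl => l.
    apply: arr2; have := K2 M m mM.
    have -> : (csum s2 M + csum s0 M + csum s1 M = csum s0 M + csum s1 M + csum s2 M)%N by lia.
    move=> <-.
    congr (_ * (_ * (_ * (_ * _)))).
    + by rewrite -own //; apply: eq_bigl => l.
    + by rewrite -(@other s2 s0 (10 + s0 - s2)%N 1 m mM isT ltac:(lia) ltac:(lia)); apply: eq_bigl => l.
    by rewrite -(@other s2 s1 (10 + s1 - s2)%N 1 m mM isT ltac:(lia) ltac:(lia)); apply: eq_bigl => l.
  have yprod s : (0 < s < 10)%N ->
      \prod_(l < 2 * M) (q ^+ (10 * M) - q ^+ (10 * l + s)) =
      (-1) ^+ M * q ^+ (10 * M * M + csum s M) * (pochN R s 10 M * pochN R (10 - s) 10 M).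
    move=> s10; rewrite (@class_prod _ _ _ _ s M) //; [|lia..].
    by have -> : (2 * M - M = M)%N by lia.
  rewrite -/D; apply: (mulrI DU); rewrite mulrA divrr // mul1r !big_sumType.
  transitivity (\prod_(l < 2 * M) (q ^+ (10 * M) - q ^+ (10 * l + s0)) *
     \prod_(l < 2 * M) (q ^+ (10 * M) - q ^+ (10 * l + s1)) *
     \prod_(l < 2 * M) (q ^+ (10 * M) - q ^+ (10 * l + s2))); first by [].
  rewrite (yprod s0 ltac:(lia)) (yprod s1 ltac:(lia)) (yprod s2 ltac:(lia)).
  have sgn3 : (-1) ^+ M * (-1) ^+ M = 1 :> pseries R by rewrite -expr2 sqrr_sign.
  transitivity (D * ((-1) ^+ M * ((-1) ^+ M * (-1) ^+ M)
      * q ^+ (10 * M * M + csum s0 M + (10 * M * M + csum s1 M) + (10 * M * M + csum s2 M)))).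
    by rewrite !exprD /D; ring.
  rewrite sgn3 mulr1 -exprM -[(-1) ^+ M * _ * _]mulrA -exprD; congr (_ * (_ * q ^+ _)).
  by case: (M) M0 => // k _; rewrite mulnBr muln1; nia.
have brac0 s : (0 < s)%N -> (s < 10)%N -> brac s \is a GRing.unit.
  by move=> sp s10; rewrite unitrM !poch_unit //; lia.
apply: (@pcvg_uniq _ (fun M =>
    (pochN R s0 10 M * pochN R (10 - s0) 10 M * (pochN R s1 10 M * pochN R (10 - s1) 10 M)
      * (pochN R s2 10 M * pochN R (10 - s2) 10 M))^-1)).
  apply: pcvgV; first by rewrite -ps_unitE !unitrM !poch_unit //; lia.
  by apply: pcvgM; [apply: pcvgM|]; apply: pcvgM; apply: poch_cvg => //; lia.
apply: (pcvg_ev (fun M h => esym (fin M h))).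
have := pcvgD (pcvgD L0 L1) L2.
by rewrite !add0n mul1r expr1 sqrrN expr1n mul1r mulN1r mulNr.
Qed.

End LambertPartialFractions.

(** ** Four instances *)

Section Instances.
Variable R : fieldType.
Local Notation q := (pq R).
Local Notation Poo := (poch R 10 10).
Local Notation B := (brac R).
Local Notation t := (theta R).

(** With j = (15 - s0 - s1 - s2) / 2, the exponents of [lambert_partial_fractions]
    are, up to constants, [lexp j s] for the residue s and [lexp (5 - j) (10 - s)]
    for the residue 10 - s. *)
Definition lexp j s m := (15 * m ^ 2 + (3 * s + 2 * j) * m)%N.

Definition Nser j s : pseries R := lam R (lexp j s) s.

Lemma NserX c j s : (0 < s)%N -> q ^+ c * Nser j s = lam R (fun m => lexp j s m + c)%N s.
Proof. by move=> s0; rewrite /Nser lam_shift // => m; rewrite /lexp; nia. Qed.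

Lemma theta_brac k : (0 < k < 10)%N -> t k = Poo * B k.
Proof. by move=> k10; rewrite /theta (@triple_product R 5). Qed.

Lemma brac_sym k : (k <= 10)%N -> B (10 - k) = B k.
Proof. by move=> k10; rewrite /brac subKn // mulrC. Qed.

Lemma brac_unit k : (0 < k < 10)%N -> B k \is a GRing.unit.
Proof. by move=> k10; rewrite /brac unitrM !poch_unit //; lia. Qed.

Lemma clear_denominators (X Y0 Y1 Y2 D c0 c1 c2 n0 n1 n2 : pseries R) :
  X^-1 = n0 / Y0 - n1 / Y1 + n2 / Y2 ->
  [&& X \is a GRing.unit, Y0 \is a GRing.unit, Y1 \is a GRing.unit & Y2 \is a GRing.unit] ->
  D = c0 * Y0 -> D = c1 * Y1 -> D = c2 * Y2 ->
  D = X * (c0 * n0 - c1 * n1 + c2 * n2).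
Proof.
move=> e /and4P[XU U0 U1 U2] d0 d1 d2; rewrite -[LHS]mulr1 -(divrr XU) mulrCA e; congr (_ * _).
rewrite mulrDr mulrBr {1}d0 {1}d1 d2.
have s (c Y n : pseries R) : Y \is a GRing.unit -> c * Y * (n / Y) = c * n.
  by move=> U; rewrite mulrCA mulrK // mulrC.
by rewrite !s.
Qed.

(* Checks one of the six exponents of an instance. *)
Local Ltac exponent :=
  by move=> m; split; rewrite /lexp; [nia|rewrite !(PoszD, PoszM); ring].

(** In this and the next three lemmas the residues s0, s1, s2 are odd, as in the
    Lambert series of the rank; their differences are even, so that of the theta
    series only theta 2 and theta 4 are multiplied with Lambert series. *)
Lemma lambert_139 :
  Poo ^+ 3 * t 4 * t 2 ^+ 2 = t 1 ^+ 2 * t 3 *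
  (t 4 * (q ^+ 0 * Nser 1 1 + q ^+ 19 * Nser 4 9)
   - t 2 * (q ^+ 2 * Nser 1 3 + q ^+ 13 * Nser 4 7)
   + t 2 * (q ^+ 14 * Nser 1 9 + q ^+ 1 * Nser 4 1)).
Proof.
have e := @lambert_partial_fractions R 1 3 9 (fun m => lexp 1 1 m + 0)%N (fun m => lexp 1 3 m + 2)%N (fun m => lexp 1 9 m + 14)%N
  (fun m => lexp 4 9 m + 19)%N (fun m => lexp 4 7 m + 13)%N (fun m => lexp 4 1 m + 1)%N isT isT isT isT.
rewrite -!NserX // in e.
have {}e := e ltac:(exponent) ltac:(exponent) ltac:(exponent)
  ltac:(exponent) ltac:(exponent) ltac:(exponent).
have PU : Poo \is a GRing.unit by rewrite poch_unit.
have b8 : B 8 = B 2 := @brac_sym 2 isT.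
have b6 : B 6 = B 4 := @brac_sym 4 isT.
have b9 : B 9 = B 1 := @brac_sym 1 isT.
have b7 : B 7 = B 3 := @brac_sym 3 isT.
rewrite -[(10 + 1 - 3)%N]/(8)%N -[(10 + 1 - 9)%N]/(2)%N
  -[(10 + 3 - 9)%N]/(4)%N -[(3 - 1)%N]/(2)%N
  -[(9 - 1)%N]/(8)%N -[(9 - 3)%N]/(6)%N in e.
rewrite ?b8 ?b6 ?b9 ?b7 in e.
have {}e := @clear_denominators _ _ _ _ (Poo ^+ 2 * (B 4 * B 2 ^+ 2)) (B 4) (B 2) (B 2) _ _ _ e.
have {}e := e ltac:(by rewrite !unitrM !poch_unit).
have {}e := e ltac:(ring) ltac:(ring) ltac:(ring).
rewrite !theta_brac //; move: e.
move: (Nser 1 1) (Nser 4 9) (Nser 1 3) (Nser 4 7) (Nser 1 9) (Nser 4 1) => n0 n1 n2 n3 n4 n5 e.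
transitivity (Poo ^+ 4 * (Poo ^+ 2 * (B 4 * B 2 ^+ 2))); first by ring.
by rewrite e; ring.
Qed.

Lemma lambert_157 :
  Poo ^+ 3 * t 4 ^+ 2 * t 2 = t 1 * t 3 * t 5 *
  (t 2 * (q ^+ 0 * Nser 1 1 + q ^+ 19 * Nser 4 9)
   - t 4 * (q ^+ 4 * Nser 1 5 + q ^+ 7 * Nser 4 5)
   + t 4 * (q ^+ 8 * Nser 1 7 + q ^+ 3 * Nser 4 3)).
Proof.
have e := @lambert_partial_fractions R 1 5 7 (fun m => lexp 1 1 m + 0)%N (fun m => lexp 1 5 m + 4)%N (fun m => lexp 1 7 m + 8)%N
  (fun m => lexp 4 9 m + 19)%N (fun m => lexp 4 5 m + 7)%N (fun m => lexp 4 3 m + 3)%N isT isT isT isT.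
rewrite -!NserX // in e.
have {}e := e ltac:(exponent) ltac:(exponent) ltac:(exponent)
  ltac:(exponent) ltac:(exponent) ltac:(exponent).
have PU : Poo \is a GRing.unit by rewrite poch_unit.
have b8 : B 8 = B 2 := @brac_sym 2 isT.
have b6 : B 6 = B 4 := @brac_sym 4 isT.
have b9 : B 9 = B 1 := @brac_sym 1 isT.
have b7 : B 7 = B 3 := @brac_sym 3 isT.
rewrite -[(10 + 1 - 5)%N]/(6)%N -[(10 + 1 - 7)%N]/(4)%N
  -[(10 + 5 - 7)%N]/(8)%N -[(5 - 1)%N]/(4)%N
  -[(7 - 1)%N]/(6)%N -[(7 - 5)%N]/(2)%N in e.
rewrite ?b8 ?b6 ?b9 ?b7 in e.
have {}e := @clear_denominators _ _ _ _ (Poo ^+ 2 * (B 4 ^+ 2 * B 2)) (B 2) (B 4) (B 4) _ _ _ e.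
have {}e := e ltac:(by rewrite !unitrM !poch_unit).
have {}e := e ltac:(ring) ltac:(ring) ltac:(ring).
rewrite !theta_brac //; move: e.
move: (Nser 1 1) (Nser 4 9) (Nser 1 5) (Nser 4 5) (Nser 1 7) (Nser 4 3) => n0 n1 n2 n3 n4 n5 e.
transitivity (Poo ^+ 4 * (Poo ^+ 2 * (B 4 ^+ 2 * B 2))); first by ring.
by rewrite e; ring.
Qed.

Lemma lambert_137 :
  Poo ^+ 3 * t 4 ^+ 2 * t 2 = t 1 * t 3 ^+ 2 *
  (t 4 * (q ^+ 0 * Nser 2 1 + q ^+ 17 * Nser 3 9)
   - t 4 * (q ^+ 2 * Nser 2 3 + q ^+ 11 * Nser 3 7)
   + t 2 * (q ^+ 10 * Nser 2 7 + q ^+ 3 * Nser 3 3)).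
Proof.
have e := @lambert_partial_fractions R 1 3 7 (fun m => lexp 2 1 m + 0)%N (fun m => lexp 2 3 m + 2)%N (fun m => lexp 2 7 m + 10)%N
  (fun m => lexp 3 9 m + 17)%N (fun m => lexp 3 7 m + 11)%N (fun m => lexp 3 3 m + 3)%N isT isT isT isT.
rewrite -!NserX // in e.
have {}e := e ltac:(exponent) ltac:(exponent) ltac:(exponent)
  ltac:(exponent) ltac:(exponent) ltac:(exponent).
have PU : Poo \is a GRing.unit by rewrite poch_unit.
have b8 : B 8 = B 2 := @brac_sym 2 isT.
have b6 : B 6 = B 4 := @brac_sym 4 isT.
have b9 : B 9 = B 1 := @brac_sym 1 isT.
have b7 : B 7 = B 3 := @brac_sym 3 isT.
rewrite -[(10 + 1 - 3)%N]/(8)%N -[(10 + 1 - 7)%N]/(4)%N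
  -[(10 + 3 - 7)%N]/(6)%N -[(3 - 1)%N]/(2)%N
  -[(7 - 1)%N]/(6)%N -[(7 - 3)%N]/(4)%N in e.
rewrite ?b8 ?b6 ?b9 ?b7 in e.
have {}e := @clear_denominators _ _ _ _ (Poo ^+ 2 * (B 4 ^+ 2 * B 2)) (B 4) (B 4) (B 2) _ _ _ e.
have {}e := e ltac:(by rewrite !unitrM !poch_unit).
have {}e := e ltac:(ring) ltac:(ring) ltac:(ring).
rewrite !theta_brac //; move: e.
move: (Nser 2 1) (Nser 3 9) (Nser 2 3) (Nser 3 7) (Nser 2 7) (Nser 3 3) => n0 n1 n2 n3 n4 n5 e.
transitivity (Poo ^+ 4 * (Poo ^+ 2 * (B 4 ^+ 2 * B 2))); first by ring.
by rewrite e; ring.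
Qed.

Lemma lambert_135 :
  Poo ^+ 3 * t 4 * t 2 ^+ 2 = t 1 * t 3 * t 5 *
  (t 2 * (q ^+ 0 * Nser 3 1 + q ^+ 15 * Nser 2 9)
   - t 4 * (q ^+ 2 * Nser 3 3 + q ^+ 9 * Nser 2 7)
   + t 2 * (q ^+ 6 * Nser 3 5 + q ^+ 5 * Nser 2 5)).
Proof.
have e := @lambert_partial_fractions R 1 3 5 (fun m => lexp 3 1 m + 0)%N (fun m => lexp 3 3 m + 2)%N (fun m => lexp 3 5 m + 6)%N
  (fun m => lexp 2 9 m + 15)%N (fun m => lexp 2 7 m + 9)%N (fun m => lexp 2 5 m + 5)%N isT isT isT isT.
rewrite -!NserX // in e.
have {}e := e ltac:(exponent) ltac:(exponent) ltac:(exponent)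
  ltac:(exponent) ltac:(exponent) ltac:(exponent).
have PU : Poo \is a GRing.unit by rewrite poch_unit.
have b8 : B 8 = B 2 := @brac_sym 2 isT.
have b6 : B 6 = B 4 := @brac_sym 4 isT.
have b9 : B 9 = B 1 := @brac_sym 1 isT.
have b7 : B 7 = B 3 := @brac_sym 3 isT.
rewrite -[(10 + 1 - 3)%N]/(8)%N -[(10 + 1 - 5)%N]/(6)%N
  -[(10 + 3 - 5)%N]/(8)%N -[(3 - 1)%N]/(2)%N
  -[(5 - 1)%N]/(4)%N -[(5 - 3)%N]/(2)%N in e.
rewrite ?b8 ?b6 ?b9 ?b7 in e.
have {}e := @clear_denominators _ _ _ _ (Poo ^+ 2 * (B 4 * B 2 ^+ 2)) (B 2) (B 4) (B 2) _ _ _ e.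
have {}e := e ltac:(by rewrite !unitrM !poch_unit).
have {}e := e ltac:(ring) ltac:(ring) ltac:(ring).
rewrite !theta_brac //; move: e.
move: (Nser 3 1) (Nser 2 9) (Nser 3 3) (Nser 2 7) (Nser 3 5) (Nser 2 5) => n0 n1 n2 n3 n4 n5 e.
transitivity (Poo ^+ 4 * (Poo ^+ 2 * (B 4 * B 2 ^+ 2))); first by ring.
by rewrite e; ring.
Qed.

End Instances.

(** * The five residue classes *)

Section Sections.
Variable R : fieldType.
Local Notation q := (pq R).
Local Notation Poo := (poch R 10 10).
Local Notation t := (theta R).
Local Notation N := (Nser R).

Lemma nsum_classes (F : nat -> pseries R) d : summable F ->
  nsum F = \sum_(r < d.+1) nsum (fun k => F (k * d.+1 + r)%N).
Proof.
move=> sF; have sFr r : summable (fun k => F (k * d.+1 + r)%N).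
  by move=> k; apply: (@eqmW _ (k * d.+1 + r)); [nia|apply: sF].
apply: pseriesP => n; rewrite (nsumE (N := n.+1 * d.+1) sF); last by nia.
have -> : \sum_(k < n.+1 * d.+1) F k = \sum_(i < n.+1) \sum_(r < d.+1) F (i * d.+1 + r)%N.
  elim: (n.+1) => [|m IHm]; first by rewrite mul0n !big_ord0.
  rewrite [RHS]big_ord_recr -IHm /= mulSn addnC big_split_ord /=.
  by congr (_ + _); apply: eq_bigr => r _.
rewrite exchange_big /= !coef_sumps; apply: eq_bigr => r _.
by rewrite (nsumE (N := n.+1) (sFr r)).
Qed.

Lemma pcvg_prod d (u : nat -> nat -> pseries R) f : (forall r, pcvg (u r) (f r)) ->
  pcvg (fun M => \prod_(r < d) u r M) (\prod_(r < d) f r).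
Proof.
move=> uf; elim: d => [|d IHd].
  by rewrite big_ord0; apply: (pcvg_ext _ (pcvg_cst 1)) => M; rewrite big_ord0.
rewrite big_ord_recr; apply: (pcvg_ext _ (pcvgM IHd (uf d))) => M.
by rewrite big_ord_recr.
Qed.

(** The factors 1 - q^(a + k b) are sorted by the residue of k modulo d + 1. *)
Lemma poch_classes a b d : (0 < a)%N -> (0 < b)%N ->
  poch R a b = \prod_(r < d.+1) poch R (a + r * b) (d.+1 * b).
Proof.
move=> a0 b0; apply: (@pcvg_uniq _ (fun M => pochN R a b (M * d.+1))).
  apply: (@pcvg_comp _ _ _ (fun M => M * d.+1)%N); last exact: poch_cvg.
  by move=> M; exists M => n; nia.
have fin M : pochN R a b (M * d.+1) = \prod_(r < d.+1) pochN R (a + r * b) (d.+1 * b) M.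
  rewrite /pochN exchange_big /=; elim: M => [|M IHM]; first by rewrite mul0n !big_ord0.
  rewrite [RHS]big_ord_recr -IHM /= mulSn addnC big_split_ord /=.
  by congr (_ * _); apply: eq_bigr => r _; congr (1 - q ^+ _); nia.
apply: (pcvg_ext (u := fun M => \prod_(r < d.+1) pochN R (a + r * b) (d.+1 * b) M)) => //.
apply: (@pcvg_prod d.+1 (fun r => pochN R (a + r * b) (d.+1 * b)) (fun r => poch R (a + r * b) (d.+1 * b))) => r.
by apply: poch_cvg; lia.
Qed.

(** J_2 times the generating series of the ranks 1 minus that of the ranks 2. *)
Definition Lser : pseries R := nsum (fun m =>
  (-1) ^+ m * q ^+ (3 * m ^ 2 + 3 * m + 1) *
  (q ^+ (2 * m + 1) - q ^+ (2 * (2 * m + 1)) - q ^+ (3 * (2 * m + 1)) + q ^+ (4 * (2 * m + 1)))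
  * (1 - q ^+ (5 * (2 * m + 1)))^-1).

(** The sections of [Lser]: the coefficients of q^(5 n + c), as n varies.  Each of
    the twenty pairs (j, r) of a power of q^(2 m + 1) in the numerator of [Lser]
    and a residue r of m modulo 5 contributes to one of them. *)
Definition Lsec0 := - (q ^+ 2 * N 1 3) + q ^+ 14 * N 1 9 + q ^+ 1 * N 4 1 - q ^+ 13 * N 4 7.
Definition Lsec1 := q ^+ 10 * N 2 7 + q ^+ 3 * N 3 3.
Definition Lsec2 := q ^+ 0 * N 1 1 + q ^+ 19 * N 4 9.
Definition Lsec3 := - (q ^+ 0 * N 2 1) + q ^+ 2 * N 2 3 + q ^+ 11 * N 3 7 - q ^+ 17 * N 3 9.
Definition Lsec4 := q ^+ 4 * N 1 5 - q ^+ 8 * N 1 7 - q ^+ 5 * N 2 5 - q ^+ 15 * N 2 9 - q ^+ 0 * N 3 1 - q ^+ 6 * N 3 5 - q ^+ 3 * N 4 3 + q ^+ 7 * N 4 5.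

(** The terms of index m = 5 k + r, whose denominator 1 - q^(5 (10 k + 2 r + 1)) is
    a series in q^5. *)
Lemma Lser_term_nsum j r :
  nsum (fun k => (-1) ^+ (k * 5 + r) * q ^+ (3 * (k * 5 + r) ^ 2 + 3 * (k * 5 + r) + 1) *
     q ^+ (j * (2 * (k * 5 + r) + 1)) * (1 - q ^+ (5 * (2 * (k * 5 + r) + 1)))^-1) =
  (-1) ^+ r * q ^+ (3 * r ^ 2 + 3 * r + 1 + j * (2 * r + 1)) * dil 5 (N j (2 * r + 1)).
Proof.
have sN : summable (fun m => (-1) ^+ m * q ^+ lexp j (2 * r + 1) m
    * (1 - q ^+ (10 * m + (2 * r + 1)))^-1).
  by apply: lam_summable => m; rewrite /lexp; nia.
rewrite /Nser /lam dil_nsum // nsumM; last exact: dil_summable.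
apply: eq_nsum => k; rewrite !rmorphM rmorph_sign /= dil_pqX.
rewrite rmorphV; last by rewrite ps_unitE coef0_1mX ?oner_eq0 //; lia.
rewrite rmorphB rmorph1 /= dil_pqX.
have -> : (5 * (2 * (k * 5 + r) + 1) = (10 * k + (2 * r + 1)) * 5)%N by lia.
set i := (_ ^-1).
have -> : (-1) ^+ (k * 5 + r) = (-1) ^+ r * (-1) ^+ k :> pseries R.
  by rewrite -exprD -signr_odd -[RHS]signr_odd; congr (_ ^+ nat_of_bool _); lia.
have -> : (-1) ^+ r * (-1) ^+ k * q ^+ (3 * (k * 5 + r) ^ 2 + 3 * (k * 5 + r) + 1) *
    q ^+ (j * (2 * (k * 5 + r) + 1)) * i = (-1) ^+ r * (-1) ^+ k *
    q ^+ (3 * (k * 5 + r) ^ 2 + 3 * (k * 5 + r) + 1 + j * (2 * (k * 5 + r) + 1)) * i.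
  by rewrite -(mulrA _ (q ^+ _) (q ^+ _)) -(exprD q).
have -> : (3 * (k * 5 + r) ^ 2 + 3 * (k * 5 + r) + 1 + j * (2 * (k * 5 + r) + 1) =
   3 * r ^ 2 + 3 * r + 1 + j * (2 * r + 1) + lexp j (2 * r + 1) k * 5)%N.
  by rewrite /lexp; nia.
by rewrite [q ^+ (_ + _ * 5)]exprD; ring.
Qed.

Lemma dilD f g : dil 5 (f + g) = dil 5 f + dil 5 g :> pseries R.
Proof. exact: rmorphD. Qed.
Lemma dilN f : dil 5 (- f) = - dil 5 f :> pseries R.
Proof. exact: rmorphN. Qed.
Lemma dilB f g : dil 5 (f - g) = dil 5 f - dil 5 g :> pseries R.
Proof. exact: rmorphB. Qed.
Lemma dil_pqXM a f : dil 5 (q ^+ a * f) = (q ^+ 5) ^+ a * dil 5 f :> pseries R.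
Proof. by rewrite rmorphM /= dil_pqX -exprM mulnC. Qed.

Lemma Lser_dissection : Lser = dil 5 Lsec0 + q * dil 5 Lsec1 + q ^+ 2 * dil 5 Lsec2
  + q ^+ 3 * dil 5 Lsec3 + q ^+ 4 * dil 5 Lsec4.
Proof.
pose F j m := (-1) ^+ m * q ^+ (3 * m ^ 2 + 3 * m + 1) * q ^+ (j * (2 * m + 1))
  * (1 - q ^+ (5 * (2 * m + 1)))^-1.
pose E j r := (-1) ^+ odd r * q ^+ (3 * r ^ 2 + 3 * r + 1 + j * (2 * r + 1))
  * dil 5 (N j (2 * r + 1)).
have FE j : nsum (F j) = \sum_(r < 5) E j r.
  rewrite (@nsum_classes _ 4).
    by apply: eq_bigr => r _; rewrite /F Lser_term_nsum /E signr_odd.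
  move=> m; rewrite /F; move: (_^-1) => i.
  have -> : (-1) ^+ m * q ^+ (3 * m ^ 2 + 3 * m + 1) * q ^+ (j * (2 * m + 1)) * i =
      q ^+ (3 * m ^ 2 + 3 * m + 1) * ((-1) ^+ m * q ^+ (j * (2 * m + 1)) * i).
    by rewrite !mulrA; congr (_ * _ * _); apply: mulrC.
  by apply: eqm_pqX; nia.
have -> : Lser = nsum (F 1%N) - nsum (F 2%N) - nsum (F 3%N) + nsum (F 4%N).
  rewrite /Lser -!nsumN -!nsumD; apply: eq_nsum => m; rewrite /F mul1n.
  by move: (_ ^-1) => i; ring.
have EE j r a b s (o : bool) : (3 * r ^ 2 + 3 * r + 1 + j * (2 * r + 1) = b + 5 * a)%N ->
    (2 * r + 1 = s)%N -> odd r = o ->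
    E j r = (if o then -1 else 1) * (q ^+ b * (q ^+ 5) ^+ a) * dil 5 (N j s).
  by move=> e1 <- <-; rewrite /E e1 exprD exprM; case: odd; rewrite ?expr1.
(* The arguments are j, r, the quotient and the remainder modulo 5 of the
   exponent, the residue 2 r + 1, and the parity of r. *)
have E10 := EE 1%N 0%N 0%N 2%N 1%N false erefl erefl erefl.
have E20 := EE 2%N 0%N 0%N 3%N 1%N false erefl erefl erefl.
have E30 := EE 3%N 0%N 0%N 4%N 1%N false erefl erefl erefl.
have E40 := EE 4%N 0%N 1%N 0%N 1%N false erefl erefl erefl.
have E11 := EE 1%N 1%N 2%N 0%N 3%N true erefl erefl erefl.
have E21 := EE 2%N 1%N 2%N 3%N 3%N true erefl erefl erefl.
have E31 := EE 3%N 1%N 3%N 1%N 3%N true erefl erefl erefl.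
have E41 := EE 4%N 1%N 3%N 4%N 3%N true erefl erefl erefl.
have E12 := EE 1%N 2%N 4%N 4%N 5%N false erefl erefl erefl.
have E22 := EE 2%N 2%N 5%N 4%N 5%N false erefl erefl erefl.
have E32 := EE 3%N 2%N 6%N 4%N 5%N false erefl erefl erefl.
have E42 := EE 4%N 2%N 7%N 4%N 5%N false erefl erefl erefl.
have E13 := EE 1%N 3%N 8%N 4%N 7%N true erefl erefl erefl.
have E23 := EE 2%N 3%N 10%N 1%N 7%N true erefl erefl erefl.
have E33 := EE 3%N 3%N 11%N 3%N 7%N true erefl erefl erefl.
have E43 := EE 4%N 3%N 13%N 0%N 7%N true erefl erefl erefl.
have E14 := EE 1%N 4%N 14%N 0%N 9%N false erefl erefl erefl.
have E24 := EE 2%N 4%N 15%N 4%N 9%N false erefl erefl erefl.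
have E34 := EE 3%N 4%N 17%N 3%N 9%N false erefl erefl erefl.
have E44 := EE 4%N 4%N 19%N 2%N 9%N false erefl erefl erefl.
have sum5 (f : nat -> pseries R) : \sum_(r < 5) f r =
    f 0%N + (f 1%N + (f 2%N + (f 3%N + f 4%N))) by rewrite !big_ord_recl big_ord0 addr0.
rewrite !FE !sum5 E10 E20 E30 E40 E11 E21 E31 E41 E12 E22 E32 E42 E13 E23 E33 E43 E14 E24 E34 E44.
rewrite /Lsec0 /Lsec1 /Lsec2 /Lsec3 /Lsec4.
move: (N 1 1) (N 2 1) (N 3 1) (N 4 1) (N 1 3) (N 2 3) (N 3 3) (N 4 3) (N 1 5) (N 2 5) (N 3 5) (N 4 5) (N 1 7) (N 2 7) (N 3 7) (N 4 7) (N 1 9) (N 2 9) (N 3 9) (N 4 9) =>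
  n10 n20 n30 n40 n11 n21 n31 n41 n12 n22 n32 n42 n13 n23 n33 n43 n14 n24 n34 n44.
rewrite !(dilB, dilD, dilN, dil_pqXM).
cbv iota; ring.
Qed.

End Sections.

(** * Solving for the residue classes 1, 2 and 3 *)

Section Elimination.
Variable R : fieldType.
Local Notation q := (pq R).
Local Notation Poo := (poch R 10 10).
Local Notation t := (theta R).

(** The difference of the two sides is in the ideal generated by the four
    relations [theta_rel1] to [theta_rel4]; the cofactors are displayed in the
    proof, here and for the next two identities. *)
Lemma theta_I0 : t 1 ^+ 2 * t 3 * (t 4 ^+ 3 * t 5 + 2%:R * q * t 3 * t 2 ^+ 2 * t 4
    - q ^+ 2 * t 2 ^+ 3 * t 1) = t 2 ^+ 4 * t 4 ^+ 3.
Proof.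
have W1 := theta_rel1 R; have W2 := theta_rel2 R.
have W3 := theta_rel3 R; have W4 := theta_rel4 R.
move: (t 1) (t 2) (t 3) (t 4) (t 5) q W1 W2 W3 W4 => t1 t2 t3 t4 t5 w W1 W2 W3 W4.
apply/eqP; rewrite -subr_eq0; apply/eqP.
transitivity (- (t2 * t4 ^+ 2) * (w * t1 ^+ 3 * t5 + t1 * t3 ^+ 3 - t2 ^+ 3 * t4)
  + (t1 * t4 * t5 + t2 * t3 ^+ 2) *
    (w * t1 ^+ 2 * t2 * t4 + t1 * t3 * t4 ^+ 2 - t2 ^+ 2 * t3 * t5)
  + t2 ^+ 2 * t4 * (w * t1 ^+ 2 * t3 ^+ 2 + t1 * t3 * t5 ^+ 2 - t2 ^+ 2 * t4 ^+ 2)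
  - t2 ^+ 3 * (w ^+ 2 * t1 ^+ 3 * t3 + t2 * t4 ^+ 3 - t3 ^+ 3 * t5)); first by ring.
by rewrite W1 W2 W3 W4; ring.
Qed.

Lemma theta_I3 : t 1 * t 3 ^+ 2 * (t 4 ^+ 3 * t 3 + 2%:R * q * t 1 * t 2 * t 4 ^+ 2
    - q * t 2 ^+ 3 * t 5) = t 2 ^+ 3 * t 4 ^+ 4.
Proof.
have W2 := theta_rel2 R; have W4 := theta_rel4 R.
move: (t 1) (t 2) (t 3) (t 4) (t 5) q W2 W4 => t1 t2 t3 t4 t5 w W2 W4.
apply/eqP; rewrite -subr_eq0; apply/eqP.
transitivity ((w * t1 * t2 * t3 + t3 ^+ 2 * t4) *
    (w * t1 ^+ 2 * t2 * t4 + t1 * t3 * t4 ^+ 2 - t2 ^+ 2 * t3 * t5)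
  - t2 ^+ 2 * t4 * (w ^+ 2 * t1 ^+ 3 * t3 + t2 * t4 ^+ 3 - t3 ^+ 3 * t5)); first by ring.
by rewrite W2 W4; ring.
Qed.

Lemma theta_I4 : t 1 * t 3 * t 5 * (t 4 ^+ 4 * t 1 - 3%:R * t 5 * t 2 ^+ 2 * t 4 ^+ 2
    - q * t 2 ^+ 4 * t 3) = - 2%:R * t 2 ^+ 4 * t 4 ^+ 4.
Proof.
have W1 := theta_rel1 R; have W2 := theta_rel2 R.
have W3 := theta_rel3 R; have W4 := theta_rel4 R.
move: (t 1) (t 2) (t 3) (t 4) (t 5) q W1 W2 W3 W4 => t1 t2 t3 t4 t5 w W1 W2 W3 W4.
apply/eqP; rewrite -subr_eq0; apply/eqP.
transitivity (w ^+ 2 * t1 ^+ 3 * t3 * (w * t1 ^+ 3 * t5 + t1 * t3 ^+ 3 - t2 ^+ 3 * t4)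
  + (w * t1 * t2 ^+ 2 * t3 + t1 * t4 ^+ 2 * t5) *
    (w * t1 ^+ 2 * t2 * t4 + t1 * t3 * t4 ^+ 2 - t2 ^+ 2 * t3 * t5)
  + (- (w * t1 ^+ 2 * t3 ^+ 2) - 2%:R * t2 ^+ 2 * t4 ^+ 2) *
    (w * t1 ^+ 2 * t3 ^+ 2 + t1 * t3 * t5 ^+ 2 - t2 ^+ 2 * t4 ^+ 2)
  - w * t1 ^+ 3 * t5 * (w ^+ 2 * t1 ^+ 3 * t3 + t2 * t4 ^+ 3 - t3 ^+ 3 * t5)); first by ring.
by rewrite W1 W2 W3 W4; ring.
Qed.

Lemma sect_sum (f0 f1 f2 f3 f4 : pseries R) :
  let f := dil 5 f0 + q * dil 5 f1 + q ^+ 2 * dil 5 f2 + q ^+ 3 * dil 5 f3 + q ^+ 4 * dil 5 f4 in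
  [/\ sect 5 0 f = f0, sect 5 1 f = f1, sect 5 2 f = f2, sect 5 3 f = f3 & sect 5 4 f = f4].
Proof.
have s (c k : nat) g : (c < 5)%N -> (k < 5)%N ->
    sect 5 c (q ^+ k * dil 5 g) = if c == k then g else 0 :> pseries R.
  move=> c5 k5; rewrite sect_pqX //; last exact: ltnW.
  case: leqP => kc; rewrite sect_dil //; try lia.
    by rewrite subn_eq0 eqn_leq kc andbT.
  by rewrite !ifF ?mulr0 //; lia.
rewrite /= -[dil 5 f0]mul1r -(expr0 q) -[q in q * dil 5 f1]expr1.
by split; rewrite !sectD !s //= ?addr0 ?add0r.
Qed.

Lemma poch2 : poch R 2 2 = Poo * brac R 2 * brac R 4.
Proof.
have -> : poch R 2 2 = poch R 2 10 * (poch R 4 10 * (poch R 6 10 * (poch R 8 10 * Poo))).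
  by rewrite (@poch_classes R 2 2 4) // !big_ord_recl big_ord0 mulr1.
rewrite /brac -[(10 - 2)%N]/8%N -[(10 - 4)%N]/6%N.
move: (poch R 2 10) (poch R 4 10) (poch R 6 10) (poch R 8 10) Poo => a b c d e.
by ring.
Qed.

Lemma theta_unit k : (0 < k < 10)%N -> t k \is a GRing.unit.
Proof. by move=> k10; rewrite theta_brac // unitrM poch_unit // brac_unit. Qed.

Lemma cramer3 (T : idomainType) (a1 a2 a3 b1 b2 b3 c1 c2 c3 x y z : T) :
  a1 * (b2 * c3 - b3 * c2) - a2 * (b1 * c3 - b3 * c1) + a3 * (b1 * c2 - b2 * c1) != 0 ->
  a1 * x + a2 * y + a3 * z = 0 -> b1 * x + b2 * y + b3 * z = 0 ->
  c1 * x + c2 * y + c3 * z = 0 -> [/\ x = 0, y = 0 & z = 0].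
Proof.
set D := (X in X != 0) => D0 ea eb ec.
have H u : D * u = 0 -> u = 0 by move=> /eqP; rewrite mulf_eq0 (negPf D0) => /eqP.
split; apply: H.
- transitivity ((b2 * c3 - b3 * c2) * (a1 * x + a2 * y + a3 * z)
    - (a2 * c3 - a3 * c2) * (b1 * x + b2 * y + b3 * z)
    + (a2 * b3 - a3 * b2) * (c1 * x + c2 * y + c3 * z)); first by rewrite /D; ring.
  by rewrite ea eb ec; ring.
- transitivity (- (b1 * c3 - b3 * c1) * (a1 * x + a2 * y + a3 * z)
    + (a1 * c3 - a3 * c1) * (b1 * x + b2 * y + b3 * z)
    - (a1 * b3 - a3 * b1) * (c1 * x + c2 * y + c3 * z)); first by rewrite /D; ring.
  by rewrite ea eb ec; ring.
transitivity ((b1 * c2 - b2 * c1) * (a1 * x + a2 * y + a3 * z)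
  - (a1 * c2 - a2 * c1) * (b1 * x + b2 * y + b3 * z)
  + (a1 * b2 - a2 * b1) * (c1 * x + c2 * y + c3 * z)); first by rewrite /D; ring.
by rewrite ea eb ec; ring.
Qed.

(** Let a, b be theta 4 and theta 2.  Multiplication of J_2 H = L by J_10,
    which is J_2 at q^5, and [theta_dissection] give five equations (E0 to E4
    below) for the sections h0 to h4 of H.  The combinations a^2 E2 + a b E0, a E3 - b E1 and
    q a b E4 + a^2 E1 - q b^2 E2 contain neither h0 nor h4. *)
Lemma sections_of_quotient (H : pseries R) : (2%:R : R) != 0 -> poch R 2 2 * H = Lser R ->
  [/\ t 2 * t 4 * sect 5 1 H = q * Poo ^+ 2 * t 1,
      t 2 * t 4 * sect 5 2 H = Poo ^+ 2 * t 5
    & t 2 * t 4 * sect 5 3 H = - (Poo ^+ 2 * t 3)].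
Proof.
move=> R2 eH; set a := t 4; set b := t 2; pose kap := poch R 2 2.
have ab : b * a = kap * Poo by rewrite /a /b !theta_brac // /kap poch2; ring.
have dk : dil 5 kap = Poo by rewrite /kap dil_poch.
have main : (dil 5 (a ^+ 2) * H) - q ^+ 2 * (dil 5 (b * a) * H) - q ^+ 4 * (dil 5 (b ^+ 2) * H)
    = dil 5 kap * Lser R.
  have TD := theta_dissection R2; rewrite -/a -/b in TD.
  rewrite dk -eH -/kap [RHS]mulrA (_ : Poo * kap = b * a); last by rewrite ab mulrC.
  by rewrite [in RHS]TD !rmorphXn /=; ring.
have [s0 s1 s2 s3 s4] := sect_sum (Lsec0 R) (Lsec1 R) (Lsec2 R) (Lsec3 R) (Lsec4 R).
rewrite -Lser_dissection in s0 s1 s2 s3 s4.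
have E c : (c < 5)%N -> a ^+ 2 * sect 5 c H
   - (if (2 <= c)%N then b * a * sect 5 (c - 2) H else q * (b * a * sect 5 (c + 5 - 2) H))
   - (if (4 <= c)%N then b ^+ 2 * sect 5 (c - 4) H else q * (b ^+ 2 * sect 5 (c + 5 - 4) H))
   = kap * sect 5 c (Lser R).
  move=> c5; rewrite -[RHS]sect_dilM // -main !sectD !sectN !sect_pqX //.
  by case: c c5 => [|[|[|[|[|c]]]]] // _; rewrite /= !sect_dilM.
have E0 := E 0%N isT; have E1 := E 1%N isT; have E2 := E 2%N isT.
have E3 := E 3%N isT; have E4 := E 4%N isT.
rewrite s0 s1 s2 s3 s4 /= in E0 E1 E2 E3 E4.
(* The right-hand sides of the three combinations, in closed form. *)
have PF0 : Poo ^+ 3 * a * b ^+ 2 = t 1 ^+ 2 * t 3 * (a * Lsec2 R + b * Lsec0 R).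
  rewrite (lambert_139 R) /Lsec0 /Lsec2 -/a -/b.
  by move: (Nser R 1 1) (Nser R 4 9) (Nser R 1 3) (Nser R 4 7) (Nser R 1 9) (Nser R 4 1)
    => n0 n1 n2 n3 n4 n5; ring.
have PF3 : Poo ^+ 3 * a ^+ 2 * b = t 1 * t 3 ^+ 2 * (b * Lsec1 R - a * Lsec3 R).
  rewrite (lambert_137 R) /Lsec1 /Lsec3 -/a -/b.
  by move: (Nser R 2 1) (Nser R 3 9) (Nser R 2 3) (Nser R 3 7) (Nser R 2 7) (Nser R 3 3)
    => n0 n1 n2 n3 n4 n5; ring.
have PF4 : t 1 * t 3 * t 5 * (q * b * a * Lsec4 R + a ^+ 2 * Lsec1 R - q * b ^+ 2 * Lsec2 R)
    = - 2%:R * q * (b * a) ^+ 2 * Poo ^+ 3.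
  have e1 := lambert_157 R; have e2 := lambert_135 R.
  rewrite -/a -/b in e1 e2.
  transitivity (- (q * b * (Poo ^+ 3 * a ^+ 2 * b)) - q * a * (Poo ^+ 3 * a * b ^+ 2));
    last by move: Poo => P; ring.
  rewrite e1 e2 /Lsec1 /Lsec2 /Lsec4.
  move: (Nser R 1 1) (Nser R 4 9) (Nser R 1 5) (Nser R 4 5) (Nser R 1 7) (Nser R 4 3)
    (Nser R 3 1) (Nser R 2 9) (Nser R 3 3) (Nser R 2 7) (Nser R 3 5) (Nser R 2 5)
    => n0 n1 n2 n3 n4 n5 n6 n7 n8 n9 n10 n11.
  by move: (t 1) (t 3) (t 5) => t1 t3 t5; ring.
have I0 := theta_I0; have I3 := theta_I3; have I4 := theta_I4.
rewrite -/a -/b in I0 I3 I4.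
move: (sect 5 0 H) (sect 5 1 H) (sect 5 2 H) (sect 5 3 H) (sect 5 4 H) E0 E1 E2 E3 E4
  => h0 h1 h2 h3 h4 E0 E1 E2 E3 E4.
move: (Lsec0 R) (Lsec1 R) (Lsec2 R) (Lsec3 R) (Lsec4 R) PF0 PF3 PF4 E0 E1 E2 E3 E4
  => l0 l1 l2 l3 l4 PF0 PF3 PF4 E0 E1 E2 E3 E4 {E s0 s1 s2 s3 s4 main dk eH}.
have [t1u t3u t5u] : [/\ t 1 != 0, t 3 != 0 & t 5 != 0].
  have tn k : (0 < k < 10)%N -> t k != 0.
    by move/theta_unit; apply: contraTneq => ->; rewrite unitr0.
  by split; apply: tn.
have a1 : a 0%N = 1 by rewrite /a theta_brac // /brac !coef0M !poch_coef0 ?mulr1.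
have b1 : b 0%N = 1 by rewrite /b theta_brac // /brac !coef0M !poch_coef0 ?mulr1.
move: kap Poo ab PF0 PF3 PF4 E0 E1 E2 E3 E4 => kp P ab PF0 PF3 PF4 E0 E1 E2 E3 E4.
move: (t 1) (t 3) (t 5) t1u t3u t5u I0 I3 I4 PF0 PF3 PF4
  => t1 t3 t5 t1u t3u t5u I0 I3 I4 PF0 PF3 PF4.
move: a b a1 b1 ab I0 I3 I4 PF0 PF3 PF4 E0 E1 E2 E3 E4
  => a b a1 b1 ab I0 I3 I4 PF0 PF3 PF4 E0 E1 E2 E3 E4.
(* The deviations of h1, h2, h3 from the claimed values: they solve the
   homogeneous system. *)
pose x := b * a * h1 - q * P ^+ 2 * t1.
pose y := b * a * h2 - P ^+ 2 * t5.
pose z := b * a * h3 + P ^+ 2 * t3.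
suff [x0 y0 z0] : [/\ x = 0, y = 0 & z = 0].
  split; apply/eqP; rewrite -subr_eq0; first by rewrite -[X in X == _]/x x0.
    by rewrite -[X in X == _]/y y0.
  by rewrite opprK -[X in X == _]/z z0.
apply: (@cramer3 _ (- (q * a * b ^+ 3)) (a ^+ 4) (- (2%:R * q * a ^+ 2 * b ^+ 2))
  (- (2%:R * a ^+ 2 * b)) (q * b ^+ 3) (a ^+ 3)
  (a ^+ 4) (- (3%:R * q * a ^+ 2 * b ^+ 2)) (q ^+ 2 * b ^+ 4)).
- set d := (X in X != 0); apply/eqP => d0; have := congr1 (@^~ 0%N) d0.
  have q0 : q 0%N = 0 by [].
  rewrite /d !(coefBps, coefDps, coefNps, coef0M, coef0X) a1 b1 q0 coef0ps.
  rewrite !expr1n expr0n !(mulr0, mul0r, mulr1, mul1r, oppr0, addr0, add0r, subr0, sub0r, opprK).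
  by move/eqP; rewrite oner_eq0.
- have u0 : t1 ^+ 2 * t3 != 0 by rewrite mulf_neq0 // expf_neq0.
  apply: (mulfI u0); rewrite mulr0.
  transitivity (t1 ^+ 2 * t3 * (b * a) * (a ^+ 2 * (a ^+ 2 * h2 - b * a * h0 - q * (b ^+ 2 * h3))
      + b * a * (a ^+ 2 * h0 - q * (b * a * h3) - q * (b ^+ 2 * h1)))
    - P ^+ 2 * a * (t1 ^+ 2 * t3 * (a ^+ 3 * t5 + 2%:R * q * t3 * b ^+ 2 * a - q ^+ 2 * b ^+ 3 * t1))).
    by rewrite /x /y /z; ring.
  rewrite E2 E0 I0.
  transitivity ((b * a) * kp * a * (t1 ^+ 2 * t3 * (a * l2 + b * l0)) - P ^+ 2 * b ^+ 4 * a ^+ 4).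
    by ring.
  rewrite -PF0.
  transitivity ((b * a) * (kp * P) * P ^+ 2 * (b * a) ^+ 2 - P ^+ 2 * (b * a) ^+ 4); first by ring.
  by rewrite -ab; ring.
- have u0 : t1 * t3 ^+ 2 != 0 by rewrite mulf_neq0 // expf_neq0.
  apply: (mulfI u0); rewrite mulr0.
  transitivity (t1 * t3 ^+ 2 * (b * a) * (a * (a ^+ 2 * h3 - b * a * h1 - q * (b ^+ 2 * h4))
      - b * (a ^+ 2 * h1 - q * (b * a * h4) - q * (b ^+ 2 * h2)))
    + P ^+ 2 * (t1 * t3 ^+ 2 * (a ^+ 3 * t3 + 2%:R * q * t1 * b * a ^+ 2 - q * b ^+ 3 * t5))).
    by rewrite /x /y /z; ring.
  rewrite E3 E1 I3.
  transitivity (- ((b * a) * kp * (t1 * t3 ^+ 2 * (b * l1 - a * l3))) + P ^+ 2 * b ^+ 3 * a ^+ 4).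
    by ring.
  rewrite -PF3.
  transitivity (- ((b * a) * (kp * P) * P ^+ 2 * a ^+ 2 * b) + P ^+ 2 * (b * a) ^+ 2 * b * a ^+ 2).
    by ring.
  by rewrite -ab; ring.
have u0 : t1 * t3 * t5 != 0 by rewrite !mulf_neq0.
apply: (mulfI u0); rewrite mulr0.
transitivity (t1 * t3 * t5 * (b * a) * (
    q * b * a * (a ^+ 2 * h4 - b * a * h2 - b ^+ 2 * h0)
    + a ^+ 2 * (a ^+ 2 * h1 - q * (b * a * h4) - q * (b ^+ 2 * h2))
    - q * b ^+ 2 * (a ^+ 2 * h2 - b * a * h0 - q * (b ^+ 2 * h3)))
  - q * P ^+ 2 * (t1 * t3 * t5 * (a ^+ 4 * t1 - 3%:R * t5 * b ^+ 2 * a ^+ 2 - q * b ^+ 4 * t3))).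
  by rewrite /x /y /z; ring.
rewrite E4 E1 E2 I4.
transitivity ((b * a) * kp * (t1 * t3 * t5 * (q * b * a * l4 + a ^+ 2 * l1 - q * b ^+ 2 * l2))
  + 2%:R * q * P ^+ 2 * (b * a) ^+ 4); first by ring.
rewrite PF4.
transitivity (- (2%:R * q * (b * a) ^+ 3 * (kp * P) * P ^+ 2) + 2%:R * q * P ^+ 2 * (b * a) ^+ 4).
  by ring.
by rewrite -ab; ring.
Qed.

End Elimination.

(** * The generating function as a Lambert series *)

Section RankSeries.
Variable R : fieldType.
Local Notation q := (pq R).
Local Notation P := (pochN R 2 2).

Lemma gbin_pascal (p : pseries R) M j :
  gbin p M.+1 j.+1 = p ^+ j.+1 * gbin p M j.+1 + gbin p M j.
Proof.
have gS K i : gbin p K.+1 i.+1 = gbin p K i.+1 + p ^+ (K - i) * gbin p K i by [].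
elim: M j => [|M IHM] [|j]; rewrite gS.
- by rewrite gbin_gt // !gbin0 mulr0 !add0r expr0 mul1r.
- by rewrite !(@gbin_gt _ p 0) // !mulr0 !addr0.
- by rewrite {1}IHM gS !gbin0 !subn0 !exprS; ring.
rewrite {1}(IHM j.+1) {1}(IHM j) !gS subSS.
case: (ltnP M j.+1) => Mj.
  by rewrite (gbin_gt _ Mj); ring.
have -> : p ^+ (M - j) = p * p ^+ (M - j.+1) by rewrite -exprS; congr (_ ^+ _); lia.
by rewrite !exprS; ring.
Qed.

(** Pascal's rule splits the sum for (N + 1, a) in such a way that it reduces
    to the sum for (N, a + 1), which has the same value. *)
Lemma durfee_finite a N :
  \sum_(r < N.+1) gbin (q ^+ 2) N r * q ^+ (2 * (r * (r + a))) * (P (r + a))^-1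
  = (P (N + a))^-1.
Proof.
elim: N a => [|N IHN] a; first by rewrite big_ord1 gbin0 mul0n muln0 !mul1r.
rewrite addSnnS -IHN big_ord_recl gbin0 mul0n muln0 !mul1r add0n.
have PU k : P k \is a GRing.unit by rewrite pochN_unit.
have PV k : (P k)^-1 = (1 - q ^+ (2 + k * 2)) * (P k.+1)^-1.
  rewrite pochNS invrM //; last by rewrite ps_unitE coef0_1mX ?oner_eq0.
  by rewrite mulrA divrr ?mul1r // ps_unitE coef0_1mX ?oner_eq0.
pose u r := gbin (q ^+ 2) N r * q ^+ (2 * (r * (r + a.+1))) * (P (r + a.+1))^-1.
pose v r := gbin (q ^+ 2) N r * q ^+ (2 * (r * (r + a.+1)) + 2 * (r + a.+1)) * (P (r + a.+1))^-1.
have ev r : gbin (q ^+ 2) N r * q ^+ (2 * (r.+1 * (r.+1 + a))) * (P (r.+1 + a))^-1 = v r.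
  by rewrite /v -addSnnS; congr (_ * q ^+ _ * _); nia.
have eu r : (q ^+ 2) ^+ r * gbin (q ^+ 2) N r * q ^+ (2 * (r * (r + a))) * (P (r + a))^-1 = u r - v r.
  rewrite PV -addnS /u /v [q ^+ (_ + 2 * _)]exprD.
  have -> : q ^+ (2 * (r * (r + a.+1))) = (q ^+ 2) ^+ r * q ^+ (2 * (r * (r + a))).
    by rewrite -exprM -exprD; congr (q ^+ _); nia.
  have -> : (2 + (r + a) * 2 = 2 * (r + a.+1))%N by lia.
  by move: (_^-1) => i; ring.
transitivity ((P a)^-1 + (\sum_(r < N.+1) (u r.+1 - v r.+1) + \sum_(r < N.+1) v r)).
  congr (_ + _); rewrite -big_split; apply: eq_bigr => r _ /=.
  by rewrite /bump /= add1n gbin_pascal !mulrDl exprS -exprS -eu ev.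
rewrite -/(u 0%N).
transitivity ((u 0%N - v 0%N) + (\sum_(r < N.+1) (u r.+1 - v r.+1)) + \sum_(r < N.+1) v r).
  by rewrite -eu gbin0 mul0n muln0 !mul1r add0n addrA.
rewrite -(big_ord_recl _ (fun r : 'I_N.+2 => u r - v r)) big_ord_recr /=.
have -> : u N.+1 - v N.+1 = 0 by rewrite /u /v gbin_gt // !mul0r subrr.
by rewrite addr0 sumrB subrK.
Qed.

(** The Durfee rectangle identity, the limit N -> oo of [durfee_finite]. *)
Lemma durfee a :
  nsum (fun r => q ^+ (2 * (r * (r + a))) * (P r * P (r + a))^-1) = (poch R 2 2)^-1.
Proof.
have PU k : P k \is a GRing.unit by rewrite pochN_unit.
have lim1 : pcvg (fun N => (P (N + a))^-1) (poch R 2 2)^-1.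
  apply: pcvgV; first by rewrite poch_coef0 // oner_eq0.
  by apply: (@pcvg_comp _ _ _ (fun N => N + a)%N); [move=> M; exists M => n; lia|apply: poch_cvg].
apply: pcvg_uniq lim1; apply: (pcvg_ext (durfee_finite a)).
apply: (@tannery _ (fun N r => gbin (q ^+ 2) N r * q ^+ (2 * (r * (r + a))) * (P (r + a))^-1) _ S)
  => // [M r|r].
  rewrite -mulrA mulrCA; apply: eqm_pqX; nia.
have -> : q ^+ (2 * (r * (r + a))) * (P r * P (r + a))^-1 =
    (P r)^-1 * q ^+ (2 * (r * (r + a))) * (P (r + a))^-1.
  by rewrite invrM // mulrC -!mulrA mulrC -!mulrA.
apply: pcvgM; last exact: pcvg_cst.
apply: pcvgM; last exact: pcvg_cst.
apply: (@pcvg_ev _ (fun N => P N / (P r * P (N - r)))  _ _ r) => [N rN|].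
  by rewrite -(@gbin_poch R 2 isT N r rN) mulrK // unitrM !PU.
have pU : poch R 2 2 \is a GRing.unit by rewrite poch_unit.
rewrite -[(P r)^-1](_ : poch R 2 2 / (P r * poch R 2 2) = _); last first.
  by rewrite invrM // mulrA divrr // mul1r.
apply: pcvgM; first exact: poch_cvg.
apply: pcvgV; first by rewrite coef0M poch_coef0 // mulr1 pochN_coef0 // oner_eq0.
apply: pcvgM; first exact: pcvg_cst.
by apply: (@pcvg_comp _ _ _ (fun N => N - r)%N); [move=> M; exists (M + r)%N => n; lia|apply: poch_cvg].
Qed.

End RankSeries.

Section RankLambert.
Variable R : fieldType.
Local Notation q := (pq R).
Local Notation P := (pochN R 2 2).
Variable z : R.
Hypothesis z0 : z != 0.
Local Notation Z := (psC z).
Local Notation Zi := (psC z^-1).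

Lemma fac_coef0 (c : R) k : (0 < k)%N -> (1 - psC c * q ^+ k) 0%N = 1.
Proof.
by case: k => // k _; rewrite coefBps coef0M coef_pqX mulr0 subr0.
Qed.

Lemma fac_unit (c : R) k : (0 < k)%N -> 1 - psC c * q ^+ k \is a GRing.unit.
Proof. by move=> k0; rewrite ps_unitE fac_coef0 // oner_eq0. Qed.

Lemma ZiK : Z * Zi = 1.
Proof. by rewrite -rmorphM mulfV // rmorph1. Qed.

Lemma even_prod N m : (m < N)%N ->
  \prod_(l < N | l != m :> nat) (q ^+ (2 * m) - q ^+ (2 * l)) =
  (-1) ^+ m * q ^+ (2 * m * (N - m.+1) + m * m.-1) * (P (N - m.+1) * P m).
Proof.
move=> mN; rewrite big_mkcond.
rewrite -(big_mkord xpredT (fun l => if l != m then q ^+ (2 * m) - q ^+ (2 * l) else 1)).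
rewrite (big_cat_nat (n := m)) //=; last exact: ltnW.
rewrite [X in _ * X]big_ltn // eqxx mul1r big_mkord.
have -> : \prod_(l < m) (if (l : nat) != m then q ^+ (2 * m) - q ^+ (2 * l) else 1) =
    (-1) ^+ m * q ^+ (m * m.-1) * P m.
  have -> : (-1) ^+ m * q ^+ (m * m.-1) = \prod_(l < m) - q ^+ (2 * l).
    rewrite prodrN card_ord; congr (_ * _).
    elim: (m) => [|k IHk]; first by rewrite big_ord0.
    by rewrite big_ord_recr /= -IHk -exprD; congr (q ^+ _); case: (k) => [|k'] /=; nia.
  rewrite /pochN [X in _ * X](reindex_inj rev_ord_inj) -big_split.
  apply: eq_bigr => l _; have lm := ltn_ord l; rewrite /= mulNr mulrBr mulr1 -exprD opprB.
  have -> : ((l : nat) != m) = true by lia.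
  by congr (q ^+ _ - _); lia.
rewrite -{1}[m.+1]add0n big_addn big_mkord.
have -> : \prod_(l < N - m.+1) (if (l + m.+1)%N != m then q ^+ (2 * m) - q ^+ (2 * (l + m.+1)) else 1) =
    q ^+ (2 * m * (N - m.+1)) * P (N - m.+1)%N.
  rewrite /pochN [q ^+ (_ * (N - m.+1))]exprM -[in (q ^+ _) ^+ _](card_ord (N - m.+1)) -prodr_const -big_split.
  apply: eq_bigr => l _; rewrite /= mulrBr mulr1 -exprD.
  have -> : ((l + m.+1)%N != m) = true by lia.
  by congr (_ - q ^+ _); lia.
by rewrite exprD; ring.
Qed.

(** The terms of the poles z = q^(-(2 m + 1)) and z = q^(2 m + 1). *)
Definition rank_pole m : pseries R := (1 - Z * q ^+ (2 * m + 1))^-1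
  + Zi * q ^+ (2 * m + 1) * (1 - Zi * q ^+ (2 * m + 1))^-1.

Definition rank_prod n : pseries R :=
  \prod_(i < n.+1) ((1 - Z * q ^+ (2 * i + 1)) * (1 - Zi * q ^+ (2 * i + 1))).

(** Partial fractions in z.  The poles q^k for odd k with |k| <= 2 n + 1 involve
    negative exponents; multiplied by q^(2 n + 1), and with z replaced by its
    inverse, they become the nodes q^(2 l) with l < 2 n + 2, and the point of
    evaluation becomes q^(2 n + 1) / z. *)
Lemma rank_partial_fractions n : (rank_prod n)^-1 =
  \sum_(m < n.+1) (-1) ^+ m * q ^+ (m ^ 2 + m) * (P (n - m) * P (n + m.+1))^-1 * rank_pole m.
Proof.
pose A m := (-1) ^+ m * q ^+ (m ^ 2 + m) * (P (n - m) * P (n + m.+1))^-1.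
pose t l : pseries R := if (n.+1 <= l)%N
  then A (l - n.+1)%N * (1 - Z * q ^+ (2 * (l - n.+1) + 1))^-1
  else A (n - l)%N * (Zi * q ^+ (2 * (n - l) + 1) * (1 - Zi * q ^+ (2 * (n - l) + 1))^-1).
have halves (S : nat -> pseries R) : \sum_(l < n.+1 + n.+1) S l =
    \sum_(m < n.+1) S (n.+1 + m)%N + \sum_(m < n.+1) S (n - m)%N.
  rewrite big_split_ord addrC; congr (_ + _).
  rewrite (reindex_inj rev_ord_inj); apply: eq_bigr => m _.
  by congr S; rewrite /= subSS.
have halvesM (S : nat -> pseries R) : \prod_(l < n.+1 + n.+1) S l =
    \prod_(m < n.+1) S (n.+1 + m)%N * \prod_(m < n.+1) S (n - m)%N.
  rewrite big_split_ord mulrC; congr (_ * _).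
  rewrite (reindex_inj rev_ord_inj); apply: eq_bigr => m _.
  by congr S; rewrite /= subSS.
transitivity (\sum_(l < n.+1 + n.+1) t l); last first.
  rewrite halves -big_split; apply: eq_bigr => m _; have := ltn_ord m => mn.
  rewrite /t /rank_pole /=.
  have -> : (n < n.+1 + m)%N = true by lia.
  have -> : (n < n - m)%N = false by lia.
  have -> : (n.+1 + m - n.+1 = m)%N by lia.
  have -> : (n - (n - m) = m)%N by lia.
  by rewrite -mulrDr.
apply: esym; apply: (@partial_fractions _ _ (fun l : 'I_(n.+1 + n.+1) => q ^+ (2 * l))
  (Zi * q ^+ (2 * n + 1)) ((-1) ^+ n.+1 * Zi * q ^+ (2 * n + 1 + n * n.+1)) t _ n).
- by move=> i j /pq_inj e; apply/val_inj => /=; lia.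
- move=> l; apply/eqP => e; have := congr1 (@^~ (2 * n + 1)%N) e.
  rewrite coefCM !coef_pqX eqxx mulr1 => ez.
  have : (z^-1 != 0) by rewrite invr_eq0.
  have -> : z^-1 = 0.
    by rewrite ez; have -> : (2 * n + 1 == 2 * l)%N = false by lia.
  by rewrite eqxx.
- by rewrite card_ord; lia.
- move=> l; have ln := ltn_ord l.
  have -> : \prod_(j | j != l) (q ^+ (2 * l) - q ^+ (2 * j)) = (-1) ^+ l *
      q ^+ (2 * l * (n.+1 + n.+1 - l.+1) + l * l.-1) * (P (n.+1 + n.+1 - l.+1) * P l).
    by rewrite -even_prod //; apply: eq_bigl => j.
  have PU k : P k \is a GRing.unit by rewrite pochN_unit.
  have cancel (x i y s1 s2 qa qb D d : pseries R) : x * i = 1 -> D * d = 1 ->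
      s1 * qa * d * i * (y * x * (s2 * qb * D)) = s1 * s2 * y * (qa * qb).
    move=> xi Dd; transitivity (s1 * s2 * y * (qa * qb) * (x * i) * (D * d)); first by ring.
    by rewrite xi Dd !mulr1.
  have sgn k k' : odd (k + k') = false -> (-1) ^+ k = (-1) ^+ k' :> pseries R.
    by move=> kl; rewrite -signr_odd -[RHS]signr_odd; congr (_ ^+ nat_of_bool _); lia.
  rewrite /t /A; case: leqP => nl; last first.
  - have [m em] : exists m, (l : nat) = (n.+1 + m)%N by exists (l - n.+1)%N; lia.
    have mn : (m <= n)%N by lia.
    rewrite !em; have -> : (n.+1 + m - n.+1 = m)%N by lia.
    have -> : (n.+1 + n.+1 - (n.+1 + m).+1 = n - m)%N by lia.
    have -> : Zi * q ^+ (2 * n + 1) - q ^+ (2 * (n.+1 + m)) =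
        Zi * q ^+ (2 * n + 1) * (1 - Z * q ^+ (2 * m + 1)).
      have -> : (2 * (n.+1 + m) = 2 * n + 1 + (2 * m + 1))%N by lia.
      rewrite [q ^+ (2 * n + 1 + _)]exprD.
      move: (q ^+ (2 * n + 1)) (q ^+ (2 * m + 1)) => u v.
      transitivity (Zi * u - Z * Zi * (u * v)); first by rewrite ZiK mul1r.
      by ring.
    rewrite cancel; first last.
    + by rewrite -addSnnS divrr // unitrM !PU.
    + by rewrite divrr // fac_unit // addn1.
    rewrite -exprM -exprD -(exprD (-1)).
    rewrite (sgn (m + (n.+1 + m))%N n.+1); last by lia.
    transitivity ((-1) ^+ n.+1 * Zi * q ^+ (2 * n + 1 +
      (m ^ 2 + m + (2 * (n.+1 + m) * (n - m) + (n.+1 + m) * (n.+1 + m).-1)))).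
      by rewrite [q ^+ (2 * n + 1 + _)]exprD !mulrA.
    rewrite -[RHS]mulrA -exprD; congr (_ * q ^+ _).
    have [k ek] : exists k, n = (m + k)%N by exists (n - m)%N; lia.
    have -> : (n - m = k)%N by lia.
    by rewrite ek addSn /=; nia.
  have [m em] : exists m, n = (l + m)%N by exists (n - l)%N; lia.
  have -> : (n - l = m)%N by lia.
  have -> : (n.+1 + n.+1 - l.+1 = n + m.+1)%N by lia.
  have -> : Zi * q ^+ (2 * n + 1) - q ^+ (2 * l) =
      - q ^+ (2 * l) * (1 - Zi * q ^+ (2 * m + 1)).
    have -> : (2 * n + 1 = 2 * l + (2 * m + 1))%N by lia.
    rewrite [q ^+ (2 * l + _)]exprD.
    by move: (q ^+ (2 * l)) (q ^+ (2 * m + 1)) => u v; ring.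
  have -> : (-1) ^+ m * q ^+ (m ^ 2 + m) * (P (n - m) * P (n + m.+1))^-1 *
      (Zi * q ^+ (2 * m + 1) * (1 - Zi * q ^+ (2 * m + 1))^-1) =
      ((-1) ^+ m * Zi) * q ^+ (m ^ 2 + m + (2 * m + 1)) * (P (n - m) * P (n + m.+1))^-1
        * (1 - Zi * q ^+ (2 * m + 1))^-1.
    rewrite [q ^+ (m ^ 2 + m + _)]exprD; move: (_^-1) (_^-1) => i j.
    by ring.
  rewrite cancel; first last.
  + have -> : (n - m = l)%N by lia.
    by rewrite [P (n + m.+1)%N * _]mulrC divrr // unitrM !PU.
  + by rewrite divrr // fac_unit // addn1.
  rewrite -exprM -exprD.
  transitivity ((-1) ^+ (m + l).+1 * Zi * (q ^+ (2 * l) *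
      q ^+ (m ^ 2 + m + (2 * m + 1) + (2 * l * (n + m.+1) + l * l.-1)))).
    by rewrite exprS [(-1) ^+ (m + l)]exprD; ring.
  rewrite (sgn (m + l).+1 n.+1); last by lia.
  rewrite -[RHS]mulrA -!exprD; congr (_ * q ^+ _).
  move: (nat_of_ord l) em => l' ->; case: l' => [|l'] /=; nia.
have -> : \prod_(i < n.+1 + n.+1) (Zi * q ^+ (2 * n + 1) - q ^+ (2 * i)) =
    (-1) ^+ n.+1 * (Zi ^+ n.+1 * q ^+ ((2 * n + 1) * n.+1 + n * n.+1)) * rank_prod n.
  rewrite (halvesM (fun i => Zi * q ^+ (2 * n + 1) - q ^+ (2 * i))) /rank_prod.
  have -> : (-1) ^+ n.+1 * (Zi ^+ n.+1 * q ^+ ((2 * n + 1) * n.+1 + n * n.+1)) =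
      \prod_(m < n.+1) (Zi * q ^+ (2 * n + 1)) * \prod_(m < n.+1) - q ^+ (2 * (n - m)).
    rewrite prodr_const prodrN card_ord exprMn -exprM [q ^+ (_ + _)]exprD.
    have -> : \prod_(m < n.+1) q ^+ (2 * (n - m)) = q ^+ (n * n.+1).
      rewrite (reindex_inj rev_ord_inj) /=.
      have -> : \prod_(m < n.+1) q ^+ (2 * (n - (n.+1 - m.+1))) = \prod_(m < n.+1) q ^+ (2 * m).
        by apply: eq_bigr => m _; congr (q ^+ _); have := ltn_ord m; lia.
      elim: (n) => [|k IHk]; first by rewrite big_ord1.
      by rewrite big_ord_recr /= IHk -exprD; congr (q ^+ _); nia.
    by ring.
  rewrite -!big_split; apply: eq_bigr => m _ /=; have mn := ltn_ord m.
  have -> : (2 * (n.+1 + m) = 2 * n + 1 + (2 * m + 1))%N by lia.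
  have -> : q ^+ (2 * n + 1) = q ^+ (2 * (n - m)) * q ^+ (2 * m + 1).
    by rewrite -exprD; congr (q ^+ _); lia.
  have -> : q ^+ (2 * n + 1 + (2 * m + 1)) = q ^+ (2 * (n - m)) * q ^+ (2 * m + 1) * q ^+ (2 * m + 1).
    by rewrite -!exprD; congr (q ^+ _); lia.
  move: (q ^+ (2 * (n - m))) (q ^+ (2 * m + 1)) => u v.
  transitivity ((Zi * (u * v) - Z * Zi * (u * v * v)) * (Zi * (u * v) - u)).
    by rewrite ZiK mul1r.
  by ring.
rewrite mulrCA mulVr ?mulr1; last first.
  rewrite /rank_prod; apply: rpred_prod => m _; rewrite unitrM !fac_unit //; lia.
rewrite exprMn -exprM.
have -> : Zi ^+ n.+1 = Zi * Zi ^+ n by rewrite exprS.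
have -> : ((2 * n + 1) * n.+1 + n * n.+1 = 2 * n + 1 + n * n.+1 + (2 * n + 1) * n)%N by nia.
by rewrite [q ^+ (_ + (2 * n + 1) * n)]exprD; ring.
Qed.

Lemma nsum_exchange (B : nat -> nat -> pseries R) : (forall D m, eqm D (B D m) 0) ->
  nsum (fun D => \sum_(m < D.+1) B D m) = nsum (fun m => nsum (fun r => B (m + r)%N m)).
Proof.
move=> hB; apply: pseriesP => n; rewrite /nsum !coef_sumps.
transitivity (\sum_(D < n.+1) \sum_(m < n.+1) if (m <= D)%N then B D m n else 0).
  apply: eq_bigr => D _; rewrite coef_sumps -big_mkcond.
  rewrite (@big_ord_widen _ _ _ D.+1 n.+1 (fun m => B D m n)) //.
rewrite exchange_big; apply: eq_bigr => m _ /=; rewrite coef_sumps.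
have mn : (m <= n)%N by have := ltn_ord m; lia.
rewrite -big_mkcond -(big_mkord (fun D => m <= D)%N (fun D => B D m n)).
rewrite -(big_mkord xpredT (fun r => B (m + r)%N m n)).
rewrite (big_cat_nat (n := m)) //=; last exact: leqW.
rewrite big_nat_cond big1 ?add0r => [|D]; last by lia.
rewrite [RHS](big_cat_nat (n := n.+1 - m)) //=; last by lia.
rewrite [X in _ = _ + X]big_nat_cond [X in _ = _ + X]big1 ?addr0 => [|r]; last first.
  by rewrite andbT => /andP[r1 r2]; rewrite hB //; lia.
rewrite -{1}[(m : nat)]add0n big_addn.
by apply: eq_big => [r|r _]; [rewrite leq_addl|rewrite addnC].
Qed.

(** The generating function of the odd Durfee symbols, with z marking the odd rank
    and D the subscript. *)
Definition rank_series : pseries R :=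
  nsum (fun D => q ^+ (2 * D ^ 2 + 2 * D + 1) * (rank_prod D)^-1).

(** After the exchange of the sums over D and m, the sum over D = m + r is an
    instance of [durfee]. *)
Lemma rank_series_lambert : poch R 2 2 * rank_series =
  nsum (fun m => (-1) ^+ m * q ^+ (3 * m ^ 2 + 3 * m + 1) * rank_pole m).
Proof.
pose B D m := q ^+ (2 * D ^ 2 + 2 * D + 1) *
  ((-1) ^+ m * q ^+ (m ^ 2 + m) * (P (D - m) * P (D + m.+1))^-1 * rank_pole m).
have -> : rank_series = nsum (fun D => \sum_(m < D.+1) B D m).
  by apply: eq_nsum => D; rewrite rank_partial_fractions mulr_sumr.
rewrite nsum_exchange; last by move=> D m; apply: eqm_pqX; nia.
have term m : nsum (fun r => B (m + r)%N m) =
    (poch R 2 2)^-1 * ((-1) ^+ m * q ^+ (3 * m ^ 2 + 3 * m + 1) * rank_pole m).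
  rewrite -(durfee R (2 * m + 1)) mulrC nsumM; last first.
    by move=> r; apply: eqm_pqX; nia.
  apply: eq_nsum => r; rewrite /B addKn.
  have -> : (m + r + m.+1 = r + (2 * m + 1))%N by lia.
  move: (_^-1) (rank_pole m) => i v.
  transitivity ((-1) ^+ m * v * i * (q ^+ (2 * (m + r) ^ 2 + 2 * (m + r) + 1) * q ^+ (m ^ 2 + m))).
    by ring.
  transitivity ((-1) ^+ m * v * i * (q ^+ (3 * m ^ 2 + 3 * m + 1) * q ^+ (2 * (r * (r + (2 * m + 1)))))).
    by rewrite -!exprD; congr (_ * q ^+ _); nia.
  by ring.
rewrite (eq_nsum term) nsumM.
  by apply: eq_nsum => m; rewrite mulrA divrr ?mul1r // poch_unit.
apply: summableM => m; rewrite [(-1) ^+ _ * _]mulrC -mulrA; apply: eqm_pqX; nia.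
Qed.

(** The numerator of z^t in a term of the Lambert series, for z^5 = 1 and
    denominator 1 - x^5. *)
Definition rank_num t x : pseries R :=
  if t is 0%N then 1 + x ^+ 5 else x ^+ t + x ^+ (5 - t).

Lemma rank_pole5 m : z ^+ 5 = 1 -> let x := q ^+ (2 * m + 1) in
  rank_pole m = \sum_(t < 5) Z ^+ t * (rank_num t x * (1 - q ^+ (5 * (2 * m + 1)))^-1).
Proof.
move=> z5 x; have zi : z^-1 = z ^+ 4.
  by apply: (mulfI z0); rewrite mulfV // -exprS z5.
have Zi4 : Zi = Z ^+ 4 by rewrite zi rmorphXn.
have Z5 : Z ^+ 5 = 1 by rewrite -rmorphXn /= z5 rmorph1.
have -> : q ^+ (5 * (2 * m + 1)) = x ^+ 5 by rewrite -exprM mulnC.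
have U1 : 1 - Z * x \is a GRing.unit by apply: fac_unit; lia.
have U2 : 1 - Zi * x \is a GRing.unit by apply: fac_unit; lia.
have U5 : 1 - x ^+ 5 \is a GRing.unit.
  by rewrite -exprM ps_unitE coef0_1mX ?oner_eq0 //; lia.
have e1 : (1 - Z * x)^-1 = (1 + Z * x + Z ^+ 2 * x ^+ 2 + Z ^+ 3 * x ^+ 3 + Z ^+ 4 * x ^+ 4)
    * (1 - x ^+ 5)^-1.
  apply: (mulrI U1); rewrite divrr // mulrA.
  rewrite (_ : (1 - Z * x) * _ = 1 - Z ^+ 5 * x ^+ 5); last by ring.
  by rewrite Z5 mul1r divrr.
have e2 : (1 - Zi * x)^-1 = (1 + Zi * x + Zi ^+ 2 * x ^+ 2 + Zi ^+ 3 * x ^+ 3 + Zi ^+ 4 * x ^+ 4)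
    * (1 - x ^+ 5)^-1.
  apply: (mulrI U2); rewrite divrr // mulrA.
  rewrite (_ : (1 - Zi * x) * _ = 1 - Zi ^+ 5 * x ^+ 5); last by ring.
  by rewrite Zi4 -exprM mulnC exprM Z5 expr1n mul1r divrr.
rewrite /rank_pole -/x e1 e2 Zi4 !big_ord_recl big_ord0 /rank_num /=.
rewrite /bump /= !addn0 !add1n.
have Zr k : Z ^+ (k + 5) = Z ^+ k by rewrite exprD Z5 mulr1.
move: (_^-1) => i.
transitivity (((1 + Z * x + Z ^+ 2 * x ^+ 2 + Z ^+ 3 * x ^+ 3 + Z ^+ 4 * x ^+ 4) +
  (Z ^+ 4 * x + Z ^+ (3 + 5) * x ^+ 2 + Z ^+ (2 + 5 + 5) * x ^+ 3 + Z ^+ (1 + 5 + 5 + 5) * x ^+ 4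
   + Z ^+ (0 + 5 + 5 + 5 + 5) * x ^+ 5)) * i); first by ring.
by rewrite !Zr; ring.
Qed.

End RankLambert.

(** * Counting odd Durfee symbols *)

Section Counting.
Variable R : fieldType.
Local Notation q := (pq R).

Definition odd_row (k : nat) (a : seq nat) : bool :=
  [&& all odd a, sorted geq a & all (fun x => x < 2 * k)%N a].

Lemma odd_durfee_rowE D a : odd_durfee_row D a = odd_row D.+1 a.
Proof.
rewrite /odd_durfee_row /odd_row; congr [&& _, _ & _]; apply: eq_all => x.
by apply/idP/idP; lia.
Qed.

Definition rows n : seq (seq nat) := [seq [seq val i | i <- x] | x : n.-bseq 'I_n.+1].

Lemma rows_uniq n : uniq (rows n).
Proof.
rewrite map_inj_uniq ?enum_uniq // => x y /(inj_map val_inj) e.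
exact: val_inj.
Qed.

Lemma mem_rows n k a : odd_row k a -> (sumn a <= n)%N -> a \in rows n.
Proof.
case: k => [|D]; first by case: a => [|x a] /and3P[_ _] //= _ _; apply/mapP;
  have [//|//|x' ex'] := @row_bseq n [::]; exists x'; rewrite ?mem_enum.
rewrite -odd_durfee_rowE => oa sa; have [||x ex] := @row_bseq n a => //.
  by apply: leq_trans (odd_durfee_row_size oa) sa.
by rewrite -ex; apply/mapP; exists x; rewrite ?mem_enum.
Qed.

(** The generating function of the rows with entries at most 2 k - 1, where c marks
    the length of the row. *)
Definition row_series (k : nat) (c : R) : pseries R :=
  fun n => \sum_(a <- rows n | odd_row k a && (sumn a == n)) c ^+ size a.

(** The finite list over which the rows are enumerated does not matter, as long as
    it contains all the rows that are counted. *)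
Lemma sum_rows n (p : pred (seq nat)) (s : seq (seq nat)) (F : seq nat -> R) : uniq s ->
  (forall a, p a -> (a \in s) = (a \in rows n)) ->
  \sum_(a <- rows n | p a) F a = \sum_(a <- s | p a) F a.
Proof.
move=> us ps; rewrite -big_filter -[RHS]big_filter; apply: perm_big.
apply: uniq_perm; rewrite ?filter_uniq ?rows_uniq // => a.
by rewrite !mem_filter; case: (boolP (p a)) => // /ps ->.
Qed.

Lemma row_seriesE k c n i : (i <= n)%N ->
  row_series k c i = \sum_(a <- rows n | odd_row k a && (sumn a == i)) c ^+ size a.
Proof.
move=> lein; apply: sum_rows; first exact: rows_uniq.
by move=> a /andP[oa /eqP sa]; rewrite !(mem_rows oa) ?sa.
Qed.

(** A row with entries at most 2 k + 1 either has largest entry 2 k + 1, which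
    may be removed, or has entries at most 2 k - 1. *)
Lemma row_seriesS k c :
  row_series k.+1 c = row_series k c + psC c * q ^+ (2 * k + 1) * row_series k.+1 c.
Proof.
apply: pseriesP => n; rewrite coefDps -mulrA coefCM coef_pqXM.
rewrite [LHS](bigID (odd_row k)) /=; congr (_ + _).
  apply: eq_bigl => a; rewrite andbC andbA; congr (_ && _).
  apply/andb_idr; case/and3P=> oa sa la; apply/and3P; split=> //.
  by apply: sub_all la => x; lia.
have top a : odd_row k.+1 a && ~~ odd_row k a ->
    exists2 a', a = (2 * k + 1)%N :: a' & odd_row k.+1 a'.
  case: a => [|x a] /andP[/and3P[oa sa la]]; first by [].
  move: oa la => /= /andP[ox oa] /andP[lx la] nk.
  exists a; last by rewrite /odd_row oa la (path_sorted sa).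
  congr (_ :: _); suff : ~~ (x < 2 * k)%N by lia.
  apply: contra nk => xk; rewrite /odd_row /= ox oa (sa : path geq x a) xk.
  apply/allP => y ya; have /allP/(_ y ya) := order_path_min (rev_trans leq_trans) sa.
  by move=> /= yx; apply: leq_ltn_trans yx xk.
have cons_ok a : odd_row k.+1 a -> odd_row k.+1 ((2 * k + 1)%N :: a).
  case/and3P=> oa sa la; rewrite /odd_row /= oa la.
  apply/and3P; split; [by lia| |by lia].
  case: a sa la {oa} => //= y a -> /andP[yk _]; rewrite andbT; lia.
have cons_no a : ~~ odd_row k ((2 * k + 1)%N :: a).
  by apply/negP => /and3P[_ _ /= /andP[]]; lia.
case: ltnP => nk.
  rewrite mulr0 big1_seq // => a /andP[/andP[/andP[oa /eqP sa] na] _].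
  have [|a' ea _] := top a; first by rewrite oa na.
  by move: sa; rewrite ea /=; lia.
rewrite (@row_seriesE _ _ n); last by lia.
rewrite mulr_sumr -big_filter -[RHS]big_filter.
rewrite (@perm_big _ _ _ _ _ [seq (2 * k + 1)%N :: a | a <-
  [seq a <- rows n | odd_row k.+1 a && (sumn a == (n - (2 * k + 1))%N)]]).
  by rewrite big_map; apply: eq_bigr => a _; rewrite exprS.
apply: uniq_perm; rewrite ?filter_uniq ?rows_uniq //.
  by rewrite map_inj_uniq ?filter_uniq ?rows_uniq // => a b [].
move=> a; rewrite mem_filter; apply/idP/mapP.
  case/andP=> /andP[/andP[oa /eqP sa] na] _.
  have [|a' ea oa'] := top a; first by rewrite oa na.
  move: sa; rewrite ea /= => sa; exists a' => //.
  by rewrite mem_filter oa' (mem_rows oa') ?andbT /=; [apply/eqP|]; lia.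
case=> a'; rewrite mem_filter => /andP[/andP[oa' /eqP sa'] _] ->.
have oa := cons_ok _ oa'; rewrite oa cons_no (mem_rows oa) /= sa' ?andbT; last by lia.
by apply/eqP; lia.
Qed.

Lemma row_series0 c : row_series 0 c = 1.
Proof.
apply: pseriesP => n; rewrite coef1ps /row_series.
have e a : odd_row 0 a && (sumn a == n) = (a == [::]) && (n == 0)%N.
  case: a => [|x a] /=; first by rewrite /odd_row /= eq_sym.
  by apply/negbTE/negP => /andP[/and3P[_ _]].
rewrite (eq_bigl _ _ e); case: eqP => [->|_]; last first.
  by rewrite big_pred0 // => a; rewrite andbF.
rewrite (sum_rows (s := [:: [::]])) //; first by rewrite big_cons big_nil eqxx addr0.
by move=> a /andP[/eqP-> _]; rewrite inE eqxx; apply: esym; apply: (@mem_rows 0 0).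
Qed.

Lemma row_series_prod k c :
  row_series k c * \prod_(i < k) (1 - psC c * q ^+ (2 * i + 1)) = 1.
Proof.
elim: k => [|k IHk]; first by rewrite row_series0 big_ord0 mulr1.
rewrite big_ord_recr /= mulrA mulrAC.
suff -> : row_series k.+1 c * (1 - psC c * q ^+ (2 * k + 1)) = row_series k c by [].
by rewrite mulrBr mulr1 {1}row_seriesS; ring.
Qed.

Lemma rank_prod_rows (z : R) D :
  (rank_prod z D)^-1 = row_series D.+1 z * row_series D.+1 z^-1.
Proof.
have e := row_series_prod D.+1 z; have e' := row_series_prod D.+1 z^-1.
have U : rank_prod z D \is a GRing.unit.
  by rewrite /rank_prod; apply: rpred_prod => m _; rewrite unitrM !fac_unit //; lia.
apply: (mulIr U); rewrite mulVr // /rank_prod big_split /=.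
by rewrite mulrACA e e' mulr1.
Qed.

End Counting.

Lemma odd_rank_bound n (s : bounded_array n) : `|odd_rank (array_of s)| <= n%:Z.
Proof.
rewrite /odd_rank /= !size_map.
by move: (size _) (size _) (size_bseq s.1.1) (size_bseq s.1.2) => x y; lia.
Qed.

(** A symbol is counted for the single index i of the defining sum for which i - n
    is its rank. *)
Lemma N0modE m k n : N0mod m k n =
  (\sum_(s : bounded_array n | odd_durfee_symbol n (array_of s))
    (odd_rank (array_of s) == m %[mod k])%Z)%N.
Proof.
have N0E r : N0 r n = (\sum_(s : bounded_array n | odd_durfee_symbol n (array_of s))
    (odd_rank (array_of s) == r))%N.
  rewrite /N0 -sum1_card big_mkcond [RHS]big_mkcond; apply: eq_bigr => s _.
  by rewrite inE; case: ifP => /andP; case: odd_durfee_symbol; case: (_ == r) => // -[].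
rewrite /N0mod (eq_bigr _ (fun (i : 'I_(2 * n).+1) _ => N0E _)) exchange_big /=.
apply: eq_bigr => s _; have := odd_rank_bound s; set r := odd_rank _ => rn.
have ir : (absz (r + n%:Z)%R < (2 * n).+1)%N by lia.
case: (boolP (r == m %[mod k])%Z) => rm.
  rewrite (bigD1 (Ordinal ir)) /=; last first.
    have -> : (absz (r + n%:Z)%R)%:Z - n%:Z = r by lia.
    by [].
  rewrite big1 ?addn0 => [|i /andP[_]]; first by apply/eqP; lia.
  by rewrite -val_eqE /= => ni; apply/eqP; lia.
rewrite big1 // => i im; apply/eqP; rewrite eqb0; apply: contra rm => /eqP->.
exact: im.
Qed.

Section Symbols.
Variable R : fieldType.
Local Notation q := (pq R).

(** A symbol is a subscript with two rows, each enumerated by [row_series]. *)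
Lemma rank_series_symbols (z : R) n : rank_series z n =
  \sum_(s : bounded_array n | odd_durfee_symbol n (array_of s))
    z ^+ size (top_row (array_of s)) * z^-1 ^+ size (bottom_row (array_of s)).
Proof.
pose e D := (2 * D ^ 2 + 2 * D + 1)%N.
pose f D a b := odd_row D.+1 a && odd_row D.+1 b && (n == sumn a + sumn b + e D)%N.
transitivity (\sum_(D < n.+1) \sum_(a <- rows n) \sum_(b <- rows n)
    if f D a b then z ^+ size a * z^-1 ^+ size b else 0).
  rewrite /rank_series /nsum coef_sumps; apply: eq_bigr => D _.
  rewrite rank_prod_rows coef_pqXM; case: ltnP => eD.
    rewrite big1 // => a _; rewrite big1 // => b _; rewrite ifF //.
    by rewrite /f /e; apply/negbTE/negP => /andP[_]; lia.
  rewrite coefMps.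
  under eq_bigr => k _.
    rewrite (@row_seriesE _ _ _ n); last by have := ltn_ord k; lia.
    rewrite (@row_seriesE _ _ z^-1 n); last by lia.
    rewrite big_mkcond mulr_suml.
    under eq_bigr => a _ do rewrite [X in _ * X]big_mkcond mulr_sumr.
  over.
  rewrite exchange_big; apply: eq_bigr => a _ /=; rewrite exchange_big; apply: eq_bigr => b _ /=.
  rewrite /f; case: (odd_row D.+1 a) => /=; last by rewrite big1 // => k _; rewrite mul0r.
  case: (odd_row D.+1 b) => /=; last by rewrite big1 // => k _; rewrite mulr0.
  case: eqP => en.
    have ka : (sumn a < (n - (2 * D ^ 2 + 2 * D + 1)).+1)%N by rewrite /e in en; lia.
    rewrite (bigD1 (Ordinal ka)) //= eqxx.
    have -> : (sumn b == n - (2 * D ^ 2 + 2 * D + 1) - sumn a)%N by rewrite /e in en; lia.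
    rewrite big1 ?addr0 // => k; rewrite -val_eqE /= => kn.
    by rewrite ifF ?mul0r //; lia.
  rewrite big1 // => k _; case: eqP => ea; last by rewrite mul0r.
  rewrite ifF ?mulr0 //; apply/negbTE/negP => /eqP eb; apply: en.
  by rewrite /e; have := ltn_ord k; lia.
rewrite [RHS]big_mkcond /=.
rewrite -(pair_bigA _ (fun (p : n.-bseq 'I_n.+1 * n.-bseq 'I_n.+1) (D : 'I_n.+1) =>
  if odd_durfee_symbol n (array_of (p, D)) then
   z ^+ size (top_row (array_of (p, D))) * z^-1 ^+ size (bottom_row (array_of (p, D))) else 0)) /=.
rewrite [RHS]exchange_big; apply: eq_bigr => D _ /=.
rewrite -(pair_bigA _ (fun (a b : n.-bseq 'I_n.+1) =>
  if odd_durfee_symbol n (array_of (a, b, D)) then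
   z ^+ size (top_row (array_of (a, b, D))) * z^-1 ^+ size (bottom_row (array_of (a, b, D))) else 0)) /=.
rewrite /rows big_map big_enum; apply: eq_bigr => a _ /=.
rewrite big_map big_enum; apply: eq_bigr => b _ /=.
congr (if _ then _ else _).
by rewrite /f /odd_durfee_symbol /= !odd_durfee_rowE -andbA.
Qed.

End Symbols.

Section RankClasses.
Variable R : fieldType.
Local Notation q := (pq R).

Definition N0mod_series t : pseries R := fun n => (N0mod t%:Z 5 n)%:R.

Lemma rank_series_N0mod (z : R) : z ^+ 5 = 1 ->
  rank_series z = \sum_(t < 5) psC (z ^+ t) * N0mod_series t.
Proof.
move=> z5; have z0 : z != 0.
  by apply: contra_eq_neq z5 => ->; rewrite expr0n /= eq_sym oner_eq0.
have zi : z^-1 = z ^+ 4 by apply: (mulfI z0); rewrite mulfV // -exprS z5.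
apply: pseriesP => n; rewrite coef_sumps rank_series_symbols.
under [RHS]eq_bigr => t _ do rewrite coefCM /N0mod_series N0modE natr_sum mulr_sumr.
rewrite exchange_big; apply: eq_bigr => s _ /=; set a := size _; set b := size _.
rewrite zi -exprM -exprD.
have t0 : ((a + 4 * b) %% 5 < 5)%N by rewrite ltn_mod.
rewrite (bigD1 (Ordinal t0)) //= big1 ?addr0 => [|t].
  rewrite (_ : (_ == _ %[mod 5])%Z) ?mulr1 ?expr_mod //.
  by rewrite /odd_rank -/a -/b; lia.
rewrite -val_eqE /= => tn; rewrite (_ : (_ == _ %[mod 5])%Z = false) ?mulr0 //.
apply/negbTE; apply: contra tn; rewrite /odd_rank -/a -/b => e; have := ltn_ord t; lia.
Qed.

Definition rank_class_series t : pseries R :=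
  nsum (fun m => (-1) ^+ m * q ^+ (3 * m ^ 2 + 3 * m + 1) *
    (rank_num t (q ^+ (2 * m + 1)) * (1 - q ^+ (5 * (2 * m + 1)))^-1)).

Lemma rank_class_summable t : summable (fun m => (-1) ^+ m * q ^+ (3 * m ^ 2 + 3 * m + 1) *
    (rank_num t (q ^+ (2 * m + 1)) * (1 - q ^+ (5 * (2 * m + 1)))^-1)).
Proof.
by move=> m; rewrite [(-1) ^+ _ * _]mulrC -mulrA; apply: eqm_pqX; nia.
Qed.

Lemma rank_classes_relation (z : R) : z ^+ 5 = 1 ->
  \sum_(t < 5) psC (z ^+ t) * (poch R 2 2 * N0mod_series t - rank_class_series t) = 0.
Proof.
move=> z5; have z0 : z != 0.
  by apply: contra_eq_neq z5 => ->; rewrite expr0n /= eq_sym oner_eq0.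
have e := rank_series_lambert z0; move: e; rewrite rank_series_N0mod //.
rewrite (eq_nsum (G := fun m => \sum_(t < 5) psC (z ^+ t) * ((-1) ^+ m * q ^+ (3 * m ^ 2 + 3 * m + 1) *
    (rank_num t (q ^+ (2 * m + 1)) * (1 - q ^+ (5 * (2 * m + 1)))^-1)))); last first.
  move=> m; rewrite rank_pole5 // mulr_sumr; apply: eq_bigr => t _.
  by rewrite rmorphXn mulrCA.
have -> : nsum (fun m => \sum_(t < 5) psC (z ^+ t) * ((-1) ^+ m * q ^+ (3 * m ^ 2 + 3 * m + 1) *
    (rank_num t (q ^+ (2 * m + 1)) * (1 - q ^+ (5 * (2 * m + 1)))^-1))) =
    \sum_(t < 5) psC (z ^+ t) * rank_class_series t.
  transitivity (\sum_(t < 5) nsum (fun m => psC (z ^+ t) * ((-1) ^+ m * q ^+ (3 * m ^ 2 + 3 * m + 1) *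
    (rank_num t (q ^+ (2 * m + 1)) * (1 - q ^+ (5 * (2 * m + 1)))^-1)))).
    by apply: pseriesP => n; rewrite [LHS]/nsum exchange_big !coef_sumps.
  by apply: eq_bigr => t _; rewrite nsumM //; apply: rank_class_summable.
move=> e; under eq_bigr => t _ do rewrite mulrBr mulrCA.
by rewrite sumrB -mulr_sumr e subrr.
Qed.

End RankClasses.

(** For each n, [rank_classes_relation] says that a polynomial in z of degree less
    than 5 vanishes at the five fifth roots of unity. *)
Lemma rank_class_lambert (t : 'I_5) :
  poch algC 2 2 * N0mod_series algC t = rank_class_series algC t.
Proof.
have [w wP] := C_prim_root_exists (isT : (0 < 5)%N).
apply/eqP; rewrite -subr_eq0; apply/eqP; apply: pseriesP => n; rewrite coef0ps.
pose c (i : nat) := (poch algC 2 2 * N0mod_series algC i - rank_class_series algC i) n.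
pose p : {poly algC} := \poly_(i < 5) c i.
suff p0 : p = 0 by have := congr1 (fun u : {poly algC} => u`_t) p0; rewrite coef_poly ltn_ord coef0.
apply: (@roots_geq_poly_eq0 _ _ [seq w ^+ (i : 'I_5) | i <- enum 'I_5]).
- apply/allP => _ /mapP[i _ ->]; rewrite /root /p horner_poly.
  have wi5 : (w ^+ i) ^+ 5 = 1 by rewrite exprAC (prim_expr_order wP) expr1n.
  have := congr1 (@^~ n) (rank_classes_relation wi5); rewrite coef_sumps coef0ps => e.
  by rewrite -[X in _ == X]e; apply/eqP; apply: eq_bigr => j _; rewrite coefCM mulrC.
- rewrite map_inj_uniq ?enum_uniq // => i j /eqP; rewrite (eq_prim_root_expr wP).
  by rewrite !modn_small // => /eqP/val_inj.
by rewrite size_map size_enum_ord size_poly.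
Qed.

(** ** From integer to complex coefficients *)

Definition toC (f : fps) : pseries algC := fun n => (f n)%:~R.

Lemma toC_mul f g : toC (fps_mul f g) = toC f * toC g.
Proof.
apply: pseriesP => n; rewrite coefMps /toC /fps_mul rmorph_sum.
by apply: eq_bigr => i _; rewrite rmorphM.
Qed.

Lemma toC1 : toC fps1 = 1.
Proof. by apply: pseriesP => n; rewrite /toC /fps1 coef1ps; case: eqP. Qed.

Lemma toC_X : toC fpsX = pq algC.
Proof. by apply: pseriesP => n; rewrite /toC /fpsX /pq; case: eqP. Qed.

Lemma toC_qpoch a b : toC (qpoch a b) = poch algC a b.
Proof.
have aux N i : ((\prod_(j < N) (1 - 'X^(a + j * b)) : {poly int})`_i)%:~R = pochN algC a b N i.
  elim: N i => [|N IHN] i; first by rewrite big_ord0 pochN0 coef1 coef1ps; case: eqP.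
  rewrite big_ord_recr pochNS /= !mulrBr !mulr1 coefB coefMXn coefBps mulrC coef_pqXM rmorphB /= IHN.
  by case: ifP => _; rewrite ?rmorph0 // IHN.
by apply: pseriesP => n; apply: aux.
Qed.

Lemma toC_inv f : f 0%N = 1 -> toC (fps_inv f) = (toC f)^-1.
Proof.
move=> f0; have U : toC f \is a GRing.unit by rewrite ps_unitE /toC f0 oner_eq0.
apply: (mulrI U); rewrite divrr // -toC_mul -toC1.
by apply: pseriesP => n; rewrite /toC fps_mulV.
Qed.

Lemma toC_bracket1 a : toC (qbracket [:: a] 10) = brac algC a.
Proof. by rewrite /qbracket /= !toC_mul !toC_qpoch toC1 mulr1. Qed.

Lemma toC_bracket2 a b : toC (qbracket [:: a; b] 10) = brac algC a * brac algC b.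
Proof. by rewrite /qbracket /= !toC_mul !toC_qpoch toC1 mulr1 mulrA. Qed.

Lemma toC_quotient a : toC (fps_div (fps_mul (J 10) (qbracket [:: a] 10)) (qbracket [:: 2%N; 4%N] 10)) =
  poch algC 10 10 * brac algC a / (brac algC 2 * brac algC 4).
Proof.
have b0 : qbracket [:: 2%N; 4%N] 10 0%N = 1.
  apply: (@intr_inj algC); rewrite -[LHS]/(toC _ 0%N) toC_bracket2 /brac !coef0M.
  by rewrite !poch_coef0 // !mulr1.
by rewrite toC_mul (toC_inv b0) toC_mul toC_bracket1 toC_bracket2 toC_qpoch.
Qed.

Lemma rank_difference :
  poch algC 2 2 * (N0mod_series algC 1 - N0mod_series algC 2) = Lser algC.
Proof.
have e1 := rank_class_lambert (Ordinal (isT : (1 < 5)%N)).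
have e2 := rank_class_lambert (Ordinal (isT : (2 < 5)%N)).
rewrite mulrBr e1 e2 /rank_class_series -nsumN -nsumD; apply: eq_nsum => m.
rewrite /rank_num /=; set x := pq algC ^+ (2 * m + 1).
have -> : pq algC ^+ (2 * (2 * m + 1)) = x ^+ 2 by rewrite -exprM mulnC.
have -> : pq algC ^+ (3 * (2 * m + 1)) = x ^+ 3 by rewrite -exprM mulnC.
have -> : pq algC ^+ (4 * (2 * m + 1)) = x ^+ 4 by rewrite -exprM mulnC.
by move: (_^-1) => i; ring.
Qed.

Theorem mainTheorem5 :
  [/\ (fun n : nat =>
         (N0mod 1 5 (5 * n + 1))%:Z - (N0mod 2 5 (5 * n + 1))%:Z)
        =1 fps_mul fpsX
             (fps_div (fps_mul (J 10) (qbracket [:: 1%N] 10))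
                      (qbracket [:: 2%N; 4%N] 10)),
      (fun n : nat =>
         (N0mod 1 5 (5 * n + 2))%:Z - (N0mod 2 5 (5 * n + 2))%:Z)
        =1 fps_div (fps_mul (J 10) (qbracket [:: 5%N] 10))
                   (qbracket [:: 2%N; 4%N] 10)
    & (fun n : nat =>
         (N0mod 1 5 (5 * n + 3))%:Z - (N0mod 2 5 (5 * n + 3))%:Z)
        =1 fps_opp
             (fps_div (fps_mul (J 10) (qbracket [:: 3%N] 10))
                      (qbracket [:: 2%N; 4%N] 10))].
Proof.
pose H := N0mod_series algC 1 - N0mod_series algC 2.
have algC2 : (2%:R : algC) != 0 by rewrite pnatr_eq0.
have [h1 h2 h3] := sections_of_quotient algC2 rank_difference; rewrite -/H in h1 h2 h3.
have PU : poch algC 10 10 \is a GRing.unit by rewrite poch_unit.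
have B2 : brac algC 2 \is a GRing.unit by rewrite brac_unit.
have B4 : brac algC 4 \is a GRing.unit by rewrite brac_unit.
have quo (f : pseries algC) (g : pseries algC) :
    theta algC 2 * theta algC 4 * f = poch algC 10 10 ^+ 2 * g ->
    f = g / (brac algC 2 * brac algC 4).
  rewrite !theta_brac // => e; apply: (canRL (mulrK _)); first by rewrite unitrM B2.
  have PPU : poch algC 10 10 ^+ 2 \is a GRing.unit by rewrite unitrX.
  by apply: (mulrI PPU); rewrite -e; ring.
have HE c n : (sect 5 c H) n =
    ((N0mod 1 5 (5 * n + c))%:Z - (N0mod 2 5 (5 * n + c))%:Z)%:~R.
  by rewrite /sect rmorphB mulnC.
have fin c n (f : fps) : sect 5 c H = toC f ->
    (N0mod 1 5 (5 * n + c))%:Z - (N0mod 2 5 (5 * n + c))%:Z = f n.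
  by move=> e; apply: (@intr_inj algC); rewrite -HE e.
split=> n; apply: fin.
- rewrite toC_mul toC_X toC_quotient mulrA; apply: quo.
  by rewrite h1 theta_brac //; ring.
- by rewrite toC_quotient; apply: quo; rewrite h2 theta_brac.
have -> g : toC (fps_opp g) = - toC g by apply: pseriesP => k; rewrite /toC rmorphN.
by rewrite toC_quotient -mulNr; apply: quo; rewrite h3 theta_brac // mulrN.
Qed.
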